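(* For any $h_1,h_2\in[0,1]$, $$\frac{\int_{\theta}^{\tau}y(s)^{2(\gamma-h_1)}\,ds}{\int_{\theta}^{\tau}y(s)^{2(\gamma-h_2)}\,ds}=\frac{\log|Y_{h_1}(\tau)|}{\log|Y_{h_2}(\tau)|}\quad\text{almost surely}.$$
   Context: Let $\theta\in\mathbb{R}$ and $T\in(\theta,+\infty)$ be given, together with a complete probability space $(\Omega,\mathcal{F},\mathbf{P})$ and a right-continuous filtration $\{\mathcal{F}_t\}_{t\in[\theta,T]}$ of complete $\sigma$-algebras of events. Let $w(t)$, $t\in[\theta,T]$, be a one-dimensional Wiener process with $w(\theta)=0$, adapted to $\{\mathcal{F}_t\}$, such that $\mathcal{F}_t$ is independent of $w(s)-w(q)$ whenever $s>q\ge t$. Let $\gamma\in[0,1]$, and let $\sigma>0$ be a constant. Let $f(s,t):C([\theta,T])\times[\theta,T]\to\mathbb{R}$ be a measurable (possibly random) function such that $f(s,t)$ is $\mathcal{F}_t$-adapted for any $s\in C([\theta,T])$, and $f(s_1,t)=f(s_2,t)$ if $(s_1-s_2)|_{[\theta,t]}\equiv 0$. For any $\delta>0$ there are constants $c_k=c_k(\delta)>0$, $k=1,2$, such that, almost surely, $|f(s_1,t)-f(s_2,t)|\le c_1\|s_1-s_2\|_{C([\theta,T])}$ and $|f(s,t)|\le c_2(\|s\|_{C([\theta,T])}+1)$ for all $t\in[\theta,T]$ and all $s,s_1,s_2\in C([\theta,T])$ whose infimum over $[\theta,T]$ is larger than $\delta$. The process $y$ is the real-valued almost surely continuous $\mathcal{F}_t$-adapted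 solution, with $y(\theta)>0$, of the Itô equation $$dy(t)=f(y(\cdot),t)\,dt+\sigma\,y(t)^{\gamma}\,dw(t)$$ on $[\theta,\tau]$, where $\tau$ is a Markov time (stopping time) with respect to $\{\mathcal{F}_t\}$ such that $\tau\in(\theta,T]$ a.s. and $\inf_{s\in[\theta,\tau]}y(s)>0$ a.s. For $h\in[0,1]$, $Y_h(s)$, $s\in[\theta,\tau]$, is the complex-valued process satisfying the Itô equation (driven by the continuous semimartingale $y$, with $i=\sqrt{-1}$) $$dY_h(s)=i\,Y_h(s)\,\frac{dy(s)}{y(s)^h},\quad s\in(\theta,\tau),\qquad Y_h(\theta)=1.$$ *)

(* Defs.v *)
From mathcomp Require Import all_boot all_order all_algebra.
From mathcomp Require Import complex.
From mathcomp Require Import all_classical all_reals all_analysis measurable_realfun.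
Set Implicit Arguments.
Unset Strict Implicit.
Unset Printing Implicit Defensive.
Import Order.TTheory GRing.Theory Num.Theory.
Import numFieldNormedType.Exports.

Local Open Scope classical_set_scope.
Local Open Scope ring_scope.

Notation lambda R := (@lebesgue_measure R).

(** Processes indexed by [[theta, T]] are total maps [R -> Omega -> V]; their
    values at times outside [[theta, T]] are never used. *)
Section filtrations.
Context (d : measure_display) (Omega : measurableType d) (R : realType).
Variable P : probability Omega R.

Definition meas_wrt (G : set (set Omega)) (X : Omega -> R) : Prop :=
  forall B : set R, measurable B -> G (X @^-1` B).

Definition independent_of (G : set (set Omega)) (X : Omega -> R) : Prop :=
  forall (A : set Omega) (B : set R), G A -> measurable B ->
    P (A `&` X @^-1` B) = (P A * P (X @^-1` B))%E.

Record is_filtration (theta T : R) (F : R -> set (set Omega)) : Prop := {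
  filt_sigma : forall t, theta <= t <= T -> sigma_algebra setT (F t);
  filt_sub : forall t, theta <= t <= T -> F t `<=` measurable;
  filt_mono : forall s t, theta <= s -> s <= t -> t <= T -> F s `<=` F t;
  filt_complete : forall t, theta <= t <= T -> P.-negligible `<=` F t;
  filt_right_cont : forall t, theta <= t < T ->
    \bigcap_(s in `]t, T]) F s `<=` F t }.

(** The second argument of [normal_prob] is the standard deviation.
    Independence of the increments of [w] follows from [wiener_indep] together
    with [wiener_adapted]. *)
Record is_wiener (theta T : R) (F : R -> set (set Omega)) (w : R -> Omega -> R)
    : Prop := {
  wiener_start : {ae P, forall x, w theta x = 0};
  wiener_cont : {ae P, forall x, {within `[theta, T], continuous (w ^~ x)}};
  wiener_adapted : forall t, theta <= t <= T -> meas_wrt (F t) (w t);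
  wiener_normal : forall q s, theta <= q -> q < s -> s <= T ->
    forall B : set R, measurable B ->
      P ((fun x => w s x - w q x) @^-1` B)
        = normal_prob 0 (Num.sqrt (s - q)) B;
  wiener_indep : forall t q s, theta <= t -> t <= q -> q < s -> s <= T ->
    independent_of (F t) (fun x => w s x - w q x) }.

Definition stopping_time (theta T : R) (F : R -> set (set Omega))
    (tau : Omega -> R) : Prop :=
  forall t, theta <= t <= T -> F t [set x | tau x <= t].

Definition stopped (V : Type) (tau : Omega -> R) (X : R -> Omega -> V)
    : R -> Omega -> V :=
  fun t x => X (Num.min t (tau x)) x.

(** A process given on the random interval [[theta, tau]] is adapted and
    continuous when the stopped process is. *)
Definition adapted_continuous (theta T : R) (F : R -> set (set Omega))
    (tau : Omega -> R) (X : R -> Omega -> R) : Prop :=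
  (forall t, theta <= t <= T -> meas_wrt (F t) (stopped tau X t)) /\
  {ae P, forall x, {within `[theta, T], continuous (stopped tau X ^~ x)}}.

End filtrations.

Section ito.
Context (d : measure_display) (Omega : measurableType d) (R : realType).
Variables (P : probability Omega R) (theta T : R).
Variables (F : R -> set (set Omega)) (w : R -> Omega -> R).

(** Adapted and, up to indistinguishability, jointly measurable. Joint
    measurability is only asked up to a null set of outcomes because the paths
    of the processes considered are continuous only almost surely and the
    product sigma-algebra is not complete. *)
Definition measurable_adapted (H : R -> Omega -> R) : Prop :=
  (exists2 K : R -> Omega -> R,
      measurable_fun (`[theta, T]%classic `*` [set: Omega])
        (fun z : R * Omega => K z.1 z.2) &
      {ae P, forall x, forall s, theta <= s <= T -> H s x = K s x}) /\
  (forall s, theta <= s <= T -> meas_wrt (F s) (H s)).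

Definition ito_integrand (H : R -> Omega -> R) : Prop :=
  measurable_adapted H /\
  {ae P, forall x,
    (\int[lambda R]_(s in `[theta, T]) ((H s x) ^+ 2)%:E < +oo)%E}.

(** The simple process [\sum_(i < n) xi_i 1_(t_i, t_i+1]], where [xi_i] is
    bounded and measurable with respect to [F t_i]. *)
Record simple_data := SimpleData {
  sp_size : nat;
  sp_time : nat -> R;
  sp_coef : nat -> Omega -> R }.

Definition is_simple (S : simple_data) : Prop :=
  [/\ forall i, (i <= sp_size S)%N -> theta <= sp_time S i <= T,
      forall i, (i < sp_size S)%N -> sp_time S i <= sp_time S i.+1,
      forall i, (i < sp_size S)%N -> meas_wrt (F (sp_time S i)) (sp_coef S i) &
      exists M : R, forall i x, (i < sp_size S)%N -> `|sp_coef S i x| <= M].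

Definition simple_process (S : simple_data) (s : R) (x : Omega) : R :=
  \sum_(i < sp_size S)
    sp_coef S i x * \1_(`]sp_time S i, sp_time S i.+1]) s.

Definition simple_integral (S : simple_data) (t : R) (x : Omega) : R :=
  \sum_(i < sp_size S)
    sp_coef S i x *
      (w (Num.min (sp_time S i.+1) t) x - w (Num.min (sp_time S i) t) x).

(** Convergence to 0 in probability, for nonnegative [V n]. *)
Definition cvg_prob0 (V : nat -> Omega -> \bar R) : Prop :=
  (forall n, measurable_fun setT (V n)) /\
  forall e : R, 0 < e -> P [set x | (e%:E <= V n x)%E] @[n --> \oo] --> 0%E.

(** [X] is (a version of) the Itô integral of [H] with respect to [w] over
    [[theta, t]]. *)
Definition is_ito_integral (H : R -> Omega -> R) (t : R) (X : Omega -> R)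
    : Prop :=
  [/\ ito_integrand H,
      measurable_fun setT X &
      exists S : nat -> simple_data,
        [/\ forall n, is_simple (S n),
            cvg_prob0 (fun n x => \int[lambda R]_(s in `[theta, t])
              ((H s x - simple_process (S n) s x) ^+ 2)%:E)%E &
            cvg_prob0 (fun n x => `|simple_integral (S n) t x - X x|%:E)]].

Definition until (tau : Omega -> R) (b : R -> Omega -> R) : R -> Omega -> R :=
  fun s x => if s <= tau x then b s x else 0.

(** [dX = a dt + b dw] on [[theta, tau]]: for every [t],
    [X (min t tau) = X theta + \int_theta^(min t tau) a ds
                             + \int_theta^t 1_(s <= tau) b dw]. *)
Definition ito_equation (tau : Omega -> R) (a b X : R -> Omega -> R) : Prop :=
  [/\ measurable_adapted (until tau a),
      {ae P, forall x,
        (lambda R).-integrable `[theta, tau x] (fun s => (a s x)%:E)} &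
      forall t, theta <= t <= T ->
        is_ito_integral (until tau b) t
          (fun x => stopped tau X t x - X theta x
             - \int[lambda R]_(s in `[theta, Num.min t (tau x)]) a s x)].

(** [dZ = H dX] on [[theta, tau]], for complex-valued [Z] and [H] and a real
    Itô process [X] with [dX = a dt + b dw]; as usual,
    [H dX = H a dt + H b dw]. *)
Definition complex_ito_driven (tau : Omega -> R)
    (H : R -> Omega -> R[i]) (a b X : R -> Omega -> R)
    (Z : R -> Omega -> R[i]) : Prop :=
  [/\ ito_equation tau a b X,
      ito_equation tau (fun s x => complex.Re (H s x) * a s x)
        (fun s x => complex.Re (H s x) * b s x)
        (fun s x => complex.Re (Z s x)) &
      ito_equation tau (fun s x => complex.Im (H s x) * a s x)
        (fun s x => complex.Im (H s x) * b s x)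
        (fun s x => complex.Im (Z s x))].

End ito.

(** An element of C([theta, T]) is represented by a function [R -> R] that is
    continuous on [[theta, T]]; condition [drift_causal] at [t = T] makes the
    drift independent of the values outside [[theta, T]]. *)
Section paths.
Context (R : realType) (theta T : R).

Definition path_space : set (R -> R) :=
  [set s | {within `[theta, T], continuous s}].

Definition path_norm (s : R -> R) : R := sup [set `|s t| | t in `[theta, T]].

Definition path_inf (s : R -> R) : R := inf [set s t | t in `[theta, T]].

Definition path_open (U : set (R -> R)) : Prop :=
  U `<=` path_space /\
  forall s, U s -> exists2 e : R, 0 < e &
    forall s', path_space s' -> path_norm (s - s') < e -> U s'.

End paths.

Section drift.
Context (d : measure_display) (Omega : measurableType d) (R : realType).
Variables (P : probability Omega R) (theta T : R).
Variable F : R -> set (set Omega).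

Let triple : Type := ((R -> R) * R * Omega)%type.

Definition drift_domain : set triple :=
  [set z | path_space theta T z.1.1 /\ theta <= z.1.2 <= T].

(** Generators of Borel(C([theta, T])) x Borel([theta, T]) x measurable. *)
Definition drift_rectangles : set (set triple) :=
  [set E | exists (U : set (R -> R)) (B : set R) (A : set Omega),
     [/\ path_open theta T U, measurable B /\ B `<=` `[theta, T],
         measurable A & E = [set z | [/\ U z.1.1, B z.1.2 & A z.2]]]].

Record is_drift (f : (R -> R) -> R -> Omega -> R) : Prop := {
  drift_measurable : forall B : set R, measurable B ->
    <<s drift_domain, drift_rectangles >>
      (drift_domain `&` [set z | B (f z.1.1 z.1.2 z.2)]);
  drift_adapted : forall s t, path_space theta T s -> theta <= t <= T ->
    meas_wrt (F t) (f s t);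
  drift_causal : forall s1 s2 t x,
    path_space theta T s1 -> path_space theta T s2 -> theta <= t <= T ->
    (forall r, theta <= r <= t -> s1 r = s2 r) -> f s1 t x = f s2 t x;
  drift_bounds : forall delta : R, 0 < delta -> exists c1 c2 : R,
    [/\ 0 < c1, 0 < c2 &
     {ae P, forall x, forall t, theta <= t <= T ->
       (forall s1 s2, path_space theta T s1 -> path_space theta T s2 ->
          delta < path_inf theta T s1 -> delta < path_inf theta T s2 ->
          `|f s1 t x - f s2 t x| <= c1 * path_norm theta T (s1 - s2)) /\
       (forall s, path_space theta T s -> delta < path_inf theta T s ->
          `|f s t x| <= c2 * (path_norm theta T s + 1))}] }.

End drift.

(* Main.v *)
(** Write U, V for the real and imaginary parts of Y_h. The integrand i Y_h is
    orthogonal to Y_h, so U dU + V dV = 0 and the Ito formula leaves only the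
    quadratic variation: with b = sigma y^(gamma - h),
      |Y_h(t)|^2 = 1 + c * int_theta^t |Y_h|^2 b^2 ds.
    This linear equation gives log |Y_h(tau)| = (c / 2) int b^2 ds, and the
    constant cancels in the ratio. Here c is the second moment of the standard
    normal law; only c > 0 matters, so its value 1 is never computed.

    The Ito formula is obtained from the telescoping sum of |Y_h|^2 along
    uniform grids. Its cross terms are the Ito integral of a process that tends
    to 0, and its squares are compared with those of h(t_k) (w(t_k+1) - w(t_k)).
    Both estimates follow from one inequality for simple processes: stopping a
    simple process p once int p^2 exceeds delta makes it square integrable, so
    that orthogonality of the increments and Markov's inequality bound the sum
    over blocks of the squared integrals of p. *)

Require Import Defs.
From mathcomp Require Import all_boot all_order all_algebra.
From mathcomp Require Import complex.
From mathcomp Require Import all_classical all_reals all_analysis measurable_realfun.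
From mathcomp Require Import ring lra.
Import Order.TTheory GRing.Theory Num.Theory.
Import numFieldNormedType.Exports.
Local Open Scope classical_set_scope.
Local Open Scope ring_scope.

Set Implicit Arguments.
Unset Strict Implicit.
Unset Printing Implicit Defensive.

(** * Moments of the normal distribution *)

Section gaussian.
Context (R : realType).
Local Notation mu := (@lebesgue_measure R).

(** The Ito integral is given only as a limit in probability, separately at each time, whereas the
    logarithm is a pathwise matter. Smallness in probability is therefore recorded as an inequality
    outside an event of small measure, and finitely many such inequalities are combined. For almost
    every path they then hold on arbitrarily fine grids, and the rest concerns a single path. The
    null set depends on the time, so the equation for the squared modulus is first obtained at
    rational times and then extended by continuity. The drift is merely integrable. It is orthogonal
    to Y_h as well, being multiplied by the same i Y_h, so its share of the cross terms tends to 0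
    by dominated convergence; its share of the squares tends to 0 by absolute continuity of the
    integral. Two devices are forced by the setting. An integrand cut at tau is only
    left-continuous, which is enough for sums sampled at left endpoints. Its paths are bounded one
    by one but not uniformly over outcomes, so it is clipped at a level that grows with the grid. *)

Lemma ge0_integral_normal_prob (m s : R) (f : R -> \bar R) :
  measurable_fun setT f -> (forall x, 0 <= f x)%E ->
  (\int[normal_prob m s]_x f x = \int[mu]_x (f x * (normal_pdf m s x)%:E))%E.
Proof.
move=> mf f0; have dom := normal_prob_dominates m s.
rewrite -(Radon_Nikodym_SigmaFinite.change_of_variables dom)//.
have If := Radon_Nikodym_SigmaFinite.f_integrable dom.
apply: ae_eq_integral => //.
- by apply: emeasurable_funM => //; exact: measurable_int If.
- apply: emeasurable_funM => //; apply/measurable_EFinP.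
  exact: measurable_normal_pdf.
(* The abstract Radon-Nikodym derivative agrees almost everywhere with the explicit density, because
   both integrate to [normal_prob] over every measurable set. *)
apply: ae_eqe_mul2l; apply: integral_ae_eq => //.
  by apply/measurable_EFinP; exact: measurable_normal_pdf.
by move=> E _ mE; rewrite -Radon_Nikodym_SigmaFinite.f_integral.
Qed.

Lemma normal_pdfE0 (s x : R) : s != 0 ->
  normal_pdf 0 s x = (Num.sqrt (s ^+ 2 * pi *+ 2))^-1 * expR (- x ^+ 2 / (s ^+ 2 *+ 2)).
Proof. by move=> s0; rewrite normal_pdfE// /normal_peak /normal_fun subr0. Qed.

(** Symmetry of the centred law. It later gives mean 0 to the increments of [w] without any
    computation: their positive and negative parts have equal integrals. *)
Lemma integral_normal_prob_oppr (s : R) (f : R -> \bar R) : s != 0 ->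
  measurable_fun setT f -> (forall x, 0 <= f x)%E ->
  (\int[normal_prob 0 s]_x f (- x)%R = \int[normal_prob 0 s]_x f x)%E.
Proof.
move=> s0 mf f0.
have mN : measurable_fun setT (-%R : R -> R) by [].
rewrite !ge0_integral_normal_prob//; last exact: measurableT_comp.
have mg : measurable_fun setT (fun x => f x * (normal_pdf 0 s x)%:E)%E.
  by apply: emeasurable_funM => //; apply/measurable_EFinP; exact: measurable_normal_pdf.
have g0 : {in [set: measurableTypeR R], forall y, (0 <= f y * (normal_pdf 0 s y)%:E)%E}.
  by move=> x _; rewrite mule_ge0// lee_fin normal_pdf_ge0.
have e := @ge0_integral_pushforward _ _ (measurableTypeR R) (measurableTypeR R) R
  (-%R : measurableTypeR R -> measurableTypeR R) mN mu setT
  (fun x => f x * (normal_pdf 0 s x)%:E)%E measurableT mg g0.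
apply: (etrans _ (etrans (esym e) _)).
  by rewrite preimage_setT; apply: eq_integral => x _ /=; rewrite !normal_pdfE0// sqrrN.
by apply: eq_measure_integral => A mA _; exact: lebesgue_measureN.
Qed.

Definition normal_second_moment : R := fine (\int[normal_prob (0:R) 1]_x (x ^+ 2)%:E).

(** Half of the Gaussian exponent absorbs [x ^+ 4]: the integrand is at most [48 * s ^+ 4] times the
    density with standard deviation [Num.sqrt 2 * s], whose total mass is 1. Any constant multiple
    of [s ^+ 4] would serve. *)
Lemma normal_4th_moment (s : R) : 0 < s ->
  (\int[normal_prob 0 s]_x (x ^+ 4)%:E <= (48 * s ^+ 4)%:E)%E.
Proof.
move=> s0; have sn0 : s != 0 by rewrite gt_eqF.
have mX : measurable_fun setT (fun x : R => (x ^+ 4)%:E).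
  by apply/measurable_EFinP; exact: exprn_measurable.
rewrite ge0_integral_normal_prob//; last first.
  by move=> x; rewrite lee_fin (exprM x 2 2) sqr_ge0.
pose t := Num.sqrt 2 * s.
have t2 : t ^+ 2 = 2 * s ^+ 2 by rewrite exprMn sqr_sqrtr.
have t0 : t != 0 by rewrite mulf_neq0// gt_eqF// sqrtr_gt0.
rewrite -[leRHS]mule1 -(integral_normal_pdf 0 t) -ge0_integralZl; last 4 first.
- by [].
- by apply/measurable_EFinP; exact: measurable_normal_pdf.
- by move=> x _; rewrite lee_fin normal_pdf_ge0.
- by rewrite lee_fin mulr_ge0// exprn_ge0// ltW.
apply: ge0_le_integral => //.
- by move=> x _; rewrite mule_ge0// lee_fin ?normal_pdf_ge0// (exprM x 2 2) sqr_ge0.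
- by apply: emeasurable_funM => //; apply/measurable_EFinP; exact: measurable_normal_pdf.
- by apply: emeasurable_funM => //; apply/measurable_EFinP; exact: measurable_normal_pdf.
move=> x _; rewrite -!EFinM lee_fin !normal_pdfE0//.
rewrite t2 -(mulrA 2) [X in _ <= _ * (X^-1 * _)](_ : _ =
   Num.sqrt 2 * Num.sqrt (s ^+ 2 * pi *+ 2)); last first.
  by rewrite -mulrnAr sqrtrM.
set k := Num.sqrt (s ^+ 2 * pi *+ 2).
have k0 : 0 < k.
  by rewrite sqrtr_gt0 pmulrn_lgt0// mulr_gt0 ?pi_gt0// exprn_gt0.
pose u := x ^+ 2 / (s ^+ 2 *+ 4).
have u0 : 0 <= u by rewrite divr_ge0 ?sqr_ge0// mulrn_wge0// sqr_ge0.
have -> : - x ^+ 2 / (s ^+ 2 *+ 2) = - u - u by rewrite /u; field.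
have -> : - x ^+ 2 / (2 * s ^+ 2 *+ 2) = - u by rewrite /u; field.
have -> : x ^+ 4 = 16 * s ^+ 4 * u ^+ 2 by rewrite /u; field.
rewrite expRD.
have h2 : Num.sqrt 2 <= 3 / 2 :> R.
  by rewrite -[leRHS]ger0_norm ?divr_ge0// -sqrtr_sqr ler_sqrt//; lra.
have s2 : 0 < Num.sqrt 2 :> R by rewrite sqrtr_gt0.
have hu : u ^+ 2 * expR (- u) <= 2.
  rewrite expRN ler_pdivrMr ?expR_gt0//.
  have := expR_ge1Dxn 1 u0; rewrite (_ : 2`!%:R = 2 :> R)//; lra.
have e0 := expR_ge0 (- u).
have k1 : 0 < k^-1 by rewrite invr_gt0.
have q : Num.sqrt 2 * Num.sqrt 2 = 2 :> R by rewrite -expr2 sqr_sqrtr.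
have -> : (Num.sqrt 2 * k)^-1 = Num.sqrt 2 / 2 * k^-1.
  rewrite invfM; congr (_ * _); apply: (mulfI (lt0r_neq0 s2)).
  by rewrite divff ?gt_eqF// mulrA q divff.
rewrite [leLHS](_ : _ = (16 * s ^+ 4 * k^-1 * expR (- u)) * (u ^+ 2 * expR (- u))); last by ring.
rewrite [leRHS](_ : _ = (16 * s ^+ 4 * k^-1 * expR (- u)) * (3 * Num.sqrt 2 / 2)); last by ring.
apply: ler_wpM2l; first by rewrite !mulr_ge0// ?ltW// exprn_gt0.
apply: (le_trans hu).
rewrite -(ler_pM2r s2) -!mulrA [X in _ <= _ * X]mulrCA q; lra.
Qed.

Lemma normal_2nd_moment_fin (s : R) : 0 < s ->
  (\int[normal_prob 0 s]_x (x ^+ 2)%:E < +oo)%E.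
Proof.
move=> s0.
apply: (@le_lt_trans _ _ (\int[normal_prob (0:R) s]_x ((1 + x ^+ 4)%:E))%E).
  apply: ge0_le_integral => //.
  - by move=> x _; rewrite lee_fin sqr_ge0.
  - by apply/measurable_EFinP; exact: exprn_measurable.
  - by apply/measurable_EFinP; apply: measurable_funD => //; exact: exprn_measurable.
  move=> x _; rewrite lee_fin (exprM x 2 2).
  by have := sqr_ge0 (x ^+ 2 - 1); have := sqr_ge0 (x ^+ 2); nra.
under eq_integral do rewrite EFinD.
rewrite ge0_integralD//.
- rewrite integral_cst// [X in (_ * X)%E](_ : _ = 1%E) ?mule1; last exact: (integral_normal_pdf 0 s).
  by rewrite lte_add_pinfty ?ltry// (le_lt_trans (normal_4th_moment s0))// ltry.
- by move=> x _; rewrite lee_fin (exprM x 2 2) sqr_ge0.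
- by apply/measurable_EFinP; exact: exprn_measurable.
Qed.

Lemma normal_2nd_moment (s : R) : 0 < s ->
  (\int[normal_prob 0 s]_x (x ^+ 2)%:E = (normal_second_moment * s ^+ 2)%:E)%E.
Proof.
move=> s0; have sn0 : s != 0 by rewrite gt_eqF.
rewrite EFinM /normal_second_moment fineK; last first.
  rewrite ge0_fin_numE ?normal_2nd_moment_fin//.
  by apply: integral_ge0 => x _; rewrite lee_fin sqr_ge0.
have mX : measurable_fun setT (fun x : R => (x ^+ 2)%:E).
  by apply/measurable_EFinP; exact: exprn_measurable.
have X0 (x : R) : (0 <= (x ^+ 2)%:E)%E by rewrite lee_fin sqr_ge0.
rewrite !ge0_integral_normal_prob//.
have F'E : (( *%R s : R -> R)^`())%classic = cst s.
  apply/funext => x; rewrite derive1E deriveM// derive_id derive_cst scaler0.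
  by rewrite addr0 /GRing.scale/= mulr1.
transitivity (\int[mu]_x (x ^+ 2 * normal_pdf 0 s x)%:E)%E; first by [].
rewrite (@increasing_ge0_integration_by_substitutionT _ ( *%R s)).
- rewrite F'E muleC -ge0_integralZl//.
  + apply: eq_integral => x _; rewrite /= -!EFinM; congr EFin.
    rewrite !fctE/= (normal_pdfE0 _ sn0) (normal_pdfE0 _ (oner_neq0 _)) expr1n mul1r.
    rewrite -(mulrnAr (s ^+ 2)) sqrtrM ?sqr_ge0// sqrtr_sqr gtr0_norm//.
    have -> : - (s * x) ^+ 2 / (s ^+ 2 *+ 2) = - x ^+ 2 / (1 *+ 2) by field.
    by rewrite invfM; move: (Num.sqrt (pi *+ 2))^-1 => K; field.
  + apply: emeasurable_funM => //; apply/measurable_EFinP.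
    exact: measurable_normal_pdf.
  + by move=> x _; rewrite mule_ge0// lee_fin normal_pdf_ge0.
- by move=> x y xy; rewrite ltr_pM2l.
- by rewrite F'E => ?; exact: cvg_cst.
- by rewrite F'E; exact: is_cvg_cst.
- by rewrite F'E; exact: is_cvg_cst.
- by move=> x; apply: derivableM.
- exact: gt0_cvgMrNy.
- exact: gt0_cvgMry.
- move=> x; apply: cvgM; last exact: continuous_normal_pdf.
  exact: exprn_continuous.
- by move=> x; rewrite mulr_ge0 ?sqr_ge0// normal_pdf_ge0.
Qed.

(** A zero second moment would concentrate the law on the point 0, which is Lebesgue-null and hence
    null for the normal law. *)
Lemma normal_second_moment_gt0 : 0 < normal_second_moment.
Proof.
rewrite lt_neqAle; apply/andP; split; last first.
  by apply/fine_ge0/integral_ge0 => x _; rewrite lee_fin sqr_ge0.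
apply/eqP => g0; have := normal_2nd_moment ltr01.
rewrite -g0 mul0r => I0.
have mX : measurable_fun setT (fun x : R => (x ^+ 2)%:E).
  by apply/measurable_EFinP; exact: exprn_measurable.
have : ae_eq (normal_prob (0:R) 1) setT (fun x : R => (x ^+ 2)%:E) (cst 0%E).
  apply/(ae_eq_integral_abs (normal_prob (0:R) 1) measurableT mX).
  by under eq_integral do rewrite gee0_abs ?lee_fin ?sqr_ge0//.
move=> [A [mA A0 sA]].
have N0 : normal_prob (0:R) 1 [set 0] = 0%E.
  by have /null_content_dominatesP := normal_prob_dominates (0:R) 1; apply => //; exact: lebesgue_measure_set1.
have : (normal_prob (0:R) 1 [set: R] <= normal_prob (0:R) 1 A + normal_prob (0:R) 1 [set 0%R])%E.
  apply: (le_trans _ (measureU2 _ mA (measurable_set1 _))).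
  apply: le_measure; rewrite ?inE//; first exact: measurableU.
  move=> x _; have [->|x0] := eqVneq x 0; first by right.
  left; apply: sA => /= /(_ I) [] /eqP; rewrite sqrf_eq0; exact/negP.
rewrite A0 N0 adde0 [leLHS](_ : _ = 1%E) ?lee_fin ?ler10//.
exact: (integral_normal_pdf 0 1).
Qed.

End gaussian.

(** * Independence and orthogonality *)

Section measurability.
Context (d : measure_display) (Omega : measurableType d) (R : realType).
Variables (G : set (set Omega)) (sG : sigma_algebra setT G).

(** Measurability with respect to [G] becomes ordinary measurability once [Omega] is equipped with
    [G], so the usual closure properties carry over. *)
Lemma meas_wrtP (X : Omega -> R) :
  meas_wrt G X <-> measurable_fun setT (X : g_sigma_algebraType G -> R).
Proof.
split=> [mX _ B mB | mX B mB].
- by rewrite setTI; apply: sub_gen_smallest; exact: mX.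
- have := mX measurableT B mB; rewrite setTI.
  by rewrite -[X in X _ -> _]/(<<s G >>) (sigma_algebra_id sG).
Qed.

Lemma meas_wrt_comp (phi : R -> R) (X : Omega -> R) :
  measurable_fun setT phi -> meas_wrt G X -> meas_wrt G (phi \o X).
Proof. by move=> mphi /meas_wrtP mX; apply/meas_wrtP; exact: measurableT_comp. Qed.

Lemma meas_wrt_cst (a : R) : meas_wrt G (fun=> a).
Proof. by apply/meas_wrtP; exact: measurable_cst. Qed.

Lemma meas_wrtD (X Y : Omega -> R) :
  meas_wrt G X -> meas_wrt G Y -> meas_wrt G (fun x => X x + Y x).
Proof. by move=> /meas_wrtP mX /meas_wrtP mY; apply/meas_wrtP; exact: measurable_funD. Qed.

Lemma meas_wrtB (X Y : Omega -> R) :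
  meas_wrt G X -> meas_wrt G Y -> meas_wrt G (fun x => X x - Y x).
Proof. by move=> /meas_wrtP mX /meas_wrtP mY; apply/meas_wrtP; exact: measurable_funB. Qed.

Lemma meas_wrtM (X Y : Omega -> R) :
  meas_wrt G X -> meas_wrt G Y -> meas_wrt G (fun x => X x * Y x).
Proof. by move=> /meas_wrtP mX /meas_wrtP mY; apply/meas_wrtP; exact: measurable_funM. Qed.

Lemma meas_wrt_sum (I : Type) (r : seq I) (Q : pred I) (X : I -> Omega -> R) :
  (forall i, Q i -> meas_wrt G (X i)) ->
  meas_wrt G (fun x => \sum_(i <- r | Q i) X i x).
Proof.
move=> mX; elim: r => [|i r IH].
  by under eq_fun do rewrite big_nil; exact: meas_wrt_cst.
under eq_fun do rewrite big_cons.
by case: (boolP (Q i)) => // Qi; apply: meas_wrtD => //; exact: mX.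
Qed.

Lemma meas_wrt_indic (a : R) (X Y : Omega -> R) : meas_wrt G X -> meas_wrt G Y ->
  meas_wrt G (fun x => if X x <= a then Y x else 0).
Proof.
move=> mX mY.
have -> : (fun x => if X x <= a then Y x else 0) =
    (fun x => (\1_(`]-oo, a]%classic) \o X) x * Y x).
  apply/funext => x /=; rewrite indicE mem_setE in_itv/=.
  by case: ifP; rewrite ?mul1r ?mul0r.
apply: meas_wrtM => //; apply: meas_wrt_comp => //; exact: measurable_indic.
Qed.

End measurability.

Lemma sub_meas_wrt (d : measure_display) (Omega : measurableType d) (R : realType)
  (G H : set (set Omega)) (X : Omega -> R) : G `<=` H -> meas_wrt G X -> meas_wrt H X.
Proof. by move=> GH mX B /mX; exact: GH. Qed.

Lemma meas_wrt_measurable (d : measure_display) (Omega : measurableType d) (R : realType)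
  (G : set (set Omega)) (X : Omega -> R) :
  G `<=` measurable -> meas_wrt G X -> measurable_fun setT X.
Proof. by move=> GH mX _ B /mX; rewrite setTI; exact: GH. Qed.

Section independence.
Local Open Scope ereal_scope.
Context (d : measure_display) (Omega : measurableType d) (R : realType).
Variables (P : probability Omega R) (G : set (set Omega)).
Hypotheses (sG : sigma_algebra setT G) (Gm : G `<=` measurable).

(** By independence the joint law of [(Z, X)] agrees with the product of the two laws on rectangles,
    hence everywhere; Tonelli's theorem then separates the factors, with no integrability to
    check. *)
Lemma ge0_expectationM_indep (Z X : {mfun Omega >-> R}) (phi psi : R -> R) :
  meas_wrt G Z -> independent_of P G X ->
  measurable_fun setT phi -> measurable_fun setT psi ->
  (forall x, 0 <= phi x)%R -> (forall x, 0 <= psi x)%R ->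
  \int[P]_x (phi (Z x) * psi (X x))%:E =
    \int[P]_x (phi (Z x))%:E * \int[P]_x (psi (X x))%:E.
Proof.
move=> mZ indep mphi mpsi phi0 psi0.
have mZX : measurable_fun setT (fun x => (Z x, X x)).
  exact: measurable_fun_pair.
pose ZX : {mfun Omega >-> (R * R)%type} := mfun_Sub (mem_set mZX).
have mf : measurable_fun setT (fun z : R * R => (phi z.1 * psi z.2)%:E).
  by apply/measurable_EFinP; apply: measurable_funM; exact: measurableT_comp.
have f0 (z : R * R) : 0 <= (phi z.1 * psi z.2)%:E by rewrite lee_fin mulr_ge0.
transitivity (\int[distribution P ZX]_z (phi z.1 * psi z.2)%:E).
  by rewrite ge0_integral_distribution.
transitivity (\int[distribution P Z \x distribution P X]_z (phi z.1 * psi z.2)%:E).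
  apply: eq_measure_integral => A mA _; apply/esym.
  apply: product_measure_unique => // B C mB mC.
  rewrite /distribution /pushforward /=.
  by rewrite -(indep _ _ (mZ _ mB) mC).
rewrite fubini_tonelli1// /fubini_F /=.
under eq_integral => z _.
  under eq_integral do rewrite EFinM.
  rewrite ge0_integralZl//=; first over.
  - by apply/measurable_EFinP.
  - by move=> ? _; rewrite lee_fin.
  - by rewrite lee_fin.
rewrite ge0_integralZr//=.
- rewrite ge0_integral_distribution//=; first by rewrite ge0_integral_distribution//=; apply/measurable_EFinP.
  by apply/measurable_EFinP.
- by apply/measurable_EFinP.
- by move=> ? _; rewrite lee_fin.
- by apply: integral_ge0 => ? _; rewrite lee_fin.
Qed.

End independence.

Section orthogonality.
Local Open Scope ereal_scope.
Context (d : measure_display) (Omega : measurableType d) (R : realType).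
Variables (P : probability Omega R).

Lemma Lfun2P (f : Omega -> R) :
  f \in Lfun P 2%:E <-> measurable_fun setT f /\ \int[P]_x (f x ^+ 2)%:E < +oo.
Proof.
split=> [f2|[mf f2]].
  split; first by have /sub_Lfun_mfun/set_mem := f2.
  have /integrableP[_] := Lfun2_integrable_sqr f2.
  by under eq_integral do rewrite /= ger0_norm ?sqr_ge0//.
rewrite inE; apply/andP; split; rewrite inE//=.
rewrite /finite_norm unlock /Lnorm poweR_lty//.
by under eq_integral do rewrite /= powR_mulrn// real_normK ?num_real//.
Qed.

Lemma Lfun2_bounded_mul (M : R) (f g : Omega -> R) : measurable_fun setT f ->
  (forall x, `|f x| <= M)%R -> g \in Lfun P 2%:E -> (f \* g)%R \in Lfun P 2%:E.
Proof.
move=> mf fM /Lfun2P[mg g2]; apply/Lfun2P; split; first exact: measurable_funM.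
apply: (@le_lt_trans _ _ (\int[P]_x ((M ^+ 2)%:E * (g x ^+ 2)%:E))).
  apply: ge0_le_integral => //.
  - by move=> x _; rewrite lee_fin sqr_ge0.
  - by apply/measurable_EFinP; apply/measurable_funX; exact: measurable_funM.
  - by apply: emeasurable_funM => //; apply/measurable_EFinP; exact: measurable_funX.
  move=> x _; rewrite -EFinM lee_fin exprMn ler_wpM2r ?sqr_ge0//.
  by rewrite -real_normK ?num_real// lerXn2r// ?nnegrE// (le_trans _ (fM x)).
rewrite ge0_integralZl//.
- by rewrite lte_mul_pinfty// ?lee_fin ?sqr_ge0.
- by apply/measurable_EFinP; exact: measurable_funX.
- by move=> x _; rewrite lee_fin sqr_ge0.
- by rewrite lee_fin sqr_ge0.
Qed.

(** Both factors are split into positive and negative parts, which reduces the claim to four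
    products of nonnegative variables. Their expectations factor, and they cancel because the two
    parts of [Y] have the same mean. *)
Lemma expectationM_indep_eq0 (G : set (set Omega)) (Z Y : Omega -> R) :
  sigma_algebra setT G -> G `<=` measurable ->
  meas_wrt G Z -> independent_of P G Y ->
  Z \in Lfun P 1 -> Y \in Lfun P 1 -> (Z \* Y)%R \in Lfun P 1 ->
  'E_P[Y] = 0 -> 'E_P[(Z \* Y)%R] = 0.
Proof.
move=> sG Gm mZ indep Z1 Y1 ZY1 EY0.
have mZ' : measurable_fun setT Z by exact: meas_wrt_measurable mZ.
have mY' : measurable_fun setT Y by have /sub_Lfun_mfun/set_mem := Y1.
pose p (t : R) := Num.max t 0%R.
pose q (t : R) := Num.max (- t)%R 0%R.
have mp : measurable_fun setT p by exact: measurable_maxr.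
have mq : measurable_fun setT q by apply: measurable_maxr => //; exact: measurableT_comp.
have p0 t : (0 <= p t)%R by rewrite le_max lexx orbT.
have q0 t : (0 <= q t)%R by rewrite le_max lexx orbT.
have pq t : t = (p t - q t)%R.
  by rewrite /p /q; case: (leP 0%R t) => h; case: (leP 0%R (- t)%R) => h'; lra.
have pn t : (`|p t| <= `|t|)%R.
  by rewrite ger0_norm// /p ge_max normr_ge0 ler_norm.
have qn t : (`|q t| <= `|t|)%R.
  by rewrite ger0_norm// /q ge_max normr_ge0 -normrN ler_norm.
have L1 (f : R -> R) (h : Omega -> R) : h \in Lfun P 1 -> measurable_fun setT f ->
    (forall t, `|f t| <= `|t|)%R -> (f \o h) \in Lfun P 1.
  move=> h1 mf fn; have /sub_Lfun_mfun/set_mem mh := h1; move/Lfun1_integrable : h1 => h1.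
  apply/Lfun1_integrable; apply: le_integrable h1 => //.
    by apply/measurable_EFinP; exact: measurableT_comp.
  by move=> x _ /=; rewrite lee_fin; exact: fn.
have L2 (f g : R -> R) : measurable_fun setT f -> measurable_fun setT g ->
    (forall t, `|f t| <= `|t|)%R -> (forall t, `|g t| <= `|t|)%R ->
    ((f \o Z) \* (g \o Y))%R \in Lfun P 1.
  move=> mf mg fn gn.
  move/Lfun1_integrable : ZY1 => h1; apply/Lfun1_integrable.
  apply: le_integrable h1 => //.
    by apply/measurable_EFinP; apply: measurable_funM; exact: measurableT_comp.
  by move=> x _ /=; rewrite lee_fin !normrM ler_pM.
have E2 (f g : R -> R) : measurable_fun setT f -> measurable_fun setT g ->
    (forall t, 0 <= f t)%R -> (forall t, 0 <= g t)%R ->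
    'E_P[((f \o Z) \* (g \o Y))%R] = 'E_P[(f \o Z)%R] * 'E_P[(g \o Y)%R].
  move=> mf mg f0 g0; rewrite unlock.
  exact: (@ge0_expectationM_indep _ _ _ _ G (mfun_Sub (mem_set mZ')) (mfun_Sub (mem_set mY'))).
have fin (f : Omega -> R) : f \in Lfun P 1 -> 'E_P[f] \is a fin_num.
  exact: expectation_fin_num.
have pY := L1 p _ Y1 mp pn; have qY := L1 q _ Y1 mq qn.
have pZ := L1 p _ Z1 mp pn; have qZ := L1 q _ Z1 mq qn.
have EYe : 'E_P[(p \o Y)%R] = 'E_P[(q \o Y)%R].
  have : 'E_P[((p \o Y) \- (q \o Y))%R] = 0.
    by rewrite -[RHS]EY0; congr expectation; apply/funext => x /=; rewrite -pq.
  rewrite expectationB// => h.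
  by rewrite -[LHS](@subeK _ _ 'E_P[(q \o Y)%R]) ?h ?add0e ?fin.
have -> : (Z \* Y)%R = (((p \o Z) \* (p \o Y) \+ (q \o Z) \* (q \o Y)) \-
   ((p \o Z) \* (q \o Y) \+ (q \o Z) \* (p \o Y)))%R.
  by apply/funext => x /=; rewrite {1}[Z x]pq {1}[Y x]pq; ring.
have add (f g : Omega -> R) : f \in Lfun P 1 -> g \in Lfun P 1 -> (f \+ g)%R \in Lfun P 1.
  by move=> *; exact: rpredD.
rewrite expectationB; [|by apply: add; exact: L2 ..].
rewrite !expectationD; [|exact: L2 ..].
rewrite !E2// EYe subee//.
by rewrite fin_numD !fin_numM ?fin.
Qed.

(** Orthogonality of martingale differences: when the square is expanded, the cross term is a
    [G n]-measurable factor times [Y n], which is centred and independent of [G n]. The first two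
    conclusions are what the induction needs in order to apply this. The predicate [Q] selects one
    block of terms while the filtration still runs through all indices. *)
Lemma second_moment_sum (n : nat) (G : nat -> set (set Omega)) (Q : pred nat)
    (xi Y : nat -> Omega -> R) (v : nat -> R) (M : R) :
  (forall j, (j <= n)%N -> sigma_algebra setT (G j)) ->
  (forall j, (j <= n)%N -> G j `<=` measurable) ->
  (forall j, (j < n)%N -> G j `<=` G j.+1) ->
  (forall j, (j < n)%N -> meas_wrt (G j) (xi j)) ->
  (forall j, (j < n)%N -> meas_wrt (G j.+1) (Y j)) ->
  (forall j x, (j < n)%N -> `|xi j x| <= M)%R ->
  (forall j, (j < n)%N -> independent_of P (G j) (Y j)) ->
  (forall j, (j < n)%N -> 'E_P[Y j] = 0) ->
  (forall j, (j < n)%N -> \int[P]_x (Y j x ^+ 2)%:E <= (v j)%:E) ->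
  [/\ meas_wrt (G n) (fun x => \sum_(j < n | Q j) xi j x * Y j x)%R,
      (fun x => \sum_(j < n | Q j) xi j x * Y j x)%R \in Lfun P 2%:E &
      \int[P]_x ((\sum_(j < n | Q j) xi j x * Y j x) ^+ 2)%R%:E <=
      \sum_(j < n | Q j) (v j)%:E * \int[P]_x (xi j x ^+ 2)%:E].
Proof.
elim: n => [sG _ _ _ _ _ _ _ _|n IH sG Gm GS mxi mY xiM indep EY VY].
  split.
  - by under eq_fun do rewrite big_ord0; apply: meas_wrt_cst; exact: sG.
  - by under eq_fun do rewrite big_ord0; exact: (Lfun_cst P 0%R 2).
  - rewrite big_ord0; under eq_integral do rewrite big_ord0 expr0n/=.
    by rewrite integral0.
have [|||||||||mS S2 IS] := IH.
- by move=> j jn; apply: sG; exact: leqW.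
- by move=> j jn; apply: Gm; exact: leqW.
- by move=> j jn; apply: GS; exact: leqW.
- by move=> j jn; apply: mxi; exact: leqW.
- by move=> j jn; apply: mY; exact: leqW.
- by move=> j x jn; apply: xiM; exact: leqW.
- by move=> j jn; apply: indep; exact: leqW.
- by move=> j jn; apply: EY; exact: leqW.
- by move=> j jn; apply: VY; exact: leqW.
set S := (fun x => \sum_(j < n | Q j) xi j x * Y j x)%R in mS S2 IS.
have SE : (fun x => \sum_(j < n.+1 | Q j) xi j x * Y j x)%R =
   (fun x => S x + if Q n then xi n x * Y n x else 0)%R.
  by apply/funext => x; rewrite big_mkcond big_ord_recr/= -big_mkcond.
have GnS : G n `<=` G n.+1 by exact: GS.
have sGS := sG n.+1 (leqnn _).
have mS' := sub_meas_wrt GnS mS.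
rewrite big_mkcond big_ord_recr/= -big_mkcond/=.
case: ifP SE => Qn SE; last first.
  have SE' x : (\sum_(j < n.+1 | Q j) xi j x * Y j x)%R = S x.
    by have := congr1 (fun f => f x) SE; rewrite addr0.
  rewrite adde0; split.
  - by under eq_fun do rewrite SE'.
  - by under eq_fun do rewrite SE'.
  - by under eq_integral do rewrite SE'.
have mY' : measurable_fun setT (Y n).
  exact: meas_wrt_measurable (Gm n.+1 (leqnn _)) (mY n (ltnSn n)).
have mxi' : measurable_fun setT (xi n).
  exact: meas_wrt_measurable (Gm n (leqnSn n)) (mxi n (ltnSn n)).
have Y2 : Y n \in Lfun P 2%:E.
  by apply/Lfun2P; split => //; rewrite (le_lt_trans (VY n (ltnSn n)))// ltry.
have xn j : (j <= n)%N -> forall x, (`|xi j x| <= M)%R by move=> jn x; exact: xiM.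
have xi2 : xi n \in Lfun P 2%:E.
  have -> : xi n = (xi n \* cst 1)%R by apply/funext => x; rewrite /= mulr1.
  exact: Lfun2_bounded_mul mxi' (xn n (leqnn _)) (Lfun_cst P 1%R 2).
have xiY2 : (xi n \* Y n)%R \in Lfun P 2%:E by exact: Lfun2_bounded_mul mxi' (xn n (leqnn _)) Y2.
have P1 : P setT \is a fin_num by rewrite probability_setT.
have Sxi : (S \* xi n)%R \in Lfun P 1 by exact: Lfun2_mul_Lfun1.
have cross : 'E_P[((S \* xi n) \* Y n)%R] = 0.
  apply: (@expectationM_indep_eq0 (G n)) => //.
  - exact: sG.
  - exact: Gm.
  - by apply: meas_wrtM => //; [exact: sG|exact: mxi].
  - exact: indep.
  - exact: Lfun_subset12.
  - have -> : ((S \* xi n) \* Y n = S \* (xi n \* Y n))%R.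
      by apply/funext => x /=; rewrite mulrA.
    exact: Lfun2_mul_Lfun1.
  - exact: EY.
rewrite SE; split.
- by apply: meas_wrtD => //; apply: meas_wrtM => //; [apply: sub_meas_wrt (mxi n (ltnSn n))|exact: mY].
- by have : (S \+ (xi n \* Y n))%R \in Lfun P 2%:E by apply: (Lfun_addr_closed P (lee1n 2)).2.
have SE' x : (\sum_(j < n.+1 | Q j) xi j x * Y j x)%R = (S x + xi n x * Y n x)%R.
  by have := congr1 (fun f => f x) SE.
under eq_integral do rewrite SE'.
have sq (f : Omega -> R) : f \in Lfun P 2%:E -> (f \* f)%R \in Lfun P 1.
  by move=> ?; exact: Lfun2_mul_Lfun1.
have mul2 : (S \* (xi n \* Y n))%R \in Lfun P 1 by exact: Lfun2_mul_Lfun1.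
have add (f g : Omega -> R) : f \in Lfun P 1 -> g \in Lfun P 1 -> (f \+ g)%R \in Lfun P 1.
  by move=> *; exact: rpredD.
rewrite [leLHS](_ : _ = 'E_P[((S \* S \+ (S \* (xi n \* Y n) \+ S \* (xi n \* Y n))) \+
  (xi n \* Y n) \* (xi n \* Y n))%R]); last first.
  by rewrite unlock; apply: eq_integral => x _; congr EFin => /=; ring.
rewrite !expectationD ?add ?sq//.
have -> : 'E_P[(S \* (xi n \* Y n))%R] = 0.
  by rewrite -[RHS]cross; congr expectation; apply/funext => x /=; rewrite mulrA.
rewrite !adde0; apply: leeD.
  rewrite unlock; apply: le_trans IS.
  by under eq_integral do rewrite /= -expr2.
rewrite unlock.
have -> : \int[P]_x (((xi n \* Y n) \* (xi n \* Y n)) x)%:E =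
    \int[P]_x (xi n x ^+ 2 * Y n x ^+ 2)%:E.
  by apply: eq_integral => x _; congr EFin => /=; ring.
rewrite (@ge0_expectationM_indep _ _ _ _ (G n) (mfun_Sub (mem_set mxi'))
  (mfun_Sub (mem_set mY')) (fun t => t ^+ 2)%R (fun t => t ^+ 2)%R).
- by rewrite muleC lee_wpmul2r ?VY//; apply: integral_ge0 => x _; rewrite lee_fin sqr_ge0.
- exact: mxi.
- exact: indep.
- exact: exprn_measurable.
- exact: exprn_measurable.
- by move=> x; exact: sqr_ge0.
- by move=> x; exact: sqr_ge0.
Qed.

End orthogonality.

(** * Estimates off small events *)

Section off_small.
Context (d : measure_display) (Omega : measurableType d) (R : realType).
Variable P : probability Omega R.
Implicit Types (Q : Omega -> Prop) (eta : R).

(** Bounds the outer measure of the failure set of [Q], so that no measurability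
    of [Q] is needed. *)
Definition off_small eta Q :=
  exists A, [/\ measurable A, (P A <= eta%:E)%E & forall x, ~ A x -> Q x].

Lemma off_smallW eta eta' Q Q' : off_small eta Q -> eta <= eta' ->
  (forall x, Q x -> Q' x) -> off_small eta' Q'.
Proof.
move=> [A [mA PA QA]] ee QQ; exists A; split => //.
- by rewrite (le_trans PA)// lee_fin.
- by move=> x /QA /QQ.
Qed.

Lemma off_smallI eta1 eta2 Q1 Q2 : off_small eta1 Q1 -> off_small eta2 Q2 ->
  off_small (eta1 + eta2) (fun x => Q1 x /\ Q2 x).
Proof.
move=> [A [mA PA QA]] [B [mB PB QB]]; exists (A `|` B); split.
- exact: measurableU.
- by rewrite (le_trans (measureU2 P mA mB))// EFinD leeD.
- by move=> x /not_orP[Ax Bx]; split; [exact: QA|exact: QB].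
Qed.

Lemma off_small_ae Q : {ae P, forall x, Q x} -> off_small 0 Q.
Proof.
move=> [A [mA PA QA]]; exists A; split => //; first by rewrite PA.
by move=> x Ax; apply: contrapT => Qx; apply: Ax; exact: QA.
Qed.

Lemma ae_off_small Q : (forall eta, 0 < eta -> off_small eta Q) -> {ae P, forall x, Q x}.
Proof.
move=> h; have h' n : {A | [/\ measurable A, (P A <= n.+1%:R^-1%:E)%E & forall x, ~ A x -> Q x]}.
  by apply: cid; apply: h.
pose B := \bigcap_n sval (h' n).
have mB : measurable B by apply: bigcap_measurable => // n _; case: (svalP (h' n)).
exists B; split => //.
- apply/eqP; rewrite eq_le measure_ge0 andbT; apply/lee_addgt0Pr => e e0.
  rewrite add0e.
  have [n ne] : exists n, n.+1%:R^-1 < e by have [n] := ltr_add_invr e0; rewrite add0r; exists n.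
  case: (svalP (h' n)) => mA PA _.
  rewrite (le_trans _ (le_trans PA _))// ?lee_fin ?(ltW ne)//.
  apply: le_measure; rewrite ?inE//; exact: bigcap_inf.
- move=> x /= nQ n _; case: (svalP (h' n)) => _ _ hx.
  by apply: contrapT => /hx.
Qed.

Lemma off_small_forall (N : nat) eta (Q : nat -> Omega -> Prop) : 0 <= eta ->
  (forall k, (k < N)%N -> off_small eta (Q k)) ->
  off_small (N%:R * eta) (fun x => forall k, (k < N)%N -> Q k x).
Proof.
move=> eta0; elim: N => [_|N IH h].
  rewrite mul0r; exists set0; split => //; by rewrite measure0.
have := off_smallI (IH (fun k kN => h k (leqW kN))) (h N (ltnSn N)).
move/off_smallW; apply; first by rewrite -natr1 mulrDl mul1r.
by move=> x [hx QN] k; rewrite ltnS leq_eqVlt => /orP[/eqP->//|]; exact: hx.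
Qed.

Lemma cvg_prob0_off_small (V : nat -> Omega -> \bar R) : cvg_prob0 P V ->
  forall e eta, 0 < e -> 0 < eta ->
  \forall n \near \oo, off_small eta (fun x => (V n x < e%:E)%E).
Proof.
move=> [mV cV] e eta e0 eta0.
have /fine_cvgP[_ /cvgrPdist_lt/(_ _ eta0) c0] := cV _ e0.
near=> n; exists [set x | (e%:E <= V n x)%E].
have mA : measurable [set x | (e%:E <= V n x)%E].
  by rewrite -[X in measurable X]setTI; exact: emeasurable_fun_c_infty.
split => //; last by move=> x /= /negP; rewrite -ltNge.
rewrite -[leLHS]fineK ?fin_num_measure// lee_fin ltW//.
have : `|0 - fine (P [set x | (e%:E <= V n x)%E])| < eta by near: n.
by rewrite sub0r normrN ger0_norm// fine_ge0.
Unshelve. all: by end_near. Qed.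

Lemma off_small_markov (X : Omega -> R) (eps K : R) : measurable_fun setT X ->
  (forall x, 0 <= X x) -> 0 < eps -> (\int[P]_x (X x)%:E <= K%:E)%E ->
  off_small (K / eps) (fun x => X x <= eps).
Proof.
move=> mX X0 eps0 XK.
exists [set x | eps%:E <= `|(X x)%:E|]%E; split.
- rewrite -[X in measurable X]setTI; apply: emeasurable_fun_c_infty => //.
  by apply: measurableT_comp => //; exact/measurable_EFinP.
- have := @markov _ _ _ P (mfun_Sub (mem_set mX)) id eps eps0 (@measurable_id _ _ _)
    (fun r r0 => r0) (fun x y _ _ h => h).
  rewrite EFinM lee_pdivlMr// muleC => /le_trans; apply; apply: le_trans XK.
  by rewrite unlock; under eq_integral do rewrite /= ger0_norm//.
- move=> x /= /negP; rewrite -ltNge lte_fin ger0_norm//; exact: ltW.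
Qed.

End off_small.

(** * Increments of the Wiener process *)

Section wiener_increments.
Context (d : measure_display) (Omega : measurableType d) (R : realType).
Variables (P : probability Omega R) (theta T : R) (F : R -> set (set Omega)).
Variables (w : R -> Omega -> R).
Hypotheses (F_filtration : is_filtration P theta T F) (w_wiener : is_wiener P theta T F w).
Local Notation c := (normal_second_moment R).
Local Notation dw q s := (fun x => w s x - w q x).

Lemma wiener_increment_meas q s : theta <= q -> q <= s -> s <= T -> meas_wrt (F s) (dw q s).
Proof.
move=> tq qs sT; have ts := le_trans tq qs.
apply: meas_wrtB; first by apply: (filt_sigma F_filtration); rewrite ts.
- by apply: (wiener_adapted w_wiener); rewrite ts.
- apply: (sub_meas_wrt (filt_mono F_filtration tq qs sT)).
  by apply: (wiener_adapted w_wiener); rewrite tq (le_trans qs).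
Qed.

Lemma wiener_increment_measurable q s : theta <= q -> q <= s -> s <= T ->
  measurable_fun setT (dw q s).
Proof.
move=> tq qs sT; apply: meas_wrt_measurable (wiener_increment_meas tq qs sT).
by apply: (filt_sub F_filtration); rewrite sT (le_trans tq).
Qed.

Lemma wiener_increment_integral q s (f : R -> \bar R) : theta <= q -> q < s -> s <= T ->
  measurable_fun setT f -> (forall x, 0 <= f x)%E ->
  (\int[P]_x f (w s x - w q x)%R = \int[normal_prob 0 (Num.sqrt (s - q))]_x f x)%E.
Proof.
move=> tq qs sT mf f0.
have mdw := wiener_increment_measurable tq (ltW qs) sT.
have mdw' : @measurable_fun _ _ Omega (measurableTypeR R) setT (dw q s) := mdw.
pose X : {mfun Omega >-> measurableTypeR R} := @mfun_Sub _ _ Omega (measurableTypeR R) (dw q s) (mem_set mdw').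
have := @ge0_integral_distribution _ _ Omega (measurableTypeR R) R P X f mf f0.
move=> <-; apply: (@eq_measure_integral _ (measurableTypeR R)) => A mA _.
exact: (wiener_normal w_wiener tq qs sT mA).
Qed.

Lemma wiener_increment_sqr q s : theta <= q -> q < s -> s <= T ->
  (\int[P]_x ((w s x - w q x) ^+ 2)%:E = (c * (s - q))%:E)%E.
Proof.
move=> tq qs sT.
rewrite (wiener_increment_integral (f := fun x => (x ^+ 2)%:E) tq qs sT).
- rewrite normal_2nd_moment ?sqrtr_gt0 ?subr_gt0// sqr_sqrtr// subr_ge0; exact: ltW.
- by apply/measurable_EFinP; exact: exprn_measurable.
- by move=> x; rewrite lee_fin sqr_ge0.
Qed.

Lemma wiener_increment_4th q s : theta <= q -> q < s -> s <= T ->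
  (\int[P]_x ((w s x - w q x) ^+ 4)%:E <= (48 * (s - q) ^+ 2)%:E)%E.
Proof.
move=> tq qs sT.
rewrite (wiener_increment_integral (f := fun x => (x ^+ 4)%:E) tq qs sT).
- apply: le_trans (normal_4th_moment _) _; first by rewrite sqrtr_gt0 subr_gt0.
  by rewrite lee_fin (exprM _ 2 2) sqr_sqrtr// subr_ge0 ltW.
- by apply/measurable_EFinP; exact: exprn_measurable.
- by move=> x; rewrite lee_fin (exprM _ 2 2) sqr_ge0.
Qed.

Lemma wiener_increment_Lfun2 q s : theta <= q -> q < s -> s <= T ->
  dw q s \in Lfun P 2%:E.
Proof.
move=> tq qs sT; apply/Lfun2P; split; first exact: wiener_increment_measurable (ltW _) _.
by rewrite wiener_increment_sqr// ltry.
Qed.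

Lemma wiener_increment_mean q s : theta <= q -> q < s -> s <= T ->
  ('E_P[dw q s] = 0)%E.
Proof.
move=> tq qs sT.
have P1 : P setT \is a fin_num by rewrite probability_setT.
have /Lfun1_integrable i1 : dw q s \in Lfun P 1.
  by apply: Lfun_subset12 => //; exact: wiener_increment_Lfun2.
have mp : measurable_fun setT (fun t : R => (Num.max t 0)%:E).
  by apply/measurable_EFinP; exact: measurable_maxr.
have p0 (t : R) : (0 <= (Num.max t 0)%:E)%E by rewrite lee_fin le_max lexx orbT.
have mn : measurable_fun setT (fun t : R => (Num.max (- t) 0)%:E).
  by apply/measurable_EFinP; apply: measurable_maxr => //; exact: measurableT_comp.
have n0 (t : R) : (0 <= (Num.max (- t) 0)%:E)%E by rewrite lee_fin le_max lexx orbT.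
rewrite unlock integralE.
have -> : (\int[P]_x (fun x0 => (w s x0 - w q x0)%:E)^\+ x =
   \int[normal_prob 0 (Num.sqrt (s - q))]_x (Num.max x 0)%:E)%E.
  by rewrite -(wiener_increment_integral tq qs sT mp p0); apply: eq_integral => x _; rewrite funeposE EFin_max.
have -> : (\int[P]_x (fun x0 => (w s x0 - w q x0)%:E)^\- x =
   \int[normal_prob 0 (Num.sqrt (s - q))]_x (Num.max (- x) 0)%:E)%E.
  by rewrite -(wiener_increment_integral tq qs sT mn n0); apply: eq_integral => x _; rewrite funenegE EFin_max EFinN.
have s0 : Num.sqrt (s - q) != 0 by rewrite gt_eqF// sqrtr_gt0 subr_gt0.
rewrite (integral_normal_prob_oppr s0 mp p0) subee//.
rewrite ge0_fin_numE; last by apply: integral_ge0.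
rewrite -(wiener_increment_integral tq qs sT mp p0).
have /integrableP[_] := integrable_funepos measurableT i1.
under eq_integral do rewrite gee0_abs//.
by congr (_ < _)%E; apply: eq_integral => x _; rewrite funeposE EFin_max.
Qed.

(** [xi j] is replaced by 0 once the accumulated sum of [xi i ^+ 2 * (r i.+1 - r i)]
    exceeds [delta]; the decision at [j] is measurable with respect to [F (r j)]. *)
Lemma truncation_inequality (n K : nat) (r : nat -> R) (xi : nat -> Omega -> R)
    (kap : nat -> nat) (M delta eps : R) :
  (forall j, (j <= n)%N -> theta <= r j <= T) ->
  (forall j, (j < n)%N -> r j < r j.+1) ->
  (forall j, (j < n)%N -> meas_wrt (F (r j)) (xi j)) ->
  (forall j x, (j < n)%N -> `|xi j x| <= M) ->
  (forall j, (j < n)%N -> (kap j < K)%N) ->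
  0 <= delta -> 0 < eps ->
  off_small P (c * delta / eps) (fun x =>
    \sum_(j < n) xi j x ^+ 2 * (r j.+1 - r j) <= delta ->
    \sum_(k < K) (\sum_(j < n | kap j == k) xi j x * (w (r j.+1) x - w (r j) x)) ^+ 2 <= eps).
Proof.
move=> rT rS mxi xiM kapK delta0 eps0.
pose A j x := \sum_(i < j) xi i x ^+ 2 * (r i.+1 - r i).
pose xi' j x := if A j.+1 x <= delta then xi j x else 0.
have dr0 j : (j < n)%N -> 0 <= r j.+1 - r j by move=> jn; rewrite subr_ge0 ltW// rS.
have sGF j : (j <= n)%N -> sigma_algebra setT (F (r j)).
  by move=> jn; apply: (filt_sigma F_filtration); exact: rT.
have GmF j : (j <= n)%N -> F (r j) `<=` measurable.
  by move=> jn; apply: (filt_sub F_filtration); exact: rT.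
have FS j : (j < n)%N -> F (r j) `<=` F (r j.+1).
  move=> jn; have /andP[tj _] := rT _ (ltnW jn); have /andP[_ jT] := rT _ jn.
  by apply: (filt_mono F_filtration) => //; rewrite ltW// rS.
have Fle i j : (i <= j)%N -> (j <= n)%N -> F (r i) `<=` F (r j).
  move=> ij jn; elim: j ij jn => [|j IH]; first by rewrite leqn0 => /eqP-> _ ?.
  rewrite leq_eqVlt => /orP[/eqP-> _ ?//|ij jn].
  by apply: subset_trans (FS _ jn); apply: IH => //; exact: ltnW.
have mA j : (j < n)%N -> meas_wrt (F (r j)) (A j.+1).
  move=> jn; apply: meas_wrt_sum; first exact/sGF/ltnW.
  move=> [i ij] _ /=; rewrite ltnS in ij.
  have mi : meas_wrt (F (r j)) (xi i).
    by apply: (sub_meas_wrt (Fle _ _ ij (ltnW jn))); exact: (mxi _ (leq_ltn_trans ij jn)).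
  have sj := sGF _ (ltnW jn).
  apply: meas_wrtM => //; last exact: meas_wrt_cst.
  by under eq_fun do rewrite expr2; exact: meas_wrtM.
have mxi' j : (j < n)%N -> meas_wrt (F (r j)) (xi' j).
  by move=> jn; apply: meas_wrt_indic; [exact/sGF/ltnW|exact: mA|exact: mxi].
have xi'M j x : (j < n)%N -> `|xi' j x| <= M.
  move=> jn; rewrite /xi'; case: ifP => _; first exact: xiM.
  by rewrite normr0 (le_trans _ (xiM j x jn)).
(* The induction carries both bounds: while [A] is at most [delta] the truncated sum is compared
   with [A], and afterwards nothing is added, so it stays below [delta]. *)
have bound m x : (m <= n)%N -> \sum_(j < m) xi' j x ^+ 2 * (r j.+1 - r j) <= Num.min delta (A m x).
  elim: m => [_|m IH mn]; first by rewrite !big_ord0 le_min delta0 /A big_ord0 lexx.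
  rewrite big_ord_recr/=; have := IH (ltnW mn); rewrite !le_min => /andP[h1 h2].
  have AS : A m.+1 x = A m x + xi m x ^+ 2 * (r m.+1 - r m) by rewrite /A big_ord_recr.
  have p : 0 <= xi m x ^+ 2 * (r m.+1 - r m) by rewrite mulr_ge0 ?sqr_ge0// dr0.
  rewrite /xi'; case: ifP => h; last first.
    by rewrite expr0n/= mul0r addr0 h1 AS (le_trans h2)// lerDl.
  by rewrite AS in h *; rewrite (le_trans _ h) ?lerD.
pose S k x := \sum_(j < n | kap j == k) xi' j x * (w (r j.+1) x - w (r j) x).
have incr j : (j < n)%N -> [/\ theta <= r j, r j < r j.+1 & r j.+1 <= T].
  by move=> jn; have /andP[? _] := rT _ (ltnW jn); have /andP[_ ?] := rT _ jn; split => //; exact: rS.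
have S2 k : [/\ meas_wrt (F (r n)) (S k), S k \in Lfun P 2%:E &
   (\int[P]_x (S k x ^+ 2)%:E <=
    \sum_(j < n | kap j == k) (c * (r j.+1 - r j))%:E * \int[P]_x (xi' j x ^+ 2)%:E)%E].
  apply: (@second_moment_sum _ _ _ _ _ (F \o r) (fun j => kap j == k) xi'
     (fun j x => w (r j.+1) x - w (r j) x) (fun j => c * (r j.+1 - r j)) M) => //=.
  - by move=> j jn; have [? ? ?] := incr j jn; exact: wiener_increment_meas (ltW _) _.
  - by move=> j jn; have [? ? ?] := incr j jn; exact: (wiener_indep w_wiener).
  - by move=> j jn; have [? ? ?] := incr j jn; exact: wiener_increment_mean.
  - by move=> j jn; have [? ? ?] := incr j jn; rewrite wiener_increment_sqr.
have mS k : measurable_fun setT (S k) by have [_ /Lfun2P[]] := S2 k.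
have mxim j : (j < n)%N -> measurable_fun setT (xi' j).
  by move=> jn; exact: meas_wrt_measurable (GmF _ (ltnW jn)) (mxi' _ jn).
have c0 := normal_second_moment_gt0 R.
have total : (\int[P]_x (\sum_(k < K) S k x ^+ 2)%:E <= (c * delta)%:E)%E.
  under eq_integral do rewrite -sumEFin.
  rewrite ge0_integral_sum//; last 2 first.
  - by move=> k; apply/measurable_EFinP; exact: measurable_funX.
  - by move=> k x _; rewrite lee_fin sqr_ge0.
  apply: (@le_trans _ _ (\sum_(k < K) \sum_(j < n | kap j == k)
     (c * (r j.+1 - r j))%:E * \int[P]_x (xi' j x ^+ 2)%:E)%E).
    by apply: lee_sum => k _; have [] := S2 k.
  (* Every index belongs to exactly one block, so the sum over the blocks is the full sum. *)
  rewrite (_ : (\sum_(k < K) _)%E = \sum_(j < n) (c * (r j.+1 - r j))%:E * \int[P]_x (xi' j x ^+ 2)%:E)%E; last first.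
    under eq_bigr do rewrite big_mkcond.
    rewrite exchange_big/=; apply: eq_bigr => j _.
    rewrite (bigD1 (Ordinal (kapK _ (ltn_ord j))))//= eqxx big1 ?adde0//.
    by move=> k; case: ifPn => // /eqP e /negP; case; apply/eqP/val_inj.
  rewrite (_ : (\sum_(j < n) _)%E = \int[P]_x (c * \sum_(j < n) xi' j x ^+ 2 * (r j.+1 - r j))%:E)%E; last first.
    under [RHS]eq_integral do rewrite mulr_sumr -sumEFin.
    rewrite ge0_integral_sum//.
    - apply: eq_bigr => j _; rewrite -ge0_integralZl//.
      + by apply: eq_integral => x _; rewrite -EFinM; congr EFin; ring.
      + by apply/measurable_EFinP; apply: measurable_funX; exact: mxim.
      + by move=> x _; rewrite lee_fin sqr_ge0.
      + by rewrite lee_fin mulr_ge0 ?dr0// ltW.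
    - move=> j; apply/measurable_EFinP; apply: measurable_funM => //; apply: measurable_funM => //.
      by apply: measurable_funX; exact: mxim.
    - move=> j x _; rewrite lee_fin; apply: mulr_ge0; first exact: ltW.
      by apply: mulr_ge0; rewrite ?sqr_ge0 ?dr0.
  apply: (@le_trans _ _ (\int[P]_x (c * delta)%:E)%E); last first.
    by rewrite integral_cst// [X in (_ * X)%E]probability_setT mule1.
  apply: ge0_le_integral => //.
  - move=> x _; rewrite lee_fin; apply: mulr_ge0; first exact: ltW.
    by apply: sumr_ge0 => j _; rewrite mulr_ge0 ?sqr_ge0 ?dr0.
  - apply/measurable_EFinP; apply: measurable_funM => //; apply: measurable_sum => j.
    by apply: measurable_funM => //; apply: measurable_funX; exact: mxim.
  - move=> x _; rewrite lee_fin; apply: ler_wpM2l; first exact: ltW.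
    by have := bound n x (leqnn _); rewrite le_min => /andP[h _]; exact: h.
have mSS : measurable_fun setT (fun x => \sum_(k < K) S k x ^+ 2).
  by apply: measurable_sum => k; exact: measurable_funX.
have SS0 x : 0 <= \sum_(k < K) S k x ^+ 2 by apply: sumr_ge0 => k _; exact: sqr_ge0.
apply: off_smallW (off_small_markov mSS SS0 eps0 total) (lexx _) _ => x h Ax.
(* If the full sum is at most [delta], so is every partial sum, and the truncation has changed no
   coefficient. *)
apply: le_trans h; rewrite le_eqVlt; apply/orP; left; apply/eqP.
apply: eq_bigr => k _; congr (_ ^+ 2); apply: eq_bigr => j _.
congr (_ * _); rewrite /xi' ifT//; apply: le_trans Ax.
rewrite /A (big_ord_widen n (fun i => xi i x ^+ 2 * (r i.+1 - r i)))//.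
rewrite [leRHS](bigID (fun i : 'I_n => (i < j.+1)%N))/= lerDl.
by apply: sumr_ge0 => i _; rewrite mulr_ge0 ?sqr_ge0 ?dr0.
Qed.

End wiener_increments.

(** * Grids and simple processes *)

Section grids.
Context (R : realType).
Implicit Types (r : nat -> R) (n : nat).

Definition grid n r (a b : R) :=
  [/\ r 0%N = a, r n = b & forall j, (j < n)%N -> r j < r j.+1].

Lemma grid_le n r a b i j : grid n r a b -> (i <= j)%N -> (j <= n)%N -> r i <= r j.
Proof.
move=> [_ _ rS] ij; elim: j ij => [|j IH]; first by rewrite leqn0 => /eqP->.
rewrite leq_eqVlt => /orP[/eqP->//|ij jn].
exact: le_trans (IH ij (ltnW jn)) (ltW (rS _ jn)).
Qed.

Lemma grid_lt n r a b i j : grid n r a b -> (i < j)%N -> (j <= n)%N -> r i < r j.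
Proof.
move=> g ij jn; have [_ _ rS] := g.
by apply: lt_le_trans (rS _ (leq_trans ij jn)) (grid_le g ij jn).
Qed.

Lemma grid_bounds n r a b j : grid n r a b -> (j <= n)%N -> a <= r j <= b.
Proof.
move=> g jn; have [<- <- _] := g.
by rewrite (grid_le g (leq0n _) jn) (grid_le g jn (leqnn _)).
Qed.

Lemma grid_ltW n r a b i j : grid n r a b -> (i <= n)%N -> (j <= n)%N -> r i < r j -> (i < j)%N.
Proof.
move=> g i_n jn rij; rewrite ltnNge; apply/negP => ji.
by have := grid_le g ji i_n; rewrite leNgt rij.
Qed.

(** No point of [L] is interior to a cell. Points of [L] outside the range of the grid are allowed,
    since a simple process on [[theta, T]] is also studied on shorter intervals. *)
Definition refines n r (L : seq R) :=
  forall a, a \in L -> forall j, (j < n)%N -> a <= r j \/ r j.+1 <= a.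

Lemma refining_grid (a b : R) (L : seq R) : a < b ->
  exists n r, [/\ grid n r a b, refines n r L &
    forall p, p \in L -> a <= p <= b -> exists2 i, (i <= n)%N & r i = p].
Proof.
move=> ab; pose s0 := undup (a :: b :: [seq p <- L | a <= p <= b]).
pose s := sort <=%O s0.
have ms p : (p \in s) = [|| p == a, p == b | (a <= p <= b) && (p \in L)].
  by rewrite mem_sort mem_undup !inE mem_filter.
have sl : sorted <%O s by rewrite sort_lt_sorted undup_uniq.
have s_gt0 : (0 < size s)%N by rewrite -has_predT; apply/hasP; exists a; rewrite ?ms ?eqxx.
pose r j := nth b s j; pose n := (size s).-1.
have nE : n.+1 = size s by rewrite prednK.
have rlt i j : (i < j)%N -> (j <= n)%N -> r i < r j.
  move=> ij jn; rewrite /r; apply: (sorted_ltn_nth lt_trans) => //.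
    by rewrite inE -nE ltnS (leq_trans (ltnW ij)).
  by rewrite inE -nE ltnS.
have rin j : (j <= n)%N -> r j \in s by move=> jn; rewrite mem_nth// -nE ltnS.
have rab j : (j <= n)%N -> a <= r j <= b.
  move=> /rin; rewrite ms => /or3P[/eqP->|/eqP->|/andP[]//].
    by rewrite lexx ltW.
  by rewrite lexx andbT ltW.
have ex p : p \in s -> exists2 i, (i <= n)%N & r i = p.
  move=> ps; exists (index p s); last by rewrite /r nth_index.
  by rewrite -ltnS nE index_mem.
have rle i j : (i <= j)%N -> (j <= n)%N -> r i <= r j.
  by rewrite leq_eqVlt => /orP[/eqP->//|ij jn]; rewrite ltW// rlt.
exists n, r; split.
- split.
  + have [i i_n ri] : exists2 i, (i <= n)%N & r i = a by apply: ex; rewrite ms eqxx.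
    apply/eqP; rewrite eq_le -{1}ri rle//=.
    by have /andP[] := rab 0%N (leq0n _).
  + have [i i_n ri] : exists2 i, (i <= n)%N & r i = b by apply: ex; rewrite ms eqxx orbT.
    apply/eqP; rewrite eq_le -{2}ri rle// andbT.
    by have /andP[] := rab n (leqnn _).
  + by move=> j jn; apply: rlt.
- move=> p pL j jn; apply: contrapT => /not_orP[/negP + /negP].
  rewrite -!ltNge => h1 h2.
  have /andP[ar _] := rab _ (ltnW jn); have /andP[_ rb] := rab _ jn.
  have [i i_n ri] : exists2 i, (i <= n)%N & r i = p.
    apply: ex; rewrite ms pL andbT; apply/or3P; apply: Or33.
    by rewrite (le_trans ar (ltW h1)) (le_trans (ltW h2) rb).
  rewrite -ri in h1 h2.
  have ji : (j < i)%N by rewrite ltnNge; apply/negP => ij; have := rle _ _ ij (ltnW jn); rewrite leNgt h1.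
  by have := rle _ _ ji i_n; rewrite leNgt h2.
- by move=> p pL pab; apply: ex; rewrite ms pL pab !orbT.
Qed.

(** The value on a cell is read at its right end because simple processes are constant on intervals
    closed on the right. Predictability then means that this value is measurable at the left end of
    the cell. *)
Definition step n r (p : R -> R) :=
  forall j s, (j < n)%N -> r j < s <= r j.+1 -> p s = p (r j.+1).

Lemma measurable_integral_step n r a b (p : R -> R) m : grid n r a b -> step n r p ->
  (m <= n)%N -> measurable_fun `]a, r m] p /\
  (\int[lambda R]_(s in `]a, r m]) (p s ^+ 2)%:E =
    (\sum_(j < m) p (r j.+1) ^+ 2 * (r j.+1 - r j))%:E)%E.
Proof.
move=> g sp; have [r0 _ rS] := g; elim: m => [_|m IH mn].
  rewrite r0 set_itvoc0 big_ord0 integral_set0; split => //.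
  exact: measurable_fun_set0.
have [mp Ip] := IH (ltnW mn).
have am : a <= r m by have /andP[] := grid_bounds g (ltnW mn).
have U : `]a, r m.+1]%classic = `]a, r m] `|` `]r m, r m.+1]%classic.
  by apply: itv_bndbnd_setU; rewrite bnd_simp// ltW// rS.
have cst_p : {in `]r m, r m.+1]%classic, p =1 cst (p (r m.+1))}.
  by move=> s; rewrite inE/= in_itv/= => sm; exact: sp.
have mU : measurable_fun `]a, r m.+1] p.
  rewrite U; apply/measurable_funU => //; split => //.
  by apply: (eq_measurable_fun (cst (p (r m.+1)))) => // s /cst_p ->.
split => //; rewrite U ge0_integral_setU//.
- rewrite Ip big_ord_recr EFinD; congr (_ + _)%E.
  rewrite (eq_integral (cst (p (r m.+1) ^+ 2)%:E)); last by move=> s /cst_p ->.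
  by rewrite integral_cst//= lebesgue_measure_itv/= lte_fin rS//.
- by rewrite -U; apply/measurable_EFinP; exact: measurable_funX.
- by move=> s _; rewrite lee_fin sqr_ge0.
- rewrite disj_set2E; apply/eqP; rewrite -subset0 => s [] /=; rewrite !in_itv/= => /andP[_ h1] /andP[].
  by rewrite ltNge h1.
Qed.

Lemma integral_step_sqr n r a b (p : R -> R) : grid n r a b -> step n r p ->
  (\int[lambda R]_(s in `[a, b]) (p s ^+ 2)%:E =
    (\sum_(j < n) p (r j.+1) ^+ 2 * (r j.+1 - r j))%:E)%E.
Proof.
move=> g sp; have [mp <-] := measurable_integral_step g sp (leqnn n).
have [_ rb _] := g; rewrite rb in mp *; rewrite -integral_itv_obnd_cbnd//.
by apply/measurable_EFinP; exact: measurable_funX.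
Qed.

End grids.

Section simple_on_grid.
Context (d : measure_display) (Omega : measurableType d) (R : realType).
Variables (theta T : R) (F : R -> set (set Omega)) (w : R -> Omega -> R).
Hypotheses (F_sigma : forall t, theta <= t <= T -> sigma_algebra setT (F t)).
Hypotheses (F_mono : forall s t, theta <= s -> s <= t -> t <= T -> F s `<=` F t).
Variables (S : simple_data Omega R) (S_simple : is_simple theta T F S).

Definition times := [seq sp_time S i | i <- iota 0 (sp_size S).+1].

Lemma mem_times i : (i <= sp_size S)%N -> sp_time S i \in times.
Proof. by move=> iS; apply: map_f; rewrite mem_iota. Qed.

Lemma simple_process_step n r x : refines n r times -> step n r (simple_process S ^~ x).
Proof.
move=> rf j s jn /andP[js sj]; apply: eq_bigr => i _; congr (_ * _).
have [h1|h1] := rf _ (mem_times (ltnW (ltn_ord i))) _ jn;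
have [h2|h2] := rf _ (mem_times (ltn_ord i)) _ jn;
rewrite !indicE !mem_setE !in_itv/=; congr ((_ : bool)%:R); lra.
Qed.

(** A term that does not vanish at [r j.+1] starts before that time, hence by refinement no later
    than [r j], when its coefficient is already known. *)
Lemma simple_process_meas_grid n r a b j : grid n r a b -> theta <= a -> b <= T ->
  refines n r times ->
  (j < n)%N -> meas_wrt (F (r j)) (simple_process S (r j.+1)).
Proof.
move=> g ta bT rf jn; have [_ _ mS _] := S_simple.
have [S1 _ _ _] := S_simple.
have /andP[arj rjb] := grid_bounds g (ltnW jn).
have sF : sigma_algebra setT (F (r j)).
  by apply: F_sigma; rewrite (le_trans ta)// (le_trans rjb).
apply: meas_wrt_sum => // i _.
case: (leP (r j.+1) (sp_time S i)) => h.
  under eq_fun do rewrite indicE mem_setE in_itv/= ltNge h mulr0.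
  exact: meas_wrt_cst.
have [h1|] := rf _ (mem_times (ltnW (ltn_ord i))) _ jn; last by rewrite leNgt h.
apply: meas_wrtM => //; last exact: meas_wrt_cst.
have /andP[ti _] := S1 i (ltnW (ltn_ord i)).
by apply: (sub_meas_wrt (F_mono ti h1 (le_trans rjb bT))); exact: mS.
Qed.

Lemma measurable_simple_process x : measurable_fun setT (simple_process S ^~ x).
Proof.
apply: measurable_sum => i; apply: measurable_funM => //.
Qed.

Lemma simple_process_bounded : exists2 M, 0 <= M & forall s x, `|simple_process S s x| <= M.
Proof.
have [_ _ _ [M SM]] := S_simple.
exists (\sum_(i < sp_size S) `|M|); first by apply: sumr_ge0.
move=> s x; apply: le_trans (ler_norm_sum _ _ _) _; apply: ler_sum => i _.
rewrite normrM; apply: (@le_trans _ _ (M * 1)); last by rewrite mulr1 ler_norm.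
apply: ler_pM => //; first exact: SM.
by rewrite indicE; case: (_ \in _); rewrite ?normr1 ?normr0.
Qed.

Lemma simple_integral_grid n r b x m : grid n r theta b -> refines n r times ->
  (m <= n)%N -> simple_integral w S (r m) x =
    \sum_(j < m) simple_process S (r j.+1) x * (w (r j.+1) x - w (r j) x).
Proof.
move=> g rf; have [S1 S2 _ _] := S_simple; have [r0 _ rS] := g.
elim: m => [_|m IH mn].
  rewrite big_ord0 r0; apply: big1 => i _.
  have /andP[t1 _] := S1 _ (ltn_ord i); have /andP[t2 _] := S1 _ (ltnW (ltn_ord i)).
  by rewrite !min_r// subrr mulr0.
rewrite big_ord_recr/= -(IH (ltnW mn)) /simple_integral /simple_process mulr_suml -big_split/=.
apply: eq_bigr => i _; rewrite -mulrA -mulrDr; congr (_ * _).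
have rm := rS _ mn; have S2i := S2 _ (ltn_ord i).
(* A time of [S] is never inside the cell, so taking the minimum with either end of the cell leaves
   it alone in both cases or replaces it in both. *)
have mE a : a <= r m \/ r m.+1 <= a -> Num.min a (r m.+1) = (if r m.+1 <= a then r m.+1 else a)
   /\ Num.min a (r m) = (if r m.+1 <= a then r m else a).
  case=> h; first by rewrite leNgt (le_lt_trans h rm)/= !min_l// (le_trans h)// ltW.
  by rewrite h !min_r// (le_trans (ltW rm)).
have [-> ->] := mE _ (rf _ (mem_times (ltnW (ltn_ord i))) _ mn).
have [-> ->] := mE _ (rf _ (mem_times (ltn_ord i)) _ mn).
rewrite indicE mem_setE in_itv/= ltNge.
have [h1|h1] := leP (r m.+1) (sp_time S i).
  rewrite (le_trans h1 S2i) /=; ring.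
by case: ifP => _ /=; ring.
Qed.

End simple_on_grid.

(** * Approximation of the Ito integral by simple processes *)

Lemma integral_sqr_addr_le (d : measure_display) (T : measurableType d) (R : realType)
  (mu : {measure set T -> \bar R}) (D : set T) (f g h : T -> R) (k : R) :
  measurable D -> measurable_fun D f -> measurable_fun D g -> 0 <= k ->
  measurable_fun D h ->
  {in D, forall x, h x ^+ 2 <= k * (f x ^+ 2 + g x ^+ 2)} ->
  (\int[mu]_(x in D) (h x ^+ 2)%:E <=
   k%:E * (\int[mu]_(x in D) (f x ^+ 2)%:E + \int[mu]_(x in D) (g x ^+ 2)%:E))%E.
Proof.
move=> mD mf mg k0 mh hfg.
have mf2 : measurable_fun D (fun x => (f x ^+ 2)%:E).
  by apply/measurable_EFinP; exact: measurable_funX.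
have mg2 : measurable_fun D (fun x => (g x ^+ 2)%:E).
  by apply/measurable_EFinP; exact: measurable_funX.
rewrite -ge0_integralD//; try by move=> x _; rewrite lee_fin sqr_ge0.
rewrite -ge0_integralZl//.
- apply: ge0_le_integral => //.
  + by move=> x _; rewrite lee_fin sqr_ge0.
  + by apply/measurable_EFinP; exact: measurable_funX.
  + by apply: measurable_funeM; exact: emeasurable_funD.
  + by move=> x Dx; rewrite -EFinD -EFinM lee_fin; apply: hfg; rewrite inE.
- exact: emeasurable_funD.
- by move=> x _; rewrite adde_ge0// lee_fin sqr_ge0.
Qed.

Section ito.
Context (d : measure_display) (Omega : measurableType d) (R : realType).
Variables (P : probability Omega R) (theta T : R) (F : R -> set (set Omega)).
Variables (w : R -> Omega -> R).
Hypotheses (theta_lt_T : theta < T).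
Hypotheses (F_filtration : is_filtration P theta T F) (w_wiener : is_wiener P theta T F w).
Local Notation c := (normal_second_moment R).

Definition adapted_step n r (p : R -> Omega -> R) :=
  [/\ forall x, step n r (p ^~ x),
      forall j, (j < n)%N -> meas_wrt (F (r j)) (p (r j.+1)) &
      exists M, forall s x, `|p s x| <= M].

(** The blocks give two uses to one bound: a single block controls the integral over all of
    [[a, b]], and one block per coarse cell controls a sum of squared integrals over the cells. *)
Lemma step_inequality n r a b (p : R -> Omega -> R) (kap : nat -> nat) K (delta eps : R) :
  grid n r a b -> theta <= a -> b <= T -> adapted_step n r p ->
  (forall j, (j < n)%N -> (kap j < K)%N) -> 0 <= delta -> 0 < eps ->
  off_small P (c * delta / eps) (fun x =>
    (\int[lambda R]_(s in `[a, b]) (p s x ^+ 2)%:E <= delta%:E)%E ->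
    \sum_(k < K) (\sum_(j < n | kap j == k) p (r j.+1) x * (w (r j.+1) x - w (r j) x)) ^+ 2 <= eps).
Proof.
move=> g ta bT [sp mp [M pM]] kapK d0 e0.
have h := @truncation_inequality _ _ _ P theta T F w F_filtration w_wiener n K r
  (fun j => p (r j.+1)) kap M delta eps.
apply: off_smallW (h _ _ mp (fun j x _ => pM _ _) kapK d0 e0) (lexx _) _.
- move=> j jn; have /andP[h1 h2] := grid_bounds g jn.
  by rewrite (le_trans ta h1) (le_trans h2 bT).
- by have [] := g.
- by move=> x hx; rewrite (integral_step_sqr g (sp x)) lee_fin.
Qed.

Lemma adapted_stepD n r a b p q : grid n r a b -> theta <= a -> b <= T ->
  adapted_step n r p -> adapted_step n r q ->
  adapted_step n r (fun s x => p s x + q s x).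
Proof.
move=> g ta bT [sp mp [M pM]] [sq mq [N qN]]; split.
- by move=> x j s jn sj; rewrite (sp x j s jn sj) (sq x j s jn sj).
- move=> j jn; apply: meas_wrtD; [|exact: mp|exact: mq].
  have /andP[h1 h2] := grid_bounds g (ltnW jn).
  by apply: (filt_sigma F_filtration); rewrite (le_trans ta h1) (le_trans h2 bT).
- by exists (M + N) => s x; rewrite (le_trans (ler_normD _ _))// lerD.
Qed.

Lemma adapted_stepM n r a b p q : grid n r a b -> theta <= a -> b <= T ->
  adapted_step n r p -> adapted_step n r q ->
  adapted_step n r (fun s x => p s x * q s x).
Proof.
move=> g ta bT [sp mp [M pM]] [sq mq [N qN]]; split.
- by move=> x j s jn sj; rewrite (sp x j s jn sj) (sq x j s jn sj).
- move=> j jn; apply: meas_wrtM; [|exact: mp|exact: mq].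
  have /andP[h1 h2] := grid_bounds g (ltnW jn).
  by apply: (filt_sigma F_filtration); rewrite (le_trans ta h1) (le_trans h2 bT).
- by exists (M * N) => s x; rewrite normrM ler_pM.
Qed.

Lemma adapted_stepN n r a b p : grid n r a b -> theta <= a -> b <= T ->
  adapted_step n r p -> adapted_step n r (fun s x => - p s x).
Proof.
move=> g ta bT [sp mp [M pM]]; split.
- by move=> x j s jn sj; rewrite (sp x j s jn sj).
- move=> j jn; have /andP[h1 h2] := grid_bounds g (ltnW jn).
  have sF : sigma_algebra setT (F (r j)).
    by apply: (filt_sigma F_filtration); rewrite (le_trans ta h1) (le_trans h2 bT).
  have := meas_wrtB sF (meas_wrt_cst sF 0) (mp j jn).
  by under eq_fun do rewrite sub0r.
- by exists M => s x; rewrite normrN.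
Qed.

Lemma simple_adapted_step n r a b S : grid n r a b -> theta <= a -> b <= T ->
  is_simple theta T F S -> refines n r (times S) ->
  adapted_step n r (simple_process S).
Proof.
move=> g ta bT sS rf; split.
- by move=> x; exact: simple_process_step.
- move=> j jn; apply: (simple_process_meas_grid _ _ sS g ta bT rf jn).
  + exact: (filt_sigma F_filtration).
  + exact: (filt_mono F_filtration).
- by have [M _ SM] := simple_process_bounded sS; exists M.
Qed.

Definition approximates (H M : R -> Omega -> R) (S : nat -> simple_data Omega R) :=
  [/\ forall n, is_simple theta T F (S n),
      forall delta eta, 0 < delta -> 0 < eta -> \forall n \near \oo, off_small P eta (fun x =>
        (\int[lambda R]_(s in `[theta, T]) ((H s x - simple_process (S n) s x) ^+ 2)%:E < delta%:E)%E) &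
      forall t eps eta, theta <= t <= T -> 0 < eps -> 0 < eta ->
        \forall n \near \oo, off_small P eta (fun x => `|simple_integral w (S n) t x - M t x| < eps)].

Lemma measurable_adapted_path H : measurable_adapted P theta T F H ->
  {ae P, forall x, measurable_fun `[theta, T] (H ^~ x)}.
Proof.
move=> [[K mK HK] _]; apply: filterS HK => x HK.
apply: (eq_measurable_fun (K ^~ x)).
  by move=> s; rewrite inE/= in_itv/= => /HK.
have mD : measurable (`[theta, T]%classic `*` [set: Omega]) by exact: measurableX.
apply: (@measurable_comp _ _ _ _ _ _ _ (fun z : R * Omega => K z.1 z.2) _
  (fun s => (s, x)) mD _ mK).
- by move=> _ [s sT <-] /=; split.
- by apply: measurable_funTS; exact: measurable_pair2.
Qed.

Lemma integral_itv_le t (f : R -> \bar R) : theta <= t <= T ->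
  measurable_fun `[theta, T] f -> (forall s, 0 <= f s)%E ->
  (\int[lambda R]_(s in `[theta, t]) f s <= \int[lambda R]_(s in `[theta, T]) f s)%E.
Proof.
move=> /andP[tt tT] mf f0; apply: ge0_subset_integral => //.
by apply: subset_itvl; rewrite bnd_simp.
Qed.

(** The approximating sequence given at time [T] serves at all times: at time [t]
    it is compared with the one given there by [step_inequality]. *)
Lemma ito_approximation (H M : R -> Omega -> R) :
  (forall t, theta <= t <= T -> is_ito_integral P theta T F w H t (M t)) ->
  exists S, approximates H M S.
Proof.
move=> HM; have TT : theta <= T <= T by rewrite lexx ltW.
have [[mH _] _ [S [sS cS IS]]] := HM T TT.
have c0 := normal_second_moment_gt0 R.
have aS delta eta : 0 < delta -> 0 < eta -> \forall n \near \oo, off_small P eta (fun x =>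
        (\int[lambda R]_(s in `[theta, T]) ((H s x - simple_process (S n) s x) ^+ 2)%:E < delta%:E)%E).
  exact: (cvg_prob0_off_small cS).
exists S; split => // t eps eta tT eps0 eta0.
have [_ _ [S' [sS' cS' IS']]] := HM t tT.
have /andP[tt tT'] := tT.
have e2 : 0 < eps / 2 by rewrite divr_gt0.
have et : 0 < eta / 4 by rewrite divr_gt0.
(* Makes the bound [c * (4 * delta) / (eps / 2) ^+ 2] of [step_inequality] equal to [eta / 4]. *)
pose delta := (eps / 2) ^+ 2 * (eta / 4) / c / 4.
have delta0 : 0 < delta by rewrite !divr_gt0// mulr_gt0// exprn_gt0.
near=> n.
have h1 : off_small P (eta / 4) (fun x =>
   (\int[lambda R]_(s in `[theta, T]) ((H s x - simple_process (S n) s x) ^+ 2)%:E < delta%:E)%E).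
  by near: n; exact: aS.
have h2 : off_small P (eta / 4) (fun x =>
   (\int[lambda R]_(s in `[theta, t]) ((H s x - simple_process (S' n) s x) ^+ 2)%:E < delta%:E)%E).
  by near: n; exact: (cvg_prob0_off_small cS').
have h3 : off_small P (eta / 4) (fun x => `|simple_integral w (S' n) t x - M t x|%:E < (eps / 2)%:E)%E.
  by near: n; exact: (cvg_prob0_off_small IS').
have h4 : off_small P (eta / 4) (fun x =>
   (\int[lambda R]_(s in `[theta, t]) ((simple_process (S n) s x - simple_process (S' n) s x) ^+ 2)%:E
     <= (4 * delta)%:E)%E ->
   `|simple_integral w (S n) t x - simple_integral w (S' n) t x| <= eps / 2).
  (* A grid of [[theta, t]] needs [theta < t]; at [t = theta] both simple integrals are 0. *)
  have [tE|tlt] := eqVneq theta t.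
    apply: off_smallW (off_small_ae _) (ltW et) _; first exact: (@aeW _ _ _ _ (fun=> True)).
    move=> x _ _; rewrite -tE /simple_integral.
    have z U : is_simple theta T F U -> \sum_(i < sp_size U) sp_coef U i x *
        (w (Num.min (sp_time U i.+1) theta) x - w (Num.min (sp_time U i) theta) x) = 0.
      move=> [U1 _ _ _]; apply: big1 => i _.
      have /andP[t1 _] := U1 _ (ltn_ord i); have /andP[t2 _] := U1 _ (ltnW (ltn_ord i)).
      by rewrite !min_r// subrr mulr0.
    by rewrite !z// subrr normr0 ltW.
  have tlt' : theta < t by rewrite lt_neqAle tlt.
  have [N [r [g rf _]]] := refining_grid (times (S n) ++ times (S' n)) tlt'.
  have rf1 : refines N r (times (S n)) by move=> a aS'; apply: rf; rewrite mem_cat aS'.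
  have rf2 : refines N r (times (S' n)) by move=> a aS'; apply: rf; rewrite mem_cat aS' orbT.
  have tht : theta <= theta by [].
  have p1 := simple_adapted_step g tht tT' (sS n) rf1.
  have p2 := adapted_stepN g tht tT' (simple_adapted_step g tht tT' (sS' n) rf2).
  have p := adapted_stepD g tht tT' p1 p2.
  have e20 : 0 < (eps / 2) ^+ 2 by rewrite exprn_gt0.
  have d40 : 0 <= 4 * delta by rewrite mulr_ge0// ltW.
  have := step_inequality (kap := fun=> 0%N) (K := 1%N) g tht tT' p (fun _ _ => isT) d40 e20.
  move=> /off_smallW; apply.
    rewrite le_eqVlt; apply/orP; left; apply/eqP; rewrite /delta; field.
    by rewrite !gt_eqF.
  move=> x hx Ix; have := hx Ix; rewrite big_ord_recl big_ord0 addr0 eqxx/=.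
  have [_ rN _] := g.
  rewrite -rN (simple_integral_grid _ (sS n) _ g rf1)// (simple_integral_grid _ (sS' n) _ g rf2)//.
  rewrite -sumrB; set A := \sum_(_ < _) _; set B := \sum_(_ < _) _.
  have -> : A = B by apply: eq_bigr => j _; ring.
  move=> hB; rewrite -(@ler_pXn2r _ 2) ?nnegrE ?(ltW e2)//.
  by rewrite real_normK ?num_real.
have h5 := off_small_ae (measurable_adapted_path mH).
have := off_smallI h1 (off_smallI h2 (off_smallI h3 (off_smallI h4 h5))).
move/off_smallW; apply; first by rewrite addr0; lra.
move=> x [k1 [k2 [k3 [k4 mHx]]]].
have mS U : measurable_fun `[theta, T] (simple_process U ^~ x).
  by apply: measurable_funTS; exact: measurable_simple_process.
have sub : `[theta, t] `<=` `[theta, T] by apply: subset_itvl; rewrite bnd_simp.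
have mf1 : measurable_fun `[theta, t] (fun s => H s x - simple_process (S n) s x).
  by apply: measurable_funS sub _ => //; apply: measurable_funB.
have mf2 : measurable_fun `[theta, t] (fun s => H s x - simple_process (S' n) s x).
  by apply: measurable_funS sub _ => //; apply: measurable_funB.
have k1' : (\int[lambda R]_(s in `[theta, t]) ((H s x - simple_process (S n) s x) ^+ 2)%:E <= delta%:E)%E.
  apply: le_trans (ltW k1); apply: integral_itv_le => //.
  - by apply/measurable_EFinP; apply: measurable_funX; exact: measurable_funB.
  - by move=> s; rewrite lee_fin sqr_ge0.
have {}k4 : `|simple_integral w (S n) t x - simple_integral w (S' n) t x| <= eps / 2.
  apply: k4; rewrite (_ : 4 * delta = 2 * (delta + delta)); last by ring.
  apply: (@le_trans _ _ (2%:E * (\int[lambda R]_(s in `[theta, t]) ((H s x - simple_process (S n) s x) ^+ 2)%:E +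
     \int[lambda R]_(s in `[theta, t]) ((H s x - simple_process (S' n) s x) ^+ 2)%:E))%E).
    apply: integral_sqr_addr_le => //.
    - by apply: measurable_funS sub _ => //; apply: measurable_funB.
    - move=> s _; set h := H s x; set u := simple_process _ _ _; set v := simple_process _ _ _.
      by have := sqr_ge0 (h + h - u - v); nra.
  by rewrite EFinM lee_wpmul2l// EFinD leeD// ltW.
move: k3; rewrite lte_fin.
have := ler_normD (simple_integral w (S n) t x - simple_integral w (S' n) t x)
  (simple_integral w (S' n) t x - M t x).
rewrite addrA subrK; lra.
Unshelve. all: by end_near. Qed.

End ito.

(** * Coarse blocks of a fine grid *)

Section blocks.
Context (R : realType).

Lemma sqr_subr_le (a b : R) : a ^+ 2 <= 2 * (b ^+ 2 + (a - b) ^+ 2).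
Proof. by have := sqr_ge0 (a - b - b); nra. Qed.

Lemma sqr_oppr_subr_le (a b : R) : (- a - b) ^+ 2 <= 2 * (a ^+ 2 + b ^+ 2).
Proof. by have := sqr_ge0 (a - b); nra. Qed.

Lemma grid_simple_process (d : measure_display) (Omega : measurableType d) (N : nat)
    (g : nat -> R) (a b : R) (cf : nat -> Omega -> R) k s x :
  grid N g a b -> (k < N)%N -> g k < s <= g k.+1 ->
  simple_process (SimpleData N g cf) s x = cf k x.
Proof.
move=> gg kN /andP[ks sk]; rewrite /simple_process /= (bigD1 (Ordinal kN))//= big1.
  by rewrite indicE mem_setE in_itv/= ks sk mulr1 addr0.
move=> i /eqP ik; rewrite indicE mem_setE in_itv/=.
have [h1|h1] /= := ltP (g i) s; last by rewrite mulr0.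
have [h2|h2] /= := leP s (g i.+1); last by rewrite mulr0.
case: ik; apply/val_inj/eqP; rewrite /= eqn_leq; apply/andP; split; rewrite -ltnS.
- by apply: (grid_ltW gg (ltnW (ltn_ord i)) kN); exact: lt_le_trans h1 sk.
- by apply: (grid_ltW gg (ltnW kN) (ltn_ord i)); exact: lt_le_trans ks h2.
Qed.

Lemma grid_simple_process_le (d : measure_display) (Omega : measurableType d) (N : nat)
    (g : nat -> R) (a b : R) (cf : nat -> Omega -> R) s x (B : R) :
  grid N g a b -> 0 <= B -> (forall k, (k < N)%N -> `|cf k x| <= B) ->
  `|simple_process (SimpleData N g cf) s x| <= B.
Proof.
move=> gg B0 cB.
have [[k kN ks]|no] := pselect (exists2 k, (k < N)%N & g k < s <= g k.+1).
  by rewrite (grid_simple_process _ _ gg kN ks); exact: cB.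
rewrite /simple_process big1 ?normr0// => k _ /=.
rewrite indicE mem_setE in_itv/=.
case: (boolP (g k < s <= g k.+1)) => ks; last by rewrite mulr0.
by case: no; exists k.
Qed.

(** Here [i k] is the position of the [k]-th coarse point in a fine grid, and [kap j] is the coarse
    cell that contains the fine cell [j]: the first [k] with [j < i k.+1]. *)
Lemma coarse_index (N n : nat) (i : nat -> nat) :
  i 0%N = 0%N -> i N = n -> (forall k l, (k < l)%N -> (l <= N)%N -> (i k <= i l)%N) ->
  exists kap : nat -> nat, (forall j, (j < n)%N -> (kap j < N)%N) /\
    forall j k, (j < n)%N -> (k < N)%N -> (kap j == k) = (i k <= j < i k.+1)%N.
Proof.
move=> i0 iN imono; pose kap j := find (fun k => (j < i k.+1)%N) (iota 0 N).
have hasj j : (j < n)%N -> has (fun k => (j < i k.+1)%N) (iota 0 N).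
  case: N => [|N] in iN imono kap * => jn; first by rewrite -iN i0 in jn.
  by apply/hasP; exists N; rewrite ?mem_iota//= iN.
have kapN j : (j < n)%N -> (kap j < N)%N.
  by move=> /hasj; rewrite has_find size_iota.
exists kap; split => // j k jn kN.
have h1 : (j < i (kap j).+1)%N.
  have := nth_find 0%N (hasj _ jn); rewrite -/(kap j) nth_iota ?kapN//.
have h2 l : (l < kap j)%N -> (i l.+1 <= j)%N.
  move=> lk; have := before_find 0%N lk; rewrite nth_iota ?(ltn_trans lk (kapN _ jn))//.
  by rewrite add0n => /negbT; rewrite -leqNgt.
apply/eqP/idP => [<-|/andP[k1 k2]].
  rewrite h1 andbT; case E : (kap j) => [|l]; first by rewrite i0.
  by apply: h2; rewrite E.
apply/eqP; rewrite eqn_leq; apply/andP; split; rewrite leqNgt; apply/negP => lt.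
- by have := h2 _ lt; rewrite leqNgt k2.
- have : (i (kap j).+1 <= i k)%N.
    by move: lt; rewrite leq_eqVlt => /orP[/eqP->//|lt]; apply: imono => //; exact: ltnW.
  by move=> h; have := leq_trans h1 (leq_trans h k1); rewrite ltnn.
Qed.

Lemma sum_coarse (N n : nat) (i kap : nat -> nat) (f : nat -> R) k :
  (forall j k, (j < n)%N -> (k < N)%N -> (kap j == k) = (i k <= j < i k.+1)%N) ->
  (k < N)%N -> (i k <= i k.+1)%N -> (i k.+1 <= n)%N ->
  \sum_(j < n | kap j == k) f j = \sum_(j < i k.+1) f j - \sum_(j < i k) f j.
Proof.
move=> kapE kN ik ikn.
have -> : \sum_(j < n | kap j == k) f j = \sum_(j < n | (i k <= j < i k.+1)%N) f j.
  by apply: eq_bigl => j; rewrite kapE.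
rewrite (big_ord_widen n f ikn) (big_ord_widen n f (leq_trans ik ikn)).
rewrite [X in X - _](bigID (fun j : 'I_n => (j < i k)%N))/= addrAC.
rewrite [X in _ = X - _ + _](eq_bigl (fun j : 'I_n => (j < i k)%N)); last first.
  by move=> j; case: (ltnP j (i k)) => h; rewrite ?andbF// andbT (leq_trans h ik).
by rewrite subrr add0r; apply: eq_bigl => j; rewrite -leqNgt andbC.
Qed.

End blocks.

(** * Sums over blocks of increments of Ito integrals *)

Section ito.
Context (d : measure_display) (Omega : measurableType d) (R : realType).
Variables (P : probability Omega R) (theta T : R) (F : R -> set (set Omega)).
Variables (w : R -> Omega -> R).
Hypotheses (theta_lt_T : theta < T).
Hypotheses (F_filtration : is_filtration P theta T F) (w_wiener : is_wiener P theta T F w).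
Local Notation c := (normal_second_moment R).

Lemma grid_is_simple N g t (cf : nat -> Omega -> R) B : grid N g theta t -> t <= T ->
  (forall k, (k < N)%N -> meas_wrt (F (g k)) (cf k)) ->
  (forall k x, (k < N)%N -> `|cf k x| <= B) ->
  is_simple theta T F (SimpleData N g cf).
Proof.
move=> gg tT mcf cfB; split => //=.
- by move=> i iN; have /andP[-> h] := grid_bounds gg iN; exact: le_trans tT.
- by move=> i iN; have [_ _ /(_ _ iN)/ltW] := gg.
- by exists B => i x; exact: cfB.
Qed.

(** Transfers [step_inequality] from simple processes to general integrands. With the coarse grid
    fixed, [H1] and [H2] are replaced by simple approximations whose integrals are accurate at all
    of its finitely many points. The combined integrand is then a step process on a common
    refinement. The bound does not involve [B], so the coefficients may be clipped at growing levels
    at no cost. *)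
Lemma block_estimate (H1 M1 H2 M2 : R -> Omega -> R) (S1 S2 : nat -> simple_data Omega R)
    (N : nat) (g : nat -> R) (t : R) (c1 c2 c3 : nat -> Omega -> R) (beta : nat -> nat)
    (K : nat) (B delta eps eta : R) :
  approximates P theta T F w H1 M1 S1 -> approximates P theta T F w H2 M2 S2 ->
  measurable_adapted P theta T F H1 -> measurable_adapted P theta T F H2 ->
  grid N g theta t -> theta < t -> t <= T ->
  (forall k, (k < N)%N -> [/\ meas_wrt (F (g k)) (c1 k), meas_wrt (F (g k)) (c2 k) &
     meas_wrt (F (g k)) (c3 k)]) ->
  (forall k x, (k < N)%N -> [/\ `|c1 k x| <= B, `|c2 k x| <= B & `|c3 k x| <= B]) ->
  (forall k, (k < N)%N -> (beta k < K)%N) ->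
  0 <= B -> 0 < delta -> 0 < eps -> 0 < eta ->
  off_small P (16 * c * delta / eps + eta) (fun x =>
    (\int[lambda R]_(s in `[theta, t])
       ((simple_process (SimpleData N g c1) s x * H1 s x
         + simple_process (SimpleData N g c2) s x * H2 s x
         - simple_process (SimpleData N g c3) s x) ^+ 2)%:E <= delta%:E)%E ->
    \sum_(b < K) (\sum_(k < N | beta k == b)
      (c1 k x * (M1 (g k.+1) x - M1 (g k) x) + c2 k x * (M2 (g k.+1) x - M2 (g k) x)
       - c3 k x * (w (g k.+1) x - w (g k) x))) ^+ 2 <= eps).
Proof.
move=> [sS1 aS1 iS1] [sS2 aS2 iS2] mH1 mH2 gg tht tT mc cB betaK B0 delta0 eps0 eta0.
have tht' : theta <= theta by [].
have sC1 : is_simple theta T F (SimpleData N g c1).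
  apply: (grid_is_simple (B := B) gg tT) => [k /mc[]//|k x kN]; by have [] := cB k x kN.
have sC2 : is_simple theta T F (SimpleData N g c2).
  apply: (grid_is_simple (B := B) gg tT) => [k /mc[]//|k x kN]; by have [] := cB k x kN.
have sC3 : is_simple theta T F (SimpleData N g c3).
  apply: (grid_is_simple (B := B) gg tT) => [k /mc[]//|k x kN]; by have [] := cB k x kN.
(* Error budget: [e] is the error allowed in one block, with [K * e ^ 2 <= eps / 4]; [rho] is the
   error of an approximating integral at one grid point; [delta'] is the squared error of an
   integrand; [eta'] is the measure of one exceptional event, of which there are [2 + 2 * N.+1].
   Successors and [B + 1] keep the denominators positive. *)
pose e := Num.sqrt (eps / (4 * K.+1%:R)).
have e0 : 0 < e by rewrite sqrtr_gt0 divr_gt0// mulr_gt0.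
have e2 : K%:R * (e ^+ 2) <= eps / 4.
  rewrite sqr_sqrtr; last by rewrite divr_ge0 ?ltW// mulr_ge0.
  have -> : K%:R * (eps / (4 * K.+1%:R)) = eps / 4 * (K%:R / K.+1%:R).
    by field; rewrite ?natr1 ?nat1r pnatr_eq0.
  rewrite ler_piMr ?divr_ge0 ?(ltW eps0)// ler_pdivrMr// mul1r ler_nat//.
pose rho := e / (4 * (B + 1) * N.+1%:R).
have rho0 : 0 < rho by rewrite divr_gt0// !mulr_gt0// ltr_wpDl.
pose delta' := delta / (8 * (B + 1) ^+ 2).
have delta'0 : 0 < delta' by rewrite divr_gt0// mulr_gt0// exprn_gt0// ltr_wpDl.
pose eta' := eta / (2 + 2 * N.+1%:R).
have eta'0 : 0 < eta' by rewrite divr_gt0// addr_gt0// mulr_gt0.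
have near_all (M : R -> Omega -> R) S : (forall t eps eta, theta <= t <= T -> 0 < eps -> 0 < eta ->
        \forall n \near \oo, off_small P eta (fun x => `|simple_integral w (S n) t x - M t x| < eps)) ->
  \forall n \near \oo, off_small P (N.+1%:R * eta') (fun x => forall k, (k < N.+1)%N ->
     `|simple_integral w (S n) (g k) x - M (g k) x| < rho).
  move=> aS.
  have : \forall n \near \oo, forall k : 'I_N.+1, off_small P eta' (fun x =>
       `|simple_integral w (S n) (g k) x - M (g k) x| < rho).
    apply: filter_forall => k; apply: aS => //.
    have /andP[h1 h2] := grid_bounds gg (ltnSE (ltn_ord k)).
    by rewrite h1 (le_trans h2).
  apply: filterS => n h; apply: off_small_forall; first exact: ltW.
  by move=> k kN; have := h (Ordinal kN).
near \oo => m.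
have h1 : off_small P eta' (fun x =>
   (\int[lambda R]_(s in `[theta, T]) ((H1 s x - simple_process (S1 m) s x) ^+ 2)%:E < delta'%:E)%E).
  by near: m; exact: aS1.
have h2 : off_small P eta' (fun x =>
   (\int[lambda R]_(s in `[theta, T]) ((H2 s x - simple_process (S2 m) s x) ^+ 2)%:E < delta'%:E)%E).
  by near: m; exact: aS2.
have h3 : off_small P (N.+1%:R * eta') (fun x => forall k, (k < N.+1)%N ->
     `|simple_integral w (S1 m) (g k) x - M1 (g k) x| < rho).
  by near: m; exact: near_all.
have h4 : off_small P (N.+1%:R * eta') (fun x => forall k, (k < N.+1)%N ->
     `|simple_integral w (S2 m) (g k) x - M2 (g k) x| < rho).
  by near: m; exact: near_all.
have h5 := off_small_ae (measurable_adapted_path mH1).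
have h6 := off_small_ae (measurable_adapted_path mH2).
pose gl := [seq g k | k <- iota 0 N.+1].
have gmem k : (k <= N)%N -> g k \in gl by move=> kN; apply: map_f; rewrite mem_iota.
have [n [r [rg rf rmem]]] := refining_grid (times (S1 m) ++ times (S2 m) ++ gl) tht.
have rf1 : refines n r (times (S1 m)) by move=> a aS; apply: rf; rewrite mem_cat aS.
have rf2 : refines n r (times (S2 m)) by move=> a aS; apply: rf; rewrite !mem_cat aS orbT.
have rf3 cf : refines n r (times (SimpleData N g cf)).
  by move=> a aS; apply: rf; rewrite !mem_cat [a \in gl]aS !orbT.
pose p s x := simple_process (SimpleData N g c1) s x * simple_process (S1 m) s x
         + simple_process (SimpleData N g c2) s x * simple_process (S2 m) s x
         + - simple_process (SimpleData N g c3) s x.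
have ap : adapted_step F n r p.
  apply: (adapted_stepD F_filtration rg tht' tT).
    apply: (adapted_stepD F_filtration rg tht' tT);
    apply: (adapted_stepM F_filtration rg tht' tT);
    exact: (simple_adapted_step F_filtration rg tht' tT).
  apply: (adapted_stepN F_filtration rg tht' tT).
  exact: (simple_adapted_step F_filtration rg tht' tT).
have [i iP] : exists i : nat -> nat, forall k, (k <= N)%N -> (i k <= n)%N /\ r (i k) = g k.
  have h k : exists j, (k <= N)%N -> (j <= n)%N /\ r j = g k.
    have [kN|] := leqP k N; last by exists 0%N.
    have [|j jn rj] := rmem (g k) _ (grid_bounds gg kN).
      by rewrite !mem_cat gmem ?orbT.
    by exists j.
  by have [i iP] := choice h; exists i.
have [g0 gN gS] := gg; have [r0 rn rS] := rg.
have rinj j k : (j <= n)%N -> (k <= n)%N -> r j = r k -> j = k.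
  move=> jn kn rjk; case: (ltngtP j k) => // lt.
    by have := grid_lt rg lt kn; rewrite rjk ltxx.
  by have := grid_lt rg lt jn; rewrite rjk ltxx.
have i0 : i 0%N = 0%N.
  by have [h e'] := iP _ (leq0n N); apply: rinj => //; rewrite e' g0 r0.
have iN : i N = n.
  by have [h e'] := iP _ (leqnn N); apply: rinj => //; rewrite e' gN rn.
have imono k l : (k < l)%N -> (l <= N)%N -> (i k <= i l)%N.
  move=> kl lN; have [ik ek] := iP _ (leq_trans (ltnW kl) lN); have [il el] := iP _ lN.
  by apply/ltnW/(grid_ltW rg ik il); rewrite ek el; exact: (grid_lt gg).
have [kap [kapN kapE]] := coarse_index i0 iN imono.
have d40 : 0 <= 4 * delta by rewrite mulr_ge0// ltW.
have e40 : 0 < eps / 4 by rewrite divr_gt0.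
have h7 := step_inequality F_filtration w_wiener rg tht' tT ap
  (kap := fun j => beta (kap j)) (K := K) (fun j jn => betaK _ (kapN _ jn)) d40 e40.
have := off_smallI h1 (off_smallI h2 (off_smallI h3 (off_smallI h4 (off_smallI h5 (off_smallI h6 h7))))).
move/off_smallW; apply.
  rewrite le_eqVlt; apply/orP; left; apply/eqP; rewrite /eta'; field.
  by rewrite !gt_eqF ?addr_gt0// ?mulr_gt0.
move=> x [k1 [k2 [k3 [k4 [m1 [m2 k7]]]]]] ID.
have B1 : 0 < (B + 1) ^+ 2 by rewrite exprn_gt0// ltr_wpDl.
have sub : `[theta, t] `<=` `[theta, T] by apply: subset_itvl; rewrite bnd_simp.
have mS U : measurable_fun `[theta, t] (simple_process U ^~ x).
  by apply: measurable_funTS; exact: measurable_simple_process.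
have mH1' : measurable_fun `[theta, t] (H1 ^~ x) by apply: (measurable_funS _ sub m1).
have mH2' : measurable_fun `[theta, t] (H2 ^~ x) by apply: (measurable_funS _ sub m2).
have tT' : theta <= t <= T by rewrite ltW.
have small (H : R -> Omega -> R) S : measurable_fun `[theta, T] (H ^~ x) ->
    (\int[lambda R]_(s in `[theta, T]) ((H s x - simple_process S s x) ^+ 2)%:E < delta'%:E)%E ->
    (\int[lambda R]_(s in `[theta, t]) ((H s x - simple_process S s x) ^+ 2)%:E <= delta'%:E)%E.
  move=> mH /ltW; apply: le_trans; apply: integral_itv_le => //.
  - apply/measurable_EFinP; apply: measurable_funX; apply: measurable_funB => //.
    by apply: measurable_funTS; exact: measurable_simple_process.
  - by move=> s; rewrite lee_fin sqr_ge0.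
have {}k1 := small _ _ m1 k1; have {}k2 := small _ _ m2 k2.
have cB1 k : (k < N)%N -> `|c1 k x| <= B by move=> kN; have [] := cB k x kN.
have cB2 k : (k < N)%N -> `|c2 k x| <= B by move=> kN; have [] := cB k x kN.
pose D s := simple_process (SimpleData N g c1) s x * H1 s x
         + simple_process (SimpleData N g c2) s x * H2 s x
         - simple_process (SimpleData N g c3) s x.
have mp : measurable_fun `[theta, t] (p ^~ x).
  apply: measurable_funD; first by apply: measurable_funD; apply: measurable_funM; exact: mS.
  exact: measurableT_comp (mS _).
have mD : measurable_fun `[theta, t] D.
  by apply: measurable_funB => //; apply: measurable_funD; exact: measurable_funM.
have sqr_le_B U : `|U| <= B -> U ^+ 2 <= (B + 1) ^+ 2.
  move=> UB; rewrite -real_normK ?num_real// lerXn2r ?nnegrE ?addr_ge0//.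
  by rewrite (le_trans UB)// lerDl.
(* The third coefficient cancels in [p - D], which is linear in the two approximation errors. *)
have Ipd : (\int[lambda R]_(s in `[theta, t]) ((p s x - D s) ^+ 2)%:E <= (delta / 2)%:E)%E.
  apply: (@le_trans _ _ ((2 * (B + 1) ^+ 2)%:E *
    (\int[lambda R]_(s in `[theta, t]) ((H1 s x - simple_process (S1 m) s x) ^+ 2)%:E +
     \int[lambda R]_(s in `[theta, t]) ((H2 s x - simple_process (S2 m) s x) ^+ 2)%:E))%E).
    apply: integral_sqr_addr_le => //.
    - exact: (measurable_funB mH1' (mS _)).
    - exact: (measurable_funB mH2' (mS _)).
    - by rewrite mulr_ge0// ltW.
    - exact: (measurable_funB mp mD).
    move=> s _; rewrite /p /D.
    have q1 := sqr_le_B _ (grid_simple_process_le s gg B0 cB1).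
    have q2 := sqr_le_B _ (grid_simple_process_le s gg B0 cB2).
    move: q1 q2; set C1 := simple_process (SimpleData N g c1) s x.
    set C2 := simple_process (SimpleData N g c2) s x => q1 q2.
    set C3 := simple_process (SimpleData N g c3) s x.
    set a := H1 s x - _; set b := H2 s x - _.
    rewrite [X in X ^+ 2](_ : _ = - (C1 * a) - C2 * b); last by rewrite /a /b; ring.
    apply: (@le_trans _ _ (2 * (C1 ^+ 2 * a ^+ 2 + C2 ^+ 2 * b ^+ 2))).
      by rewrite -!exprMn; exact: sqr_oppr_subr_le.
    rewrite -mulrA ler_wpM2l// mulrDr.
    by apply: lerD; apply: ler_wpM2r => //; exact: sqr_ge0.
  apply: (@le_trans _ _ ((2 * (B + 1) ^+ 2)%:E * (delta' + delta')%:E)%E).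
    apply: lee_wpmul2l; first by rewrite lee_fin mulr_ge0// ltW.
    by rewrite EFinD; exact: leeD.
  rewrite -EFinM lee_fin le_eqVlt; apply/orP; left; apply/eqP; rewrite /delta'.
  by field; rewrite gt_eqF// ltr_wpDl.
have Ip : (\int[lambda R]_(s in `[theta, t]) (p s x ^+ 2)%:E <= (4 * delta)%:E)%E.
  apply: (@le_trans _ _ (2%:E * (\int[lambda R]_(s in `[theta, t]) (D s ^+ 2)%:E +
     \int[lambda R]_(s in `[theta, t]) ((p s x - D s) ^+ 2)%:E))%E).
    apply: integral_sqr_addr_le => //; first exact: measurable_funB.
    by move=> s _; exact: sqr_subr_le.
  apply: (@le_trans _ _ (2%:E * (delta + delta / 2)%:E)%E).
    by apply: lee_wpmul2l => //; rewrite EFinD; exact: leeD.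
  rewrite -EFinM lee_fin (_ : 2 * (delta + delta / 2) = 4 * delta - delta); last by field.
  by rewrite gerBl ltW.
have {}k7 := k7 Ip.
pose J k := \sum_(j < n | kap j == k) p (r j.+1) x * (w (r j.+1) x - w (r j) x).
pose Z k := c1 k x * (M1 (g k.+1) x - M1 (g k) x) + c2 k x * (M2 (g k.+1) x - M2 (g k) x)
       - c3 k x * (w (g k.+1) x - w (g k) x).
have JE k : (k < N)%N -> J k =
    c1 k x * (simple_integral w (S1 m) (g k.+1) x - simple_integral w (S1 m) (g k) x) +
    c2 k x * (simple_integral w (S2 m) (g k.+1) x - simple_integral w (S2 m) (g k) x) -
    c3 k x * (w (g k.+1) x - w (g k) x).
  move=> kN; have [ik1 ek1] := iP _ kN; have [ik0 ek0] := iP _ (ltnW kN).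
  have ikk : (i k <= i k.+1)%N by exact: imono.
  have Jeq : J k = \sum_(j < n | kap j == k)
     (c1 k x * (simple_process (S1 m) (r j.+1) x * (w (r j.+1) x - w (r j) x)) +
      c2 k x * (simple_process (S2 m) (r j.+1) x * (w (r j.+1) x - w (r j) x)) -
      c3 k x * (w (r j.+1) x - w (r j) x)).
    apply: eq_bigr => j; rewrite kapE// => /andP[kj jk].
    have gk : g k < r j.+1 <= g k.+1.
      rewrite -ek0 -ek1; apply/andP; split; last exact: (grid_le rg).
      exact: (grid_lt rg).
    by rewrite /p !(grid_simple_process _ _ gg kN gk); ring.
  rewrite Jeq sumrB big_split/= -!mulr_sumr.
  rewrite (sum_coarse (fun j => simple_process (S1 m) (r j.+1) x * (w (r j.+1) x - w (r j) x)) kapE)//.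
  rewrite (sum_coarse (fun j => simple_process (S2 m) (r j.+1) x * (w (r j.+1) x - w (r j) x)) kapE)//.
  rewrite (sum_coarse (fun j => w (r j.+1) x - w (r j) x) kapE)//.
  rewrite -!(simple_integral_grid _ (sS1 m) _ rg rf1)//.
  rewrite -!(simple_integral_grid _ (sS2 m) _ rg rf2)// !ek1 !ek0.
  have tele l : \sum_(j < l) (w (r j.+1) x - w (r j) x) = w (r l) x - w (r 0%N) x.
    by rewrite -(big_mkord xpredT (fun j => w (r j.+1) x - w (r j) x)) telescope_sumr.
  by rewrite !tele ek1 ek0; congr (_ - _ * _); ring.
have JZ k : (k < N)%N -> `|Z k - J k| <= e / N.+1%:R.
  move=> kN; rewrite JE// /Z.
  have a0 := k3 k (ltnW kN); have a1 := k3 k.+1 kN.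
  have b0 := k4 k (ltnW kN); have b1 := k4 k.+1 kN.
  move: a0 a1 b0 b1.
  set x0 := simple_integral _ _ (g k) x; set x1 := simple_integral _ _ (g k.+1) x.
  set y0 := simple_integral _ _ (g k) x; set y1 := simple_integral _ _ (g k.+1) x.
  move=> a0 a1 b0 b1.
  have -> : e / N.+1%:R = 4 * (B + 1) * rho.
    rewrite /rho; field; rewrite ?natr1 ?nat1r pnatr_eq0/=.
    by rewrite gt_eqF// ltr_wpDl.
  rewrite [X in `|X|](_ : _ = c1 k x * ((M1 (g k.+1) x - x1) - (M1 (g k) x - x0)) +
     c2 k x * ((M2 (g k.+1) x - y1) - (M2 (g k) x - y0))); last by ring.
  apply: (le_trans (ler_normD _ _)); rewrite !normrM.
  have X : `|(M1 (g k.+1) x - x1) - (M1 (g k) x - x0)| <= 2 * rho.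
    apply: (le_trans (ler_normB _ _)); rewrite ![`|M1 _ _ - _|]distrC mulr_natl mulr2n.
    by apply: lerD; exact: ltW.
  have Y : `|(M2 (g k.+1) x - y1) - (M2 (g k) x - y0)| <= 2 * rho.
    apply: (le_trans (ler_normB _ _)); rewrite ![`|M2 _ _ - _|]distrC mulr_natl mulr2n.
    by apply: lerD; exact: ltW.
  have Xc := ler_pM (normr_ge0 _) (normr_ge0 _) (cB1 k kN) X.
  have Yc := ler_pM (normr_ge0 _) (normr_ge0 _) (cB2 k kN) Y.
  apply: (le_trans (lerD Xc Yc)).
  have -> : 4 * (B + 1) * rho = B * (2 * rho) + B * (2 * rho) + 4 * rho by ring.
  by rewrite lerDl mulr_ge0// ltW.
have blockJ b : \sum_(j < n | beta (kap j) == b) p (r j.+1) x * (w (r j.+1) x - w (r j) x) =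
    \sum_(k < N | beta k == b) J k.
  rewrite (partition_big (fun j : 'I_n => Ordinal (kapN j (ltn_ord j))) (fun k : 'I_N => beta k == b))//=.
  apply: eq_bigr => k bk; apply: eq_bigl => j.
  by rewrite -val_eqE/=; have [->|] := eqVneq (kap j) k; rewrite ?andbF// bk.
have Zb b : (\sum_(k < N | beta k == b) Z k) ^+ 2 <=
    2 * (\sum_(j < n | beta (kap j) == b) p (r j.+1) x * (w (r j.+1) x - w (r j) x)) ^+ 2 + 2 * e ^+ 2.
  rewrite blockJ; set A := \sum_(_ < N | _) Z _; set A' := \sum_(_ < N | _) J _.
  have AA : `|A - A'| <= e.
    rewrite /A /A' -sumrB; apply: (le_trans (ler_norm_sum _ _ _)).
    apply: (@le_trans _ _ (\sum_(k < N | beta k == b) e / N.+1%:R)).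
      by apply: ler_sum => k _; exact: JZ.
    apply: (@le_trans _ _ (\sum_(k < N) e / N.+1%:R)).
      rewrite [leRHS](bigID (fun k : 'I_N => beta k == b))/= lerDl.
      by apply: sumr_ge0 => k _; rewrite divr_ge0// ltW.
    rewrite sumr_const card_ord -[leLHS]mulr_natr -mulrA ler_piMr ?(ltW e0)//.
    by rewrite mulrC ler_pdivrMr// mul1r ler_nat.
  have : (A - A') ^+ 2 <= e ^+ 2.
    by rewrite -real_normK ?num_real// lerXn2r// nnegrE ltW.
  move=> h; apply: (le_trans (sqr_subr_le A A')); rewrite mulrDr.
  by rewrite lerD2l ler_wpM2l.
apply: (@le_trans _ _ (\sum_(b < K) (2 * (\sum_(j < n | beta (kap j) == b) p (r j.+1) x * (w (r j.+1) x - w (r j) x)) ^+ 2 + 2 * e ^+ 2))).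
  by apply: ler_sum => b _; exact: Zb.
rewrite big_split/= -mulr_sumr sumr_const card_ord -[X in _ + X]mulr_natl.
by rewrite mulrCA; lra.
Unshelve. all: by end_near.
Qed.

End ito.

(** * Jointly measurable processes and squared increments *)

Section joint.
Context (d : measure_display) (Omega : measurableType d) (R : realType).
Variables (P : probability Omega R) (theta T : R).

(** The first clause of [measurable_adapted] on its own. It makes the squared integral of a path a
    measurable function of the outcome, up to a null set. *)
Definition jointly_measurable (H : R -> Omega -> R) :=
  exists2 K : R -> Omega -> R,
    measurable_fun (`[theta, T]%classic `*` [set: Omega]) (fun z : R * Omega => K z.1 z.2) &
    {ae P, forall x, forall s, theta <= s <= T -> H s x = K s x}.

Lemma jointly_measurableD H K : jointly_measurable H -> jointly_measurable K ->
  jointly_measurable (fun s x => H s x + K s x).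
Proof.
move=> [H' mH' HH'] [K' mK' KK']; exists (fun s x => H' s x + K' s x).
  exact: measurable_funD.
by apply: filterS2 HH' KK' => x h k s sT; rewrite h// k.
Qed.

Lemma jointly_measurableB H K : jointly_measurable H -> jointly_measurable K ->
  jointly_measurable (fun s x => H s x - K s x).
Proof.
move=> [H' mH' HH'] [K' mK' KK']; exists (fun s x => H' s x - K' s x).
  exact: measurable_funB.
by apply: filterS2 HH' KK' => x h k s sT; rewrite h// k.
Qed.

Lemma jointly_measurableM H K : jointly_measurable H -> jointly_measurable K ->
  jointly_measurable (fun s x => H s x * K s x).
Proof.
move=> [H' mH' HH'] [K' mK' KK']; exists (fun s x => H' s x * K' s x).
  exact: measurable_funM.
by apply: filterS2 HH' KK' => x h k s sT; rewrite h// k.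
Qed.

Lemma jointly_measurable_simple (S : simple_data Omega R) :
  (forall i, (i < sp_size S)%N -> measurable_fun setT (sp_coef S i)) ->
  jointly_measurable (simple_process S).
Proof.
move=> mS; exists (simple_process S); last exact: aeW.
apply: measurable_funTS; apply: measurable_sum => i; apply: measurable_funM.
- by apply: (measurableT_comp (mS i (ltn_ord i))); exact: measurable_snd.
- apply: measurableT_comp; last exact: measurable_fst.
  exact: measurable_indic.
Qed.

(** Almost sure convergence implies convergence in probability: the events that [delta] is exceeded
    at some index from [m] on decrease to a null set. Their measurability comes from Tonelli's
    theorem, applied to the jointly measurable versions [K n]. *)
Lemma ae_cvg_off_small t (D : nat -> R -> Omega -> R) : theta <= t <= T ->
  (forall n, jointly_measurable (D n)) ->
  {ae P, forall x, forall delta : R, 0 < delta -> \forall n \near \oo,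
     (\int[lambda R]_(s in `[theta, t]) (D n s x ^+ 2)%:E <= delta%:E)%E} ->
  forall delta eta : R, 0 < delta -> 0 < eta -> \forall n \near \oo, off_small P eta (fun x =>
     (\int[lambda R]_(s in `[theta, t]) (D n s x ^+ 2)%:E <= delta%:E)%E).
Proof.
move=> /andP[tt tT] jD cvgD delta eta delta0 eta0.
have [K mK DK] : exists2 K : nat -> R -> Omega -> R,
  (forall n, measurable_fun (`[theta, T]%classic `*` [set: Omega]) (fun z : R * Omega => K n z.1 z.2)) &
  (forall n, {ae P, forall x, forall s, theta <= s <= T -> D n s x = K n s x}).
  have h n : exists K : R -> Omega -> R,
      measurable_fun (`[theta, T]%classic `*` [set: Omega]) (fun z : R * Omega => K z.1 z.2) /\
      {ae P, forall x, forall s, theta <= s <= T -> D n s x = K s x}.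
    by have [K mK DK] := jD n; exists K.
  have [K KP] := choice h.
  by exists K => n; have [] := KP n.
pose J n x := (\int[lambda R]_(s in `[theta, t]) (K n s x ^+ 2)%:E)%E.
have mJ n : measurable_fun setT (J n).
  pose E : set (R * Omega) := `[theta, t]%classic `*` setT.
  pose f := (fun z : R * Omega => (K n z.1 z.2 ^+ 2)%:E) \_ E.
  have mE : measurable E by exact: measurableX.
  have mf : measurable_fun setT f.
    apply/(measurable_restrictT _ mE).
    apply/measurable_EFinP; apply: measurable_funX.
    apply: measurable_funS (mK n); first exact: measurableX.
    by move=> z [/= z1 _]; split => //=; move: z1; apply: subset_itvl; rewrite bnd_simp.
  have f0 z : (0 <= f z)%E by rewrite /f patchE; case: ifP => // _; rewrite lee_fin sqr_ge0.
  have := @measurable_fun_fubini_tonelli_G _ _ _ _ R (lambda R) f mf f0.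
  apply: eq_measurable_fun => x _; rewrite /fubini_G /J [RHS]integral_mkcond.
  apply: eq_integral => s _; rewrite /f /E !patchE in_setX in_setT andbT.
  by case: ifP.
have Jae : {ae P, forall x, forall n, J n x = \int[lambda R]_(s in `[theta, t]) (D n s x ^+ 2)%:E}%E.
  apply: ae_foralln => n; apply: filterS (DK n) => x h.
  apply: eq_integral => s; rewrite inE/= in_itv/= => /andP[ts st].
  by rewrite h// ts (le_trans st).
pose A m := \bigcup_(n in [set n | (m <= n)%N]) [set x | (delta%:E < J n x)%E].
have mA m : measurable (A m).
  apply: bigcup_measurable => n _; rewrite -[X in measurable X]setTI.
  exact: emeasurable_fun_o_infty.
have A0 : P (\bigcap_m A m) = 0%E.
  have : P.-negligible (\bigcap_m A m).
    have := filterI Jae cvgD => -[B [mB PB sB]].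
    exists B; split => // x Ax; apply: sB => -[hJ hc].
    have [m _ hm] := hc _ delta0.
    have [n /= mn] := Ax m I; rewrite hJ ltNge; apply/negP/negPn.
    exact: hm.
  by move/measure_negligible; apply; exact: bigcap_measurable.
have : P (A m) @[m --> \oo] --> P (\bigcap_m A m).
  apply: nonincreasing_cvg_mu => //.
  - by rewrite (le_lt_trans (probability_le1 _ (mA _)))// ltry.
  - exact: bigcap_measurable.
  - move=> m n mn; apply/subsetPset => x [k /= nk h]; exists k => //=.
    exact: leq_trans nk.
rewrite A0 => /fine_cvgP[_ /cvgrPdist_lt/(_ _ eta0)] c0.
near=> n.
have h1 : off_small P eta (fun x => (J n x <= delta%:E)%E).
  exists (A n); split => //.
    have : `|0 - fine (P (A n))| < eta by near: n.
    rewrite sub0r normrN ger0_norm ?fine_ge0// => /ltW h.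
    by rewrite -[leLHS]fineK ?fin_num_measure// lee_fin.
  by move=> x nA; rewrite leNgt; apply/negP => h; apply: nA; exists n => /=.
have := off_smallI h1 (off_small_ae Jae).
move/off_smallW; apply; first by rewrite addr0.
by move=> x [h e]; rewrite -e.
Unshelve. all: by end_near. Qed.

End joint.

Section noise.
Context (d : measure_display) (Omega : measurableType d) (R : realType).
Variables (P : probability Omega R) (theta T : R) (F : R -> set (set Omega)).
Variables (w : R -> Omega -> R).
Hypotheses (F_filtration : is_filtration P theta T F) (w_wiener : is_wiener P theta T F w).
Local Notation c := (normal_second_moment R).

(** The centred squares of the increments are independent of the past, so [second_moment_sum]
    applies to them in place of the increments. Their second moment is at most [96 + 2 * c ^+ 2]
    times the squared cell length, by the fourth moment bound with constant 48 and
    [(a - b)^2 <= 2 (a^2 + b^2)]. One factor of the cell length is bounded by [h], the other sums to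
    [t - theta]. *)
Lemma quadratic_noise N g t (cf : nat -> Omega -> R) (B h eps : R) :
  grid N g theta t -> t <= T ->
  (forall k, (k < N)%N -> meas_wrt (F (g k)) (cf k)) ->
  (forall k x, (k < N)%N -> `|cf k x| <= B) ->
  (forall k, (k < N)%N -> g k.+1 - g k <= h) -> 0 < eps ->
  off_small P ((96 + 2 * c ^+ 2) * B ^+ 4 * h * (t - theta) / eps ^+ 2) (fun x =>
    `|\sum_(k < N) cf k x ^+ 2 * ((w (g k.+1) x - w (g k) x) ^+ 2 - c * (g k.+1 - g k))| <= eps).
Proof.
move=> gg tT mcf cfB gh eps0; have [g0 gN gS] := gg.
have incr k : (k < N)%N -> [/\ theta <= g k, g k < g k.+1 & g k.+1 <= T].
  move=> kN; have /andP[h1 _] := grid_bounds gg (ltnW kN).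
  have /andP[_ h2] := grid_bounds gg kN.
  by split => //; [exact: gS|exact: le_trans tT].
have gT j : (j <= N)%N -> theta <= g j <= T.
  by move=> jN; have /andP[h0 h1] := grid_bounds gg jN; rewrite h0 (le_trans h1).
pose Y k x := (w (g k.+1) x - w (g k) x) ^+ 2 - c * (g k.+1 - g k).
pose v k := (96 + 2 * c ^+ 2) * (g k.+1 - g k) ^+ 2.
have sF j : (j <= N)%N -> sigma_algebra setT (F (g j)).
  by move=> jN; apply: (filt_sigma F_filtration); exact: gT.
have Fm j : (j <= N)%N -> F (g j) `<=` measurable.
  by move=> jN; apply: (filt_sub F_filtration); exact: gT.
have [|||||||||_ /Lfun2P[mZ _]] := @second_moment_sum _ _ _ P N (F \o g) xpredT (fun k x => cf k x ^+ 2) Y v (B ^+ 2).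
- exact: sF.
- exact: Fm.
- by move=> j jN; have [? ? ?] := incr j jN; apply: (filt_mono F_filtration) => //; exact: ltW.
- move=> j jN; under eq_fun do rewrite expr2.
  by apply: meas_wrtM; [exact/sF/ltnW|exact: mcf..].
- move=> j jN /=; have [h1 h2 h3] := incr j jN; apply: meas_wrtB; [exact: sF| |by apply: meas_wrt_cst; exact: sF].
  have mw := wiener_increment_meas F_filtration w_wiener h1 (ltW h2) h3.
  by under eq_fun do rewrite expr2; apply: meas_wrtM; [exact: sF|exact: mw..].
- move=> j x jN; rewrite normrX lerXn2r// ?nnegrE//; last exact: cfB.
  by apply: le_trans (cfB j x jN).
- move=> j jN A C FA mC; have [? ? ?] := incr j jN.
  have mphi : measurable_fun setT (fun u : R => u ^+ 2 - c * (g j.+1 - g j)).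
    by apply: measurable_funB => //; exact: exprn_measurable.
  have := mphi measurableT _ mC; rewrite setTI => mC'.
  by have := wiener_indep w_wiener (t := g j) (q := g j) (s := g j.+1) _ _ _ _ FA mC'; apply.
- move=> j jN; have [h1 h2 h3] := incr j jN.
  have P1 : P setT \is a fin_num by rewrite probability_setT.
  have L2 := wiener_increment_Lfun2 F_filtration w_wiener h1 h2 h3.
  rewrite (expectationB (X := fun x => (w (g j.+1) x - w (g j) x) ^+ 2) (Y := cst (c * (g j.+1 - g j)))).
  + rewrite expectation_cst unlock (wiener_increment_sqr F_filtration w_wiener h1 h2 h3).
    by rewrite subee.
  + by apply/Lfun1_integrable; exact: Lfun2_integrable_sqr.
  + exact: Lfun_cst.
- move=> j jN; have [h1 h2 h3] := incr j jN.
  have mdw := wiener_increment_measurable F_filtration w_wiener h1 (ltW h2) h3.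
  apply: (@le_trans _ _ (2%:E * (\int[P]_x ((((w (g j.+1) x - w (g j) x) ^+ 2) ^+ 2)%:E) +
      \int[P]_x ((cst (c * (g j.+1 - g j)) x) ^+ 2)%:E))%E).
    apply: integral_sqr_addr_le => //.
    - exact: measurable_funX.
    - by apply: measurable_funB => //; exact: measurable_funX.
    - move=> x _; have := sqr_oppr_subr_le (- (w (g j.+1) x - w (g j) x) ^+ 2) (c * (g j.+1 - g j)).
      by rewrite opprK sqrrN.
  have -> : (\int[P]_x ((cst (c * (g j.+1 - g j)) x) ^+ 2)%:E = ((c * (g j.+1 - g j)) ^+ 2)%:E)%E.
    by rewrite -[RHS]mule1 -(probability_setT P) -integral_cst.
  apply: (@le_trans _ _ (2%:E * ((48 * (g j.+1 - g j) ^+ 2)%:E + ((c * (g j.+1 - g j)) ^+ 2)%:E))%E).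
    apply: lee_wpmul2l => //; apply: leeD => //.
    under eq_integral do rewrite -exprM.
    exact: (wiener_increment_4th F_filtration w_wiener h1 h2 h3).
  by rewrite -EFinD -EFinM lee_fin le_eqVlt; apply/orP; left; apply/eqP; rewrite /v; ring.
rewrite /=; set Z := fun x => _ in mZ * => E2.
have B20 : 0 <= (96 + 2 * c ^+ 2) by rewrite addr_ge0// mulr_ge0// sqr_ge0.
have dg k : (k < N)%N -> 0 <= g k.+1 - g k by move=> kN; rewrite subr_ge0 ltW// gS.
have Ev : (\sum_(j < N) (v j)%:E * \int[P]_x ((cf j x ^+ 2) ^+ 2)%:E <=
    ((96 + 2 * c ^+ 2) * B ^+ 4 * h * (t - theta))%:E)%E.
  apply: (@le_trans _ _ (\sum_(j < N) ((96 + 2 * c ^+ 2) * B ^+ 4 * h * (g j.+1 - g j))%:E)%E).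
    apply: lee_sum => j _.
    apply: (@le_trans _ _ ((v j)%:E * (B ^+ 4)%:E)%E).
      apply: lee_wpmul2l; first by rewrite lee_fin mulr_ge0// sqr_ge0.
      apply: (@le_trans _ _ (\int[P]_x (B ^+ 4)%:E)%E); last first.
        by rewrite integral_cst// [X in (_ * X)%E]probability_setT mule1.
      apply: ge0_le_integral => //.
      - by move=> x _; rewrite lee_fin sqr_ge0.
      - apply/measurable_EFinP; do 2 apply: measurable_funX.
        by apply: meas_wrt_measurable (mcf j _) => //; exact/Fm/ltnW.
      - move=> x _; rewrite lee_fin -exprM -[X in X <= _](@ger0_norm _ (_ ^+ 4)); last first.
          by rewrite (exprM _ 2 2) sqr_ge0.
        rewrite normrX lerXn2r ?nnegrE ?cfB//.
        exact: le_trans (cfB j x (ltn_ord j)).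
    rewrite -EFinM lee_fin /v.
    have -> : (96 + 2 * c ^+ 2) * (g j.+1 - g j) ^+ 2 * B ^+ 4 =
      ((96 + 2 * c ^+ 2) * B ^+ 4 * (g j.+1 - g j)) * (g j.+1 - g j) by ring.
    apply: ler_wpM2r; first exact: dg.
    apply: ler_wpM2l; last exact: gh.
    by rewrite mulr_ge0// (exprM _ 2 2) sqr_ge0.
  rewrite sumEFin -mulr_sumr -(big_mkord xpredT (fun j => g j.+1 - g j)) telescope_sumr//.
  by rewrite g0 gN.
have Z0 x : 0 <= Z x ^+ 2 by exact: sqr_ge0.
have e20 : 0 < eps ^+ 2 by rewrite exprn_gt0.
have := off_small_markov (measurable_funX 2 mZ) Z0 e20 (le_trans E2 Ev).
move=> /off_smallW; apply; first exact: lexx.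
move=> x hx; rewrite -(@ler_pXn2r _ 2) ?nnegrE ?(ltW eps0)//.
by rewrite real_normK ?num_real.
Qed.

End noise.

(** * Step functions on uniform grids *)

Section paths.
Context (R : realType).
Local Notation mu := (@lebesgue_measure R).

Definition stepf N (g : nat -> R) (cf : nat -> R) (s : R) : R :=
  \sum_(k < N) cf k * \1_(`]g k, g k.+1]) s.

Lemma stepfE N g a b cf k s : grid N g a b -> (k < N)%N -> g k < s <= g k.+1 ->
  stepf N g cf s = cf k.
Proof.
move=> gg kN ks.
(* A deterministic step function is a simple process over a dummy space of outcomes. *)
exact: (@grid_simple_process R _ R N g a b (fun k (_ : R) => cf k) k s 0).
Qed.

Lemma stepf_le N g a b cf s B : grid N g a b -> 0 <= B ->
  (forall k, (k < N)%N -> `|cf k| <= B) -> `|stepf N g cf s| <= B.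
Proof.
move=> gg B0 cB.
exact: (@grid_simple_process_le R _ R N g a b (fun k (_ : R) => cf k) s 0 B).
Qed.

Lemma measurable_stepf N g cf : measurable_fun setT (stepf N g cf).
Proof.
by apply: measurable_sum => k; apply: measurable_funM => //; exact: measurable_indic.
Qed.

Lemma step_stepf N g a b cf : grid N g a b -> step N g (stepf N g cf).
Proof.
move=> gg k s kN ks; rewrite !(stepfE _ gg kN)//.
by have [_ _ /(_ _ kN) ->] := gg; rewrite lexx.
Qed.

Lemma grid_cell N (g : nat -> R) (a b s : R) : grid N g a b -> a < s <= b ->
  exists2 k, (k < N)%N & g k < s <= g k.+1.
Proof.
move=> [<- <- _]; elim: N => [|N IH] /andP[h1 h2].
  by have := lt_le_trans h1 h2; rewrite ltxx.
have [h|h] := leP s (g N); last by exists N; rewrite ?h.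
by have [|k kN ks] := IH; [rewrite h1|exists k => //; exact: ltnW].
Qed.

Lemma integrable_bounded_mul (D : set R) (h A : R -> R) (M : R) : measurable D ->
  measurable_fun D h -> (forall s, D s -> `|h s| <= M) ->
  mu.-integrable D (EFin \o A) -> mu.-integrable D (EFin \o (fun s => h s * A s)).
Proof.
move=> mD mh hM iA; apply: (@integrableMr _ _ _ mu D mD h _ mh _ iA).
exists M; split => [|K MK s Ds]; first exact: num_real.
exact: le_trans (hM s Ds) (ltW MK).
Qed.

Lemma stepf_bounded N (g : nat -> R) (a b : R) (cf : nat -> R) : grid N g a b ->
  exists M, forall s, `|stepf N g cf s| <= M.
Proof.
move=> gg; exists (\sum_(k < N) `|cf k|) => s; apply: (stepf_le _ gg).
  by apply: sumr_ge0.
by move=> k kN; rewrite (bigD1 (Ordinal kN))//= lerDl sumr_ge0.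
Qed.

Lemma Rintegral_stepf N (g : nat -> R) (a b : R) (cf : nat -> R) (A : R -> R) : grid N g a b ->
  mu.-integrable `[a, b] (EFin \o A) ->
  mu.-integrable `]a, b] (EFin \o (fun s => stepf N g cf s * A s)) /\
  \int[mu]_(s in `]a, b]) (stepf N g cf s * A s) =
    \sum_(k < N) cf k * \int[mu]_(s in `]g k, g k.+1]) A s.
Proof.
move=> gg iA; have [ga gb gS] := gg.
have iA' k l : (l <= N)%N -> a <= g k -> mu.-integrable `]g k, g l] (EFin \o A).
  move=> lN ak; apply: integrableS iA => //.
  by apply: subset_itv; rewrite bnd_simp//; have /andP[] := grid_bounds gg lN.
have iP k l : (l <= N)%N -> a <= g k ->
    mu.-integrable `]g k, g l] (EFin \o (fun s => stepf N g cf s * A s)).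
  move=> lN ak; have [M cM] := stepf_bounded cf gg.
  apply: (@integrable_bounded_mul _ _ _ M) => //; last exact: iA'.
  by apply: measurable_funTS; exact: measurable_stepf.
split; first by have := iP 0%N N (leqnn _); rewrite ga gb; apply.
suff h m : (m <= N)%N ->
  \int[mu]_(s in `]a, g m]) (stepf N g cf s * A s) =
    \sum_(k < m) cf k * \int[mu]_(s in `]g k, g k.+1]) A s.
  by have := h N (leqnn _); rewrite gb.
elim: m => [_|m IH mN].
  by rewrite ga set_itvoc0 big_ord0 Rintegral_set0.
have e1 := IH (ltnW mN).
have am : a <= g m by have /andP[] := grid_bounds gg (ltnW mN).
have U : `]a, g m.+1]%classic = `]a, g m] `|` `]g m, g m.+1]%classic.
  by apply: itv_bndbnd_setU; rewrite bnd_simp// ltW// gS.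
have ec : {in `]g m, g m.+1]%classic, (fun s => stepf N g cf s * A s) =1 (fun s => cf m * A s)}.
  by move=> s; rewrite inE/= in_itv/= => sm; rewrite (stepfE _ gg mN sm).
have dis : [disjoint `]a, g m] & `]g m, g m.+1]].
  rewrite disj_set2E; apply/eqP; rewrite -subset0 => s [] /=; rewrite !in_itv/= => /andP[_ h1] /andP[].
  by rewrite ltNge h1.
rewrite big_ord_recr/= -e1 U Rintegral_setU//; last first.
  by rewrite -U; have := iP 0%N m.+1 mN; rewrite ga; apply.
congr (_ + _); transitivity (\int[mu]_(s in `]g m, g m.+1]) (cf m * A s)).
  exact: eq_Rintegral.
by rewrite RintegralZl//; exact: iA'.
Qed.

(** The regularity that survives when a continuous integrand is set to 0 after [tau], and all that
    is needed for values sampled at the left ends of shrinking cells to converge. *)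
Definition left_continuous_on (a b : R) (u : R -> R) := forall s, a < s <= b ->
  forall e : R, 0 < e -> exists2 dl : R, 0 < dl & forall r, a <= r -> s - dl < r < s -> `|u r - u s| < e.

Definition ugrid (a b : R) N (k : nat) : R := a + k%:R * ((b - a) / N%:R).

Lemma ugridP (a b : R) N : a < b -> (0 < N)%N -> grid N (ugrid a b N) a b.
Proof.
move=> ab N0; split; first by rewrite /ugrid mul0r addr0.
- by rewrite /ugrid mulrC divfK ?pnatr_eq0 -?lt0n// addrC subrK.
- move=> j jN; rewrite /ugrid ltrD2l ltr_pM2r ?ltr_nat//.
  by rewrite divr_gt0 ?subr_gt0// ltr0n.
Qed.

Lemma ugridS (a b : R) N k : ugrid a b N k.+1 - ugrid a b N k = (b - a) / N%:R.
Proof. by rewrite /ugrid -natr1; ring. Qed.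

Lemma cvg_stepf (a b s : R) (u : R -> R) (N : nat -> nat) :
  a < b -> (forall n, (n < N n)%N) ->
  left_continuous_on a b u -> a < s <= b ->
  stepf (N n) (ugrid a b (N n)) (u \o ugrid a b (N n)) s @[n --> \oo] --> u s.
Proof.
move=> ab NN lu sab; apply/cvgrPdist_lt => e e0.
have [dl dl0 hdl] := lu s sab e e0.
near=> n.
have N0 : (0 < N n)%N by exact: leq_ltn_trans (NN n).
have gg := ugridP ab N0.
have [k kN /andP[ks sk]] := grid_cell gg sab.
rewrite (stepfE _ gg kN) ?ks// distrC; apply: hdl.
  by have /andP[] := grid_bounds gg (ltnW kN).
rewrite ks andbT ltrBlDr -ltrBlDl.
apply: le_lt_trans (_ : (b - a) / (N n)%:R < dl).
  by rewrite -(ugridS a b (N n) k) lerD2r.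
rewrite ltr_pdivrMr ?ltr0n// -ltr_pdivrMl// (@lt_trans _ _ n%:R) ?ltr_nat//.
by near: n; exact: nbhs_infty_gtr.
Unshelve. all: by end_near. Qed.

End paths.

(** * Limits of sampled sums along one path *)

Section path_limits.
Context (R : realType).
Local Notation mu := (@lebesgue_measure R).

(** Simple processes must be bounded over all outcomes, while the paths sampled here have bounds
    that depend on the outcome. Clipping provides the former and, once its level exceeds the bound
    of a path, changes nothing on that path. *)
Definition clip (B u : R) : R := Num.max (- B) (Num.min B u).

Lemma clip_le B u : 0 <= B -> `|clip B u| <= B.
Proof.
move=> B0; rewrite ler_norml /clip le_max lexx/= ge_max ge_min lexx andbT.
by rewrite (le_trans _ B0)// oppr_le0.
Qed.

Lemma clip_id B u : `|u| <= B -> clip B u = u.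
Proof.
by rewrite ler_norml => /andP[h1 h2]; rewrite /clip min_r// max_r.
Qed.

Lemma measurable_clip B : measurable_fun setT (clip B).
Proof. by apply: measurable_maxr => //; exact: measurable_minr. Qed.

Lemma bounded_cvg_sqr (a b M : R) (f : nat -> R -> R) :
  (forall n, measurable_fun `[a, b] (f n)) ->
  (forall n s, a <= s <= b -> `|f n s| <= M) ->
  (forall s, a < s <= b -> f n s @[n --> \oo] --> 0) ->
  forall delta : R, 0 < delta -> \forall n \near \oo,
    (\int[mu]_(s in `[a, b]) (f n s ^+ 2)%:E <= delta%:E)%E.
Proof.
move=> mf fM cf delta delta0.
have mf2 n : measurable_fun `[a, b] (fun s => (f n s ^+ 2)%:E).
  by apply/measurable_EFinP; apply: measurable_funX.
have sub : `]a, b] `<=` `[a, b] by apply: subset_itvr; rewrite bnd_simp.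
have mf2' n : measurable_fun `]a, b] (fun s => (f n s ^+ 2)%:E).
  by apply: (measurable_funS _ sub (mf2 n)).
have icst (k : R) : mu.-integrable `]a, b] (EFin \o cst k).
  apply/integrableP; split; first by apply/measurable_EFinP.
  under eq_integral do rewrite /=.
  rewrite integral_cst//= lebesgue_measure_itv/= lte_fin.
  by case: ifP => _; rewrite ?mule0// -EFinD -EFinM ltry.
have := @dominated_cvg _ _ _ mu `]a, b]%classic (measurable_itv _)
  (fun n s => (f n s ^+ 2)%:E) (cst 0%E) (EFin \o cst (M ^+ 2)) mf2' _ _ (icst _) _.
rewrite integral0 => cI.
have /fine_cvgP[fin /cvgrPdist_lt/(_ _ delta0) c0] : (\int[mu]_(s in `]a, b]) (f n s ^+ 2)%:E)%E @[n --> \oo] --> 0%E.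
  apply: cI => //.
  - move=> s sab /=; apply/cvg_EFin; first exact: nearW.
    have h : f n s @[n --> \oo] --> 0 by apply: cf; move: sab; rewrite /= in_itv.
    have := cvgM h h; rewrite mulr0; exact.
  - move=> n s sab /=; rewrite lee_fin normrX lerXn2r ?nnegrE//.
      by apply: (le_trans _ (fM n s _)) => //; have := sub _ sab; rewrite /= in_itv.
    by apply: fM; have := sub _ sab; rewrite /= in_itv.
near=> n; rewrite -integral_itv_obnd_cbnd//.
have h1 : (\int[mu]_(s in `]a, b]) (f n s ^+ 2)%:E)%E \is a fin_num by near: n.
rewrite -[leLHS]fineK// lee_fin ltW//.
have : `|0 - fine (\int[mu]_(s in `]a, b]) (f n s ^+ 2)%:E)%E| < delta by near: n.
rewrite sub0r normrN ger0_norm// fine_ge0//; apply: integral_ge0 => s _.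
by rewrite lee_fin sqr_ge0.
Unshelve. all: by end_near. Qed.

(** Young's inequality [2 p q <= lam p^2 + q^2 / lam], term by term. It is used with [lam] small, a
    bounded sum of the [p k ^+ 2] and a sum of the [q k ^+ 2] that is small compared with [lam]. *)
Lemma sum_sqr_perturb N (p q : nat -> R) (lam : R) : 0 < lam ->
  `|\sum_(k < N) (p k + q k) ^+ 2 - \sum_(k < N) p k ^+ 2| <=
    lam * \sum_(k < N) p k ^+ 2 + (1 + lam^-1) * \sum_(k < N) q k ^+ 2.
Proof.
move=> l0; rewrite -sumrB !mulr_sumr -big_split/=.
apply: (le_trans (ler_norm_sum _ _ _)); apply: ler_sum => k _.
have -> : (p k + q k) ^+ 2 - p k ^+ 2 = 2 * (p k * q k) + q k ^+ 2 by ring.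
apply: (le_trans (ler_normD _ _)).
rewrite [`|q k ^+ 2|]ger0_norm ?sqr_ge0//.
have h1 : 0 <= lam * (p k + lam^-1 * q k) ^+ 2 by rewrite mulr_ge0 ?sqr_ge0// ltW.
have h2 : 0 <= lam * (p k - lam^-1 * q k) ^+ 2 by rewrite mulr_ge0 ?sqr_ge0// ltW.
have e1 : lam * (p k + lam^-1 * q k) ^+ 2 = lam * p k ^+ 2 + lam^-1 * q k ^+ 2 + 2 * (p k * q k).
  by field; rewrite gt_eqF.
have e2 : lam * (p k - lam^-1 * q k) ^+ 2 = lam * p k ^+ 2 + lam^-1 * q k ^+ 2 - 2 * (p k * q k).
  by field; rewrite gt_eqF.
have -> : lam * p k ^+ 2 + (1 + lam^-1) * q k ^+ 2 =
  (lam * p k ^+ 2 + lam^-1 * q k ^+ 2) + q k ^+ 2 by ring.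
rewrite lerD2r ler_norml; rewrite {}e1 in h1; rewrite {}e2 in h2.
by rewrite -subr_ge0 opprK addrC h1/= -subr_ge0.
Qed.

Section limits.
Variables (a b : R) (N : nat -> nat).
Hypotheses (ab : a < b) (NN : forall n, (n < N n)%N).
Local Notation g n := (ugrid a b (N n)).

Let N0 n : (0 < N n)%N. Proof. exact: leq_ltn_trans (NN n). Qed.
Let gg n : grid (N n) (g n) a b. Proof. exact: ugridP. Qed.

(** An indefinite integral has zero quadratic variation: by absolute continuity each cell integral
    is at most [e / (I + 1)] in absolute value, and the cell integrals of [|A|] add up to [I]. *)
Lemma small_cells (A : R -> R) : mu.-integrable `[a, b] (EFin \o A) ->
  forall e : R, 0 < e -> \forall n \near \oo,
    \sum_(k < N n) (\int[mu]_(s in `]g n k, g n k.+1]) A s) ^+ 2 <= e.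
Proof.
move=> iA e e0.
pose I := \int[mu]_(s in `]a, b]) `|A s|.
have I0 : 0 <= I by apply: Rintegral_ge0.
have iA' n k l : (l <= N n)%N -> mu.-integrable `]g n k, g n l] (EFin \o A).
  move=> lN; apply: integrableS iA => //.
  apply: subset_itv; rewrite bnd_simp; last by have /andP[] := grid_bounds (gg n) lN.
  by rewrite /ugrid lerDl mulr_ge0// divr_ge0// subr_ge0 ltW.
have iN := integrable_norm iA.
pose A0 := A \_ `[a, b].
have iA0 : mu.-integrable [set: R] (EFin \o A0).
  rewrite (_ : EFin \o A0 = (EFin \o A) \_ `[a, b]); last first.
    by apply/funext => s; rewrite /A0 /= !patchE; case: ifP.
  by rewrite -integrable_mkcond.
have e1 : 0 < e / (I + 1) by rewrite divr_gt0// ltr_wpDl.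
have [dl [dl0 hdl]] := integral_normr_continuous iA0 e1.
near=> n.
have cell k : (k < N n)%N -> `|\int[mu]_(s in `]g n k, g n k.+1]) A s| <=
    \int[mu]_(s in `]g n k, g n k.+1]) `|A s|.
  by move=> kN; apply: le_normr_Rintegral => //; exact: iA'.
have cell2 k : (k < N n)%N -> `|\int[mu]_(s in `]g n k, g n k.+1]) A s| <= e / (I + 1).
  move=> kN; apply: (le_trans (cell k kN)); apply/ltW.
  have -> : \int[mu]_(s in `]g n k, g n k.+1]) `|A s| = \int[mu]_(s in `]g n k, g n k.+1]) `|A0 s|.
    apply: eq_Rintegral => s; rewrite inE/= in_itv/= => /andP[s1 s2].
    rewrite /A0 patchE ifT// inE/= in_itv/=.
    have /andP[h1 _] := grid_bounds (gg n) (ltnW kN).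
    have /andP[_ h2] := grid_bounds (gg n) kN.
    by rewrite (le_trans h1 (ltW s1)) (le_trans s2 h2).
  apply: hdl => //=; rewrite lebesgue_measure_itv/= lte_fin.
  have [_ _ gS] := gg n; rewrite gS// -EFinD lte_fin ugridS.
  rewrite ltr_pdivrMr ?ltr0n// -ltr_pdivrMl// (@lt_trans _ _ n%:R) ?ltr_nat//.
  by near: n; exact: nbhs_infty_gtr.
have sumI : \sum_(k < N n) \int[mu]_(s in `]g n k, g n k.+1]) `|A s| = I.
  have [_] := Rintegral_stepf (fun=> 1) (gg n) (iN : mu.-integrable `[a, b] (EFin \o (fun s => `|A s|))).
  under [X in _ = X -> _]eq_bigr do rewrite mul1r.
  move=> <-; apply: eq_Rintegral => s; rewrite inE/= in_itv/= => sab.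
  by have [k kN ks] := grid_cell (gg n) sab; rewrite (stepfE _ (gg n) kN ks) mul1r.
apply: (@le_trans _ _ (\sum_(k < N n) (e / (I + 1)) * \int[mu]_(s in `]g n k, g n k.+1]) `|A s|)).
  apply: ler_sum => k _; rewrite -real_normK ?num_real// expr2.
  by apply: ler_pM => //; [exact: cell2|exact: cell].
rewrite -mulr_sumr sumI mulrAC ler_pdivrMr ?ltr_wpDl//.
by rewrite ler_wpM2l ?(ltW e0)// lerDl.
Unshelve. all: by end_near. Qed.

(** The sum is the integral of [A] and [B] against step functions that sample [u] and [v]. The
    integrand tends pointwise to [u A + v B = 0] and is dominated by [M (|A| + |B|)], so
    integrability of [A] and [B] is enough. *)
Lemma drift_sum_cvg0 (u v A B : R -> R) (M : R) :
  left_continuous_on a b u -> left_continuous_on a b v -> 0 <= M ->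
  (forall s, a <= s <= b -> `|u s| <= M) -> (forall s, a <= s <= b -> `|v s| <= M) ->
  mu.-integrable `[a, b] (EFin \o A) -> mu.-integrable `[a, b] (EFin \o B) ->
  (forall s, a < s <= b -> u s * A s + v s * B s = 0) ->
  \sum_(k < N n) (u (g n k) * \int[mu]_(s in `]g n k, g n k.+1]) A s
    + v (g n k) * \int[mu]_(s in `]g n k, g n k.+1]) B s) @[n --> \oo] --> 0.
Proof.
move=> lu lv M0 uM vM iA iB tan.
pose f n s := stepf (N n) (g n) (u \o g n) s * A s + stepf (N n) (g n) (v \o g n) s * B s.
have SE n : \sum_(k < N n) (u (g n k) * \int[mu]_(s in `]g n k, g n k.+1]) A s
    + v (g n k) * \int[mu]_(s in `]g n k, g n k.+1]) B s) = \int[mu]_(s in `]a, b]) f n s.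
  have [i1 e1] := Rintegral_stepf (u \o g n) (gg n) iA.
  have [i2 e2] := Rintegral_stepf (v \o g n) (gg n) iB.
  by rewrite /f RintegralD// e1 e2 -big_split.
under eq_cvg do rewrite SE.
have sub : `]a, b] `<=` `[a, b] by apply: subset_itvr; rewrite bnd_simp.
have iA' : mu.-integrable `]a, b] (EFin \o A) by apply: integrableS iA.
have iB' : mu.-integrable `]a, b] (EFin \o B) by apply: integrableS iB.
have ug n k : (k < N n)%N -> `|(u \o g n) k| <= M.
  by move=> kN; apply: uM; exact: grid_bounds (gg n) (ltnW kN).
have vg n k : (k < N n)%N -> `|(v \o g n) k| <= M.
  by move=> kN; apply: vM; exact: grid_bounds (gg n) (ltnW kN).
have mf n : measurable_fun `]a, b] (EFin \o f n).
  apply/measurable_EFinP; apply: measurable_funD; apply: measurable_funM;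
    try (by apply: measurable_funTS; exact: measurable_stepf).
  + by apply/measurable_EFinP; exact: measurable_int iA'.
  + by apply/measurable_EFinP; exact: measurable_int iB'.
pose h s := (M * `|A s| + M * `|B s|)%:E.
have ih : mu.-integrable `]a, b] h.
  rewrite (_ : h = (fun s => M%:E * (EFin \o (Num.norm \o A)) s + M%:E * (EFin \o (Num.norm \o B)) s)%E) //.
  apply: integrableD => //; apply: integrableZl => //.
  + exact: integrable_norm iA'.
  + exact: integrable_norm iB'.
have := @dominated_cvg _ _ _ mu `]a, b]%classic (measurable_itv _)
  (fun n => EFin \o f n) (cst 0%E) h mf _ _ ih _.
rewrite integral0 => cI.
apply: fine_cvg; apply: cI => //.
- move=> s; rewrite /= in_itv/= => sab; apply/cvg_EFin; first exact: nearW.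
  rewrite -(tan _ sab); apply: cvgD; apply: cvgM; try exact: cvg_cst.
  + exact: cvg_stepf.
  + exact: cvg_stepf.
- move=> n s sab /=; rewrite lee_fin /f; apply: (le_trans (ler_normD _ _)).
  rewrite !normrM; apply: lerD; apply: ler_wpM2r => //; apply: (stepf_le _ (gg n)) => //.
  + exact: ug.
  + exact: vg.
Qed.

Lemma riemann_sum_cvg (h : R -> R) (M : R) : left_continuous_on a b h -> 0 <= M ->
  (forall s, a <= s <= b -> `|h s| <= M) ->
  \sum_(k < N n) h (g n k) ^+ 2 * (g n k.+1 - g n k) @[n --> \oo] -->
    \int[mu]_(s in `[a, b]) (h s ^+ 2).
Proof.
move=> lh M0 hM.
have sub : `]a, b] `<=` `[a, b] by apply: subset_itvr; rewrite bnd_simp.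
have hg n k : (k < N n)%N -> `|(h \o g n) k| <= M.
  by move=> kN; apply: hM; exact: grid_bounds (gg n) (ltnW kN).
pose f n s := stepf (N n) (g n) (h \o g n) s ^+ 2.
have mf n : measurable_fun setT (f n) by apply: measurable_funX; exact: measurable_stepf.
have icst (k : R) : mu.-integrable `]a, b] (EFin \o cst k).
  apply/integrableP; split; first by apply/measurable_EFinP.
  under eq_integral do rewrite /=.
  rewrite integral_cst//= lebesgue_measure_itv/= lte_fin.
  by case: ifP => _; rewrite ?mule0// -EFinD -EFinM ltry.
have SE n : \sum_(k < N n) h (g n k) ^+ 2 * (g n k.+1 - g n k) =
    fine (\int[mu]_(s in `]a, b]) (f n s)%:E)%E.
  rewrite integral_itv_obnd_cbnd; last by apply/measurable_EFinP; exact: measurable_funTS.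
  rewrite (integral_step_sqr (gg n) (step_stepf _ (gg n)))/=.
  apply: eq_bigr => k _; rewrite (stepfE _ (gg n) (ltn_ord k))//.
  by have [_ _ /(_ _ (ltn_ord k)) ->] := gg n; rewrite lexx.
have cf s : a < s <= b -> f n s @[n --> \oo] --> h s ^+ 2.
  by move=> sab; have c1 := cvg_stepf ab NN lh sab; have := cvgM c1 c1; exact.
have fM n s : `|f n s| <= M ^+ 2.
  by rewrite normrX lerXn2r ?nnegrE//; apply: (stepf_le _ (gg n)) => //; exact: hg.
under eq_cvg do rewrite SE.
have := @dominated_cvg _ _ _ mu `]a, b]%classic (measurable_itv _)
  (fun n => EFin \o f n) (fun s => (h s ^+ 2)%:E) (EFin \o cst (M ^+ 2)) _ _ _ (icst _) _.
move=> cI.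
(* Left continuity already gives measurability: the square is a pointwise limit of step
   functions. *)
have mh2 : measurable_fun `]a, b] (fun s => (h s ^+ 2)%:E).
  apply: (emeasurable_fun_cvg (fun n => EFin \o f n)).
  - by move=> n; apply/measurable_EFinP; exact: measurable_funTS.
  - by move=> s; rewrite /= in_itv/= => sab; apply/cvg_EFin; [exact: nearW|exact: cf].
rewrite /Rintegral -integral_itv_obnd_cbnd//.
apply: fine_cvg; rewrite fineK; last first.
  rewrite ge0_fin_numE; last by apply: integral_ge0 => s _; rewrite lee_fin sqr_ge0.
  apply: (@le_lt_trans _ _ (\int[mu]_(s in `]a, b]) (M ^+ 2)%:E)%E); last first.
    have /integrableP[_] := icst (M ^+ 2).
    by under eq_integral do rewrite /= ger0_norm ?sqr_ge0//.
  apply: ge0_le_integral => //.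
  - by move=> s _; rewrite lee_fin sqr_ge0.
  - move=> s sab; rewrite lee_fin -real_normK ?num_real// lerXn2r ?nnegrE//.
    by apply: hM; have := sub _ sab; rewrite /= in_itv.
apply: cI => //.
- by move=> n; apply/measurable_EFinP; exact: (measurable_funTS (mf n)).
- by move=> s; rewrite /= in_itv/= => sab; apply/cvg_EFin; [exact: nearW|exact: cf].
- by move=> n s _ /=; rewrite lee_fin.
Qed.

End limits.
End path_limits.

(** * The Ito formula along one path *)

Section path_limit.
Context (R : realType).
Local Notation mu := (@lebesgue_measure R).
Variables (a b c M : R) (N : nat -> nat).
Hypotheses (ab : a < b) (c0 : 0 <= c) (M0 : 0 <= M) (NN : forall n, (n < N n)%N).
Local Notation g n := (ugrid a b (N n)).

(** On a path of an Ito process with drift [A] this is the increment of its stochastic integral over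
    one cell. *)
Definition noise_part (u A : R -> R) n k :=
  u (g n k.+1) - u (g n k) - \int[mu]_(s in `]g n k, g n k.+1]) A s.

Lemma telescope_sqr n (u : R -> R) :
  u b ^+ 2 - u a ^+ 2 = \sum_(k < N n) (2 * (u (g n k) * (u (g n k.+1) - u (g n k)))
    + (u (g n k.+1) - u (g n k)) ^+ 2).
Proof.
have [ga gb _] := ugridP ab (leq_ltn_trans (leq0n n) (NN n)).
have -> : u b ^+ 2 - u a ^+ 2 = u (g n (N n)) ^+ 2 - u (g n 0%N) ^+ 2 by rewrite gb ga.
rewrite -(telescope_sumr (fun k => u (g n k) ^+ 2))// big_mkord.
by apply: eq_bigr => k _; ring.
Qed.

(** The increment of [u] is [h dW] plus a remainder, made of the drift and of the error in replacing
    the stochastic integral by [h dW]. The sum of the squares of the main part is at most [L], so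
    [sum_sqr_perturb] reduces the claim to the squares of [h dW], which the third hypothesis
    compares with [c * h ^+ 2] times the cell lengths. *)
Lemma quadratic_variation_bound n (u A h W : R -> R) (e r lam L : R) :
  0 < lam ->
  \sum_(k < N n) (noise_part u A n k - h (g n k) * (W (g n k.+1) - W (g n k))) ^+ 2 <= e ->
  \sum_(k < N n) (\int[mu]_(s in `]g n k, g n k.+1]) A s) ^+ 2 <= r ->
  `|\sum_(k < N n) h (g n k) ^+ 2 * ((W (g n k.+1) - W (g n k)) ^+ 2 - c * (g n k.+1 - g n k))| <= e ->
  e + c * \sum_(k < N n) h (g n k) ^+ 2 * (g n k.+1 - g n k) <= L ->
  `|\sum_(k < N n) (u (g n k.+1) - u (g n k)) ^+ 2 -
    c * \sum_(k < N n) h (g n k) ^+ 2 * (g n k.+1 - g n k)| <=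
  e + (lam * L + (1 + lam^-1) * (2 * (r + e))).
Proof.
move=> lam0 h1 h2 h3 h4.
pose al k := \int[mu]_(s in `]g n k, g n k.+1]) A s.
pose q k := al k + (noise_part u A n k - h (g n k) * (W (g n k.+1) - W (g n k))).
pose p k := h (g n k) * (W (g n k.+1) - W (g n k)).
have := @sum_sqr_perturb R (N n) p q lam lam0.
rewrite (eq_bigr (fun k : 'I_(N n) => (u (g n k.+1) - u (g n k)) ^+ 2)); last first.
  by move=> k _; rewrite /p /q /noise_part /al; congr (_ ^+ 2); ring.
set S := \sum_(k < N n) (u _ - _) ^+ 2; set S' := \sum_(k < N n) p k ^+ 2 => pert.
set Rs := \sum_(k < N n) h _ ^+ 2 * (_ - _) in h4 *.
have S'E : S' - c * Rs = \sum_(k < N n) h (g n k) ^+ 2 * ((W (g n k.+1) - W (g n k)) ^+ 2 - c * (g n k.+1 - g n k)).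
  rewrite mulr_sumr -sumrB; apply: eq_bigr => k _; rewrite /p; ring.
rewrite -S'E in h3.
have qle : \sum_(k < N n) q k ^+ 2 <= 2 * (r + e).
  apply: (@le_trans _ _ (\sum_(k < N n) 2 * (al k ^+ 2 +
     (noise_part u A n k - h (g n k) * (W (g n k.+1) - W (g n k))) ^+ 2))).
    apply: ler_sum => k _; rewrite /q; set x := noise_part _ _ _ _ - _.
    by have := sqr_oppr_subr_le (- al k) (- x); rewrite !opprK !sqrrN.
  by rewrite -mulr_sumr big_split/= ler_wpM2l// lerD.
have S'L : S' <= L.
  apply: le_trans h4; rewrite -lerBlDr; exact: le_trans (ler_norm _) h3.
have -> : S - c * Rs = (S' - c * Rs) + (S - S') by ring.
apply: (le_trans (ler_normD _ _)); apply: lerD => //; apply: (le_trans pert).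
apply: lerD; first by rewrite ler_wpM2l// ltW.
by rewrite ler_wpM2l// addr_ge0// invr_ge0 ltW.
Qed.

(** The deterministic core. All probabilistic input sits in the last hypothesis: for every [e], five
    sums are small for some arbitrarily large [n]. The limits that need no probability (drift,
    squared drift, Riemann sums) hold for all large [n], so one common [n] can be chosen, large
    enough for the clipping to be invisible. *)
Lemma path_limit (B : nat -> R) (u v hu hv Au Av W : R -> R) :
  (forall K, \forall n \near \oo, K <= B n) ->
  left_continuous_on a b u -> left_continuous_on a b v ->
  left_continuous_on a b hu -> left_continuous_on a b hv ->
  (forall s, a <= s <= b -> [/\ `|u s| <= M, `|v s| <= M, `|hu s| <= M & `|hv s| <= M]) ->
  mu.-integrable `[a, b] (EFin \o Au) -> mu.-integrable `[a, b] (EFin \o Av) ->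
  (forall s, a < s <= b -> u s * Au s + v s * Av s = 0) ->
  (forall e : R, 0 < e -> forall n0, exists2 n, (n0 <= n)%N &
    [/\ (\sum_(k < N n) (clip (B n) (u (g n k)) * noise_part u Au n k +
           clip (B n) (v (g n k)) * noise_part v Av n k)) ^+ 2 <= e,
        \sum_(k < N n) (noise_part u Au n k - clip (B n) (hu (g n k)) * (W (g n k.+1) - W (g n k))) ^+ 2 <= e,
        \sum_(k < N n) (noise_part v Av n k - clip (B n) (hv (g n k)) * (W (g n k.+1) - W (g n k))) ^+ 2 <= e,
        `|\sum_(k < N n) clip (B n) (hu (g n k)) ^+ 2 * ((W (g n k.+1) - W (g n k)) ^+ 2 - c * (g n k.+1 - g n k))| <= e &
        `|\sum_(k < N n) clip (B n) (hv (g n k)) ^+ 2 * ((W (g n k.+1) - W (g n k)) ^+ 2 - c * (g n k.+1 - g n k))| <= e]) ->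
  u b ^+ 2 + v b ^+ 2 = u a ^+ 2 + v a ^+ 2 +
    c * (\int[mu]_(s in `[a, b]) (hu s ^+ 2) + \int[mu]_(s in `[a, b]) (hv s ^+ 2)).
Proof.
move=> By lu lv lhu lhv bd iAu iAv tan freq.
set Iu := \int[mu]_(s in `[a, b]) (hu s ^+ 2); set Iv := \int[mu]_(s in `[a, b]) (hv s ^+ 2).
apply/eqP; rewrite -subr_eq0 -normr_le0; apply/ler_addgt0Pr => e' e'0; rewrite add0r.
(* The errors collected at the end amount to at most [16 * e + 2 * c * e], so this denominator is
   generous. *)
pose e := e' / (100 + 10 * c).
have e0 : 0 < e by rewrite divr_gt0// ltr_wpDr// mulr_ge0.
pose L := 1 + c * (Iu + 1) + c * (Iv + 1).
have Iu0 : 0 <= Iu by apply: Rintegral_ge0 => s _; exact: sqr_ge0.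
have Iv0 : 0 <= Iv by apply: Rintegral_ge0 => s _; exact: sqr_ge0.
have L1 : 1 <= L by rewrite /L -addrA lerDl addr_ge0// mulr_ge0// addr_ge0.
have L0 : 0 < L by exact: lt_le_trans L1.
pose lam := e / L.
have lam0 : 0 < lam by rewrite divr_gt0.
pose k1 := 1 + lam^-1.
have k10 : 1 <= k1 by rewrite lerDl invr_ge0 ltW.
have k1p : 0 < k1 by exact: lt_le_trans k10.
(* The bound by 1 keeps the sums below [L]; the bounds by [e / k1] and [e] serve
   [quadratic_variation_bound]; the bound by [e ^+ 2] is there because the cross term is controlled
   through its square. *)
pose z := Num.min 1 (Num.min (e / k1) (Num.min e (e ^+ 2))).
have z0 : 0 < z by rewrite !lt_min ltr01 e0 divr_gt0//= exprn_gt0.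
have ek : 0 < e / k1 by rewrite divr_gt0.
have h1 := small_cells ab NN iAu ek.
have h2 := small_cells ab NN iAv ek.
have uM s : a <= s <= b -> `|u s| <= M by move=> /bd[].
have vM s : a <= s <= b -> `|v s| <= M by move=> /bd[].
have huM s : a <= s <= b -> `|hu s| <= M by move=> /bd[].
have hvM s : a <= s <= b -> `|hv s| <= M by move=> /bd[].
have /cvgrPdist_le/(_ _ e0) h3 := drift_sum_cvg0 ab NN lu lv M0 uM vM iAu iAv tan.
have m10 : 0 < Num.min 1 e by rewrite lt_min ltr01.
have /cvgrPdist_le/(_ _ m10) h4 := riemann_sum_cvg ab NN lhu M0 huM.
have /cvgrPdist_le/(_ _ m10) h5 := riemann_sum_cvg ab NN lhv M0 hvM.
have : \forall n \near \oo, [/\ M <= B n,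
    \sum_(k < N n) (\int[mu]_(s in `]g n k, g n k.+1]) Au s) ^+ 2 <= e / k1,
    \sum_(k < N n) (\int[mu]_(s in `]g n k, g n k.+1]) Av s) ^+ 2 <= e / k1,
    `|0 - \sum_(k < N n) (u (g n k) * \int[mu]_(s in `]g n k, g n k.+1]) Au s
      + v (g n k) * \int[mu]_(s in `]g n k, g n k.+1]) Av s)| <= e &
    `|Iu - \sum_(k < N n) hu (g n k) ^+ 2 * (g n k.+1 - g n k)| <= Num.min 1 e /\
    `|Iv - \sum_(k < N n) hv (g n k) ^+ 2 * (g n k.+1 - g n k)| <= Num.min 1 e].
  by near=> n; split; [|..|split]; near: n.
move=> -[n0 _ hn0]; have [n n0n [f1 f2 f3 f4 f5]] := freq z z0 n0.
have [{}h0 {}h1 {}h2 {}h3 [{}h4 {}h5]] := hn0 n n0n.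
have gab k : (k < N n)%N -> a <= g n k <= b.
  by move=> kN; apply: grid_bounds (ugridP ab (leq_ltn_trans (leq0n n) (NN n))) (ltnW kN).
have cl (f : R -> R) k : (forall s, a <= s <= b -> `|f s| <= M) -> (k < N n)%N -> clip (B n) (f (g n k)) = f (g n k).
  by move=> fM kN; apply: clip_id; exact: le_trans (fM _ (gab _ kN)) h0.
have {}f1 : (\sum_(k < N n) (u (g n k) * noise_part u Au n k + v (g n k) * noise_part v Av n k)) ^+ 2 <= z.
  by apply: le_trans f1; rewrite le_eqVlt; apply/predU1P; left; congr (_ ^+ 2); apply: eq_bigr => k _; rewrite !cl.
have {}f2 : \sum_(k < N n) (noise_part u Au n k - hu (g n k) * (W (g n k.+1) - W (g n k))) ^+ 2 <= z.
  by apply: le_trans f2; rewrite le_eqVlt; apply/predU1P; left; apply: eq_bigr => k _; rewrite !cl.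
have {}f3 : \sum_(k < N n) (noise_part v Av n k - hv (g n k) * (W (g n k.+1) - W (g n k))) ^+ 2 <= z.
  by apply: le_trans f3; rewrite le_eqVlt; apply/predU1P; left; apply: eq_bigr => k _; rewrite !cl.
have {}f4 : `|\sum_(k < N n) hu (g n k) ^+ 2 * ((W (g n k.+1) - W (g n k)) ^+ 2 - c * (g n k.+1 - g n k))| <= z.
  by apply: le_trans f4; rewrite le_eqVlt; apply/predU1P; left; congr `|_|; apply: eq_bigr => k _; rewrite !cl.
have {}f5 : `|\sum_(k < N n) hv (g n k) ^+ 2 * ((W (g n k.+1) - W (g n k)) ^+ 2 - c * (g n k.+1 - g n k))| <= z.
  by apply: le_trans f5; rewrite le_eqVlt; apply/predU1P; left; congr `|_|; apply: eq_bigr => k _; rewrite !cl.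
move: h4 h5; set Ru := \sum_(k < N n) hu _ ^+ 2 * (_ - _); set Rv := \sum_(k < N n) hv _ ^+ 2 * (_ - _).
rewrite !le_min => /andP[h4 h4'] /andP[h5 h5'].
have z1 : z <= 1 by rewrite /z ge_min lexx.
have zk : z <= e / k1 by rewrite /z !ge_min lexx ?orbT.
have ze : z <= e by rewrite /z !ge_min lexx ?orbT.
have ze2 : z <= e ^+ 2 by rewrite /z !ge_min lexx ?orbT.
have Lu : z + c * Ru <= L.
  rewrite /L -addrA lerD// (@le_trans _ _ (c * (Iu + 1)))//; last by rewrite lerDl mulr_ge0// addr_ge0.
  by rewrite ler_wpM2l// -lerBlDl (le_trans (ler_norm _))// distrC.
have Lv : z + c * Rv <= L.
  rewrite /L -addrA lerD// (@le_trans _ _ (c * (Iv + 1)))//; last by rewrite lerDr mulr_ge0// addr_ge0.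
  by rewrite ler_wpM2l// -lerBlDl (le_trans (ler_norm _))// distrC.
have Q (r : R) : e + (lam * L + k1 * (2 * (e / k1 + e / k1))) = 6 * e.
  by rewrite /lam; field; rewrite !gt_eqF.
have qv (S : R) : S <= z + (lam * L + k1 * (2 * (e / k1 + z))) -> S <= 6 * e.
  move=> /le_trans; apply; rewrite -(Q 0); apply: lerD => //; rewrite lerD2l.
  by rewrite ler_wpM2l ?(ltW k1p)// ler_wpM2l// lerD2l.
have qu := qv _ (quadratic_variation_bound lam0 f2 h1 f4 Lu).
have qv' := qv _ (quadratic_variation_bound lam0 f3 h2 f5 Lv).
move: qu qv'; rewrite -/Ru -/Rv.
set Su := \sum_(k < N n) (u _ - _) ^+ 2; set Sv := \sum_(k < N n) (v _ - _) ^+ 2 => qu qv'.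
set Z := \sum_(k < N n) _ in f1; set Dr := \sum_(k < N n) _ in h3.
have Ze : `|Z| <= e.
  by rewrite -(@ler_pXn2r _ 2) ?nnegrE ?(ltW e0)// real_normK ?num_real// (le_trans f1).
rewrite sub0r normrN in h3.
have X : u b ^+ 2 + v b ^+ 2 - (u a ^+ 2 + v a ^+ 2 + c * (Iu + Iv)) =
   2 * Dr + 2 * Z + (Su - c * Ru) + (Sv - c * Rv) + c * (Ru - Iu) + c * (Rv - Iv).
  have -> : u b ^+ 2 + v b ^+ 2 - (u a ^+ 2 + v a ^+ 2 + c * (Iu + Iv)) =
    (u b ^+ 2 - u a ^+ 2) + (v b ^+ 2 - v a ^+ 2) - c * (Iu + Iv) by ring.
  rewrite !(telescope_sqr n) !big_split/= -/Su -/Sv.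
  have -> : 2 * Dr + 2 * Z = \sum_(k < N n) (2 * (u (g n k) * (u (g n k.+1) - u (g n k)))) +
      \sum_(k < N n) (2 * (v (g n k) * (v (g n k.+1) - v (g n k)))).
    rewrite -mulrDr /Dr /Z -!big_split mulr_sumr/=; apply: eq_bigr => k _.
    rewrite /noise_part; ring.
  ring.
rewrite X.
have cRu : `|c * (Ru - Iu)| <= c * e by rewrite normrM ger0_norm// ler_wpM2l// distrC.
have cRv : `|c * (Rv - Iv)| <= c * e by rewrite normrM ger0_norm// ler_wpM2l// distrC.
have eE : e' = 100 * e + 10 * (c * e).
  by rewrite /e; field; rewrite gt_eqF// ltr_wpDr// mulr_ge0.
have ce : 0 <= c * e by rewrite mulr_ge0// ltW.
move: Ze h3 qu qv' cRu cRv; rewrite !ler_norml eE.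
by move: e0 ce; clear; move=> *; lra.
Unshelve. all: by end_near. Qed.

End path_limit.

(** * Quadratic variation of Ito processes *)

Section left_continuity.
Context (R : realType).
Implicit Types (a b : R) (u : R -> R).

Lemma left_continuous_onW a b b' u : b' <= b -> left_continuous_on a b u ->
  left_continuous_on a b' u.
Proof. by move=> bb lu s /andP[h1 h2]; apply: lu; rewrite h1 (le_trans h2). Qed.

Lemma within_continuous_left a b u : {within `[a, b], continuous u} ->
  left_continuous_on a b u.
Proof.
move=> /subspace_continuousP cu s /andP[as_ sb] e e0.
have sin : `[a, b]%classic s by rewrite /= in_itv/= (ltW as_) sb.
have /cvgrPdist_lt/(_ _ e0) := cu s sin.
rewrite /prop_near1/within/= => -[dl /= dl0 hdl]; exists dl => // r ar /andP[h1 h2].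
rewrite distrC; apply: hdl.
  by rewrite /= ger0_norm ?subr_ge0 ?(ltW h2)// ltrBlDl -ltrBlDr.
by rewrite in_itv/= ar (le_trans (ltW h2)).
Qed.

Lemma within_continuous_bounded a b u : {within `[a, b], continuous u} ->
  exists2 M, 0 <= M & forall s, a <= s <= b -> `|u s| <= M.
Proof.
move=> cu; have [ab|ba] := leP a b; last first.
  exists 0 => // s /andP[h1 h2]; exfalso.
  by have := lt_le_trans ba (le_trans h1 h2); rewrite ltxx.
have cn : {within `[a, b], continuous (fun s => `|u s|)}.
  by move=> s; apply: continuous_comp; [exact: cu|exact: norm_continuous].
have [s0 _ hs0] := EVT_max ab cn.
by exists `|u s0| => // s sab; apply: hs0; rewrite in_itv.
Qed.

Lemma clip_le_norm (B v : R) : 0 <= B -> `|clip B v| <= `|v|.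
Proof.
move=> B0; have [h|h] := leP `|v| B; first by rewrite clip_id.
by apply: (le_trans (clip_le v B0)); exact: ltW.
Qed.

End left_continuity.

Section tame.
Context (d : measure_display) (Omega : measurableType d) (R : realType).
Variables (P : probability Omega R) (theta T : R) (F : R -> set (set Omega)).
Variables (w : R -> Omega -> R) (tau : Omega -> R).
Hypotheses (theta_lt_T : theta < T).
Hypotheses (F_filtration : is_filtration P theta T F) (w_wiener : is_wiener P theta T F w).
Hypotheses (tau_range : {ae P, forall x, theta < tau x <= T}).
Local Notation c := (normal_second_moment R).
Local Notation mu := (@lebesgue_measure R).

Lemma aeI (Q Q' : Omega -> Prop) : {ae P, forall x, Q x} -> {ae P, forall x, Q' x} ->
  {ae P, forall x, Q x /\ Q' x}.
Proof. by move=> h h'; apply: filterS2 h h' => x. Qed.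

(** Continuous Ito processes whose diffusion coefficient has continuous paths up to [tau]; the drift
    is only integrable, as in [ito_equation]. *)
Record tame (a b X : R -> Omega -> R) : Prop := {
  tame_adapted : adapted_continuous P theta T F tau X;
  tame_eq : ito_equation P theta T F w tau a b X;
  tame_cont : {ae P, forall x, {within `[theta, tau x], continuous (b ^~ x)}} }.

(** For a process in [tame] this is a version of the Ito integral of [until tau b] over
    [[theta, t]]. *)
Definition noise_of (a X : R -> Omega -> R) t x :=
  stopped tau X t x - X theta x - \int[mu]_(s in `[theta, Num.min t (tau x)]) a s x.

Record tame_path (a b X : R -> Omega -> R) (x : Omega) : Prop := {
  tp_tau : theta < tau x <= T;
  tp_cont : {within `[theta, T], continuous (stopped tau X ^~ x)};
  tp_contb : {within `[theta, tau x], continuous (b ^~ x)};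
  tp_left : left_continuous_on theta T (until tau b ^~ x);
  tp_bound : exists2 M, 0 <= M & forall s, theta <= s <= T ->
    `|stopped tau X s x| <= M /\ `|until tau b s x| <= M;
  tp_meas : measurable_fun `[theta, T] (until tau b ^~ x);
  tp_int : mu.-integrable `[theta, T] (EFin \o (until tau a ^~ x));
  tp_noise : forall r s, theta <= r -> r <= s -> s <= T ->
    noise_of a X s x - noise_of a X r x =
    stopped tau X s x - stopped tau X r x - \int[mu]_(q in `]r, s]) until tau a q x }.

Lemma tame_path_ae a b X : tame a b X -> {ae P, forall x, tame_path a b X x}.
Proof.
move=> [[_ cX] [ma ia itoX] cb].
have TT : theta <= T <= T by rewrite lexx ltW.
have [[mb _] _ _] := itoX T TT.
have h := aeI tau_range (aeI cX (aeI cb (aeI ia (measurable_adapted_path mb)))).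
apply: filterS h => x [tx [cx [cbx [iax mbx]]]].
have /andP[t1 t2] := tx.
have lb : left_continuous_on theta T (until tau b ^~ x).
  move=> s /andP[ts sT] e e0; rewrite /until.
  have [st|ts'] := leP s (tau x).
    have [|dl dl0 hdl] := within_continuous_left cbx _ e0 (s := s); first by rewrite ts.
    exists dl => // r tr /andP[h1 h2]; rewrite (le_trans (ltW h2) st).
    by apply: hdl; rewrite ?h1.
  (* At a time [s] beyond [tau x] the cut integrand is constantly 0 on the interval of this length
     to the left of [s]. *)
  exists (s - tau x); first by rewrite subr_gt0.
  move=> r _ /andP[h1 _]; rewrite opprB addrCA subrr addr0 in h1.
  by rewrite leNgt h1/= subrr normr0.
have [M1 M10 hM1] := within_continuous_bounded cx.
have [M2 M20 hM2] := within_continuous_bounded cbx.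
have eqi (s : R) : theta <= s -> s <= T ->
    {in [set: R], (a ^~ x) \_ `[theta, Num.min s (tau x)] =1 (until tau a ^~ x) \_ `[theta, s]}.
  move=> _ _ q _; rewrite /until !patchE !mem_setE !in_itv/= le_min.
  by case: (theta <= q) => //=; case: (q <= s) => //=; case: ifP.
have ix : mu.-integrable `[theta, T] (EFin \o (until tau a ^~ x)).
  rewrite integrable_mkcond//.
  have -> : (EFin \o (until tau a ^~ x)) \_ `[theta, T] = (fun s => (a s x)%:E) \_ `[theta, tau x].
    apply/funext => q; rewrite /until !patchE !mem_setE !in_itv/=.
    case: (theta <= q) => //=; case: (leP q (tau x)) => h1; case: (leP q T) => h2 //=.
    by have := le_lt_trans (le_trans h1 t2) h2; rewrite ltxx.
  by rewrite -integrable_mkcond.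
split => //.
- exists (Num.max M1 M2); first by rewrite le_max M10.
  move=> s sT; rewrite !le_max hM1//; split => //; rewrite /until.
  case: ifP => st; last by rewrite normr0 M20 orbT.
  by rewrite hM2 ?orbT// st andbT; case/andP: sT.
- move=> r s tr rs sT; rewrite /noise_of.
  have ei q : theta <= q -> q <= T -> \int[mu]_(p in `[theta, Num.min q (tau x)]) a p x =
      \int[mu]_(p in `[theta, q]) until tau a p x.
    move=> tq qT; rewrite Rintegral_mkcond [RHS]Rintegral_mkcond.
    by apply: eq_Rintegral => p _; apply: (eqi q tq qT); rewrite inE.
  rewrite !ei//; last 2 first.
  + exact: le_trans rs _.
  + exact: le_trans rs.
  rewrite -(@Rintegral_itvB _ (until tau a ^~ x) (BLeft theta) (BRight s) r).
  + ring.
  + by apply: integrableS ix => //; apply: subset_itvl; rewrite bnd_simp.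
  + by rewrite bnd_simp.
  + by rewrite bnd_simp.
Qed.

(** Integrands are clipped at level [n.+1] and [quadratic_noise] then costs
    [n.+1 ^ 4] times the mesh, which must tend to 0. *)
Definition mesh_size (n : nat) : nat := (n.+1 ^ 5)%N.

Lemma mesh_size_gt n : (n < mesh_size n)%N.
Proof.
by rewrite /mesh_size -[X in (X < _)%N]/(n.+1.-1) prednK// -{1}(expn1 n.+1) leq_pexp2l.
Qed.

Local Notation level n := (n.+1%:R : R).

Lemma tame_noise a b X : tame a b X -> forall t, theta <= t <= T ->
  is_ito_integral P theta T F w (until tau b) t (noise_of a X t).
Proof. by move=> [_ [_ _ h] _]. Qed.

Lemma tame_measurable_adapted a b X : tame a b X -> measurable_adapted P theta T F (until tau b).
Proof.
move=> tX; have TT : theta <= T <= T by rewrite lexx ltW.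
by have [[]] := tame_noise tX TT.
Qed.

(** * Estimates on uniform grids up to a fixed time *)

Section fixed_time.
Variables (t : R) (tht : theta < t) (tT : t <= T).
Local Notation N := mesh_size.
Local Notation g n := (ugrid theta t (N n)).

Let gg n : grid (N n) (g n) theta t.
Proof. by apply: ugridP => //; exact: leq_ltn_trans (mesh_size_gt n). Qed.

Let gT n k : (k < N n)%N -> theta <= g n k <= T.
Proof.
move=> kN; have /andP[-> h] := grid_bounds (gg n) (ltnW kN); exact: le_trans tT.
Qed.

Let sF n k : (k < N n)%N -> sigma_algebra setT (F (g n k)).
Proof. by move=> kN; apply: (filt_sigma F_filtration); exact: gT. Qed.

(** The integral condition of [block_estimate] is replaced by conditions on single paths: the
    sampled integrand tends to 0 pointwise and stays bounded, so its square integral tends to 0 on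
    almost every path and hence in probability. The bound [level n], uniform in the outcome, makes
    the coefficients admissible; the bound [M], which depends on the path, gives domination. *)
Lemma tame_estimate (a1 b1 X1 a2 b2 X2 : R -> Omega -> R) (c1 c2 c3 : nat -> nat -> Omega -> R)
    (beta : nat -> nat -> nat) (K : nat -> nat) :
  tame a1 b1 X1 -> tame a2 b2 X2 ->
  (forall n k, (k < N n)%N -> [/\ meas_wrt (F (g n k)) (c1 n k), meas_wrt (F (g n k)) (c2 n k) &
     meas_wrt (F (g n k)) (c3 n k)]) ->
  (forall n k x, [/\ `|c1 n k x| <= level n, `|c2 n k x| <= level n & `|c3 n k x| <= level n]) ->
  (forall n k, (k < N n)%N -> (beta n k < K n)%N) ->
  {ae P, forall x, exists M, forall n k, (k < N n)%N ->
    [/\ `|c1 n k x| <= M, `|c2 n k x| <= M & `|c3 n k x| <= M]} ->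
  {ae P, forall x, forall s, theta < s <= t ->
     stepf (N n) (g n) (c1 n ^~ x) s * until tau b1 s x + stepf (N n) (g n) (c2 n ^~ x) s * until tau b2 s x
      - stepf (N n) (g n) (c3 n ^~ x) s @[n --> \oo] --> 0} ->
  forall eps eta : R, 0 < eps -> 0 < eta -> \forall n \near \oo, off_small P eta (fun x =>
    \sum_(j < K n) (\sum_(k < N n | beta n k == j)
      (c1 n k x * (noise_of a1 X1 (g n k.+1) x - noise_of a1 X1 (g n k) x)
     + c2 n k x * (noise_of a2 X2 (g n k.+1) x - noise_of a2 X2 (g n k) x)
     - c3 n k x * (w (g n k.+1) x - w (g n k) x))) ^+ 2 <= eps).
Proof.
move=> t1 t2 mc cB bK bd cv eps eta eps0 eta0.
have [S1 aS1] := ito_approximation theta_lt_T F_filtration w_wiener (tame_noise t1).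
have [S2 aS2] := ito_approximation theta_lt_T F_filtration w_wiener (tame_noise t2).
have m1 := tame_measurable_adapted t1; have m2 := tame_measurable_adapted t2.
have c0 := normal_second_moment_gt0 R.
(* Makes the bound [16 * c * delta / eps] of [block_estimate] equal to [eta / 2]. *)
pose delta := eps * eta / (32 * c).
have delta0 : 0 < delta by rewrite divr_gt0 ?mulr_gt0.
have eta4 : 0 < eta / 4 by rewrite divr_gt0.
pose D n s x := simple_process (SimpleData (N n) (g n) (c1 n)) s x * until tau b1 s x
  + simple_process (SimpleData (N n) (g n) (c2 n)) s x * until tau b2 s x
  - simple_process (SimpleData (N n) (g n) (c3 n)) s x.
have tT' : theta <= t <= T by rewrite ltW.
have jD n : jointly_measurable P theta T (D n).
  have js (cf : nat -> nat -> Omega -> R) : (forall k, (k < N n)%N -> meas_wrt (F (g n k)) (cf n k)) ->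
      jointly_measurable P theta T (simple_process (SimpleData (N n) (g n) (cf n))).
    move=> mcf; apply: jointly_measurable_simple => /= k kN.
    by apply: meas_wrt_measurable (mcf k kN); apply: (filt_sub F_filtration); exact: gT.
  apply: jointly_measurableB; last by apply: js => k /mc[].
  apply: jointly_measurableD; apply: jointly_measurableM.
  - by apply: js => k /mc[].
  - by case: m1.
  - by apply: js => k /mc[].
  - by case: m2.
have aeD : {ae P, forall x, forall delta : R, 0 < delta -> \forall n \near \oo,
     (\int[mu]_(s in `[theta, t]) (D n s x ^+ 2)%:E <= delta%:E)%E}.
  have h := aeI (tame_path_ae t1) (aeI (tame_path_ae t2) (aeI bd cv)).
  apply: filterS h => x [p1 [p2 [[M hM] cvx]]].
  have [M1 M10 hM1] := tp_bound p1; have [M2 M20 hM2] := tp_bound p2.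
  have M0 : 0 <= M.
    by have [] := hM 0%N 0%N isT => /(le_trans (normr_ge0 _)).
  apply: (@bounded_cvg_sqr _ theta t (M * M1 + M * M2 + M)).
  - move=> n.
    have sub : `[theta, t] `<=` `[theta, T] by apply: subset_itvl; rewrite bnd_simp.
    have ms S : measurable_fun `[theta, t] (simple_process S ^~ x).
      by apply: measurable_funTS; exact: measurable_simple_process.
    have mb1 : measurable_fun `[theta, t] (until tau b1 ^~ x) by apply: (measurable_funS _ sub (tp_meas p1)).
    have mb2 : measurable_fun `[theta, t] (until tau b2 ^~ x) by apply: (measurable_funS _ sub (tp_meas p2)).
    by apply: measurable_funB => //; apply: measurable_funD; exact: measurable_funM.
  - move=> n s /andP[ts st].
    have sT : theta <= s <= T by rewrite ts (le_trans st).
    have [_ k1] := hM1 s sT; have [_ k2] := hM2 s sT.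
    have l1 : `|simple_process (SimpleData (N n) (g n) (c1 n)) s x| <= M.
      by apply: (grid_simple_process_le s (gg n) M0) => k /hM[].
    have l2 : `|simple_process (SimpleData (N n) (g n) (c2 n)) s x| <= M.
      by apply: (grid_simple_process_le s (gg n) M0) => k /hM[].
    have l3 : `|simple_process (SimpleData (N n) (g n) (c3 n)) s x| <= M.
      by apply: (grid_simple_process_le s (gg n) M0) => k /hM[].
    apply: (le_trans (ler_normB _ _)); apply: lerD => //.
    by apply: (le_trans (ler_normD _ _)); rewrite !normrM; apply: lerD; exact: ler_pM.
  - exact: cvx.
have near_small := ae_cvg_off_small tT' jD aeD delta0 eta4.
near=> n.
have h1 : off_small P (eta / 4) (fun x => (\int[mu]_(s in `[theta, t]) (D n s x ^+ 2)%:E <= delta%:E)%E).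
  by near: n; exact: near_small.
have h2 := block_estimate F_filtration w_wiener aS1 aS2 m1 m2 (gg n) tht tT (mc n)
  (fun k x _ => cB n k x) (bK n) (ler0n _ _) delta0 eps0 eta4.
have := off_smallI h1 h2; move/off_smallW; apply.
  rewrite (_ : 16 * c * delta / eps = eta / 2); last by rewrite /delta; field; rewrite !gt_eqF.
  by rewrite le_eqVlt; apply/predU1P; left; field.
by move=> x [k1 k2]; exact: k2.
Unshelve. all: by end_near. Qed.

Lemma cvg_stepf_clip (u : R -> R) (M s : R) : left_continuous_on theta t u ->
  (forall s, theta <= s <= t -> `|u s| <= M) -> theta < s <= t ->
  stepf (N n) (g n) (fun k => clip (level n) (u (g n k))) s @[n --> \oo] --> u s.
Proof.
move=> lu uM st; apply: cvg_trans (cvg_stepf tht mesh_size_gt lu st).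
apply: near_eq_cvg; near=> n; apply: eq_bigr => k _; congr (_ * _); rewrite clip_id//.
apply: (le_trans (uM _ (grid_bounds (gg n) (ltnW (ltn_ord k))))).
by apply: (@le_trans _ _ n%:R); [near: n; exact: nbhs_infty_ger|rewrite ler_nat].
Unshelve. all: by end_near. Qed.

Lemma clip_meas n k (X : Omega -> R) : (k < N n)%N -> meas_wrt (F (g n k)) X ->
  meas_wrt (F (g n k)) (fun x => clip (level n) (X x)).
Proof.
move=> kN mX; apply: (meas_wrt_comp (sF kN) (measurable_clip (level n)) mX).
Qed.

Definition clipped_coef (b : R -> Omega -> R) n k x := clip (level n) (until tau b (g n k) x).
Definition clipped_path (X : R -> Omega -> R) n k x := clip (level n) (stopped tau X (g n k) x).

Lemma clipped_coef_meas a b X n k : tame a b X -> (k < N n)%N ->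
  meas_wrt (F (g n k)) (clipped_coef b n k).
Proof.
move=> tX kN; apply: clip_meas => //.
by have [_] := tame_measurable_adapted tX; apply; exact: gT.
Qed.

Lemma clipped_path_meas a b X n k : tame a b X -> (k < N n)%N ->
  meas_wrt (F (g n k)) (clipped_path X n k).
Proof.
move=> tX kN; apply: clip_meas => //.
by have [+ _] := tame_adapted tX; apply; exact: gT.
Qed.

Lemma tame_bound_t a b X x : tame_path a b X x -> exists2 M, 0 <= M & forall s, theta <= s <= t ->
    `|stopped tau X s x| <= M /\ `|until tau b s x| <= M.
Proof.
move=> /tp_bound[M M0 hM]; exists M => // s /andP[ts st]; apply: hM.
by rewrite ts (le_trans st).
Qed.

(** Every cell is its own block, and the integrand is [until tau b] minus its sampled version, which
    tends to 0 by left continuity. The second process is a dummy with coefficient 0. *)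
Lemma riemann_estimate a b X : tame a b X ->
  forall eps eta : R, 0 < eps -> 0 < eta -> \forall n \near \oo, off_small P eta (fun x =>
    \sum_(k < N n) ((noise_of a X (g n k.+1) x - noise_of a X (g n k) x)
     - clipped_coef b n k x * (w (g n k.+1) x - w (g n k) x)) ^+ 2 <= eps).
Proof.
move=> tX eps eta eps0 eta0.
have := @tame_estimate a b X a b X (fun _ _ _ => 1) (fun _ _ _ => 0) (clipped_coef b)
  (fun _ k => k) N tX tX _ _ _ _ _ eps eta eps0 eta0.
move=> est; apply: filterS (est _ _ _ _ _) => //.
- move=> n; move/off_smallW; apply => // x; apply: le_trans.
  rewrite le_eqVlt; apply/predU1P; left; apply: eq_bigr => k _; congr (_ ^+ 2).
  rewrite (big_pred1 k) => [|j]; first by rewrite mul1r mul0r addr0.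
  by rewrite /= -val_eqE.
- move=> n k kN; split; try (by apply: meas_wrt_cst; exact: sF).
  exact: clipped_coef_meas tX kN.
- move=> n k x; rewrite normr1 normr0 ler1n ler0n; split => //.
  exact: clip_le.
- apply: filterS (tame_path_ae tX) => x /tame_bound_t[M M0 hM].
  exists (Num.max 1 M) => n k kN; rewrite normr1 normr0 !le_max lexx ler01; split => //.
  apply/orP; right; apply: (le_trans (clip_le_norm _ (ler0n _ _))).
  by have [] := hM _ (grid_bounds (gg n) (ltnW kN)).
- apply: filterS (tame_path_ae tX) => x p s st.
  have [M M0 hM] := tame_bound_t p.
  have lb := left_continuous_onW tT (tp_left p).
  have h := @cvg_stepf_clip _ M s lb (fun s st => (hM s st).2) st.
  rewrite [X in _ --> X](_ : _ = until tau b s x - until tau b s x); last by rewrite subrr.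
  apply: cvgB h; apply: cvg_near_cst; apply: nearW => n.
  have [k kN ks] := grid_cell (gg n) st.
  by rewrite !(stepfE _ (gg n) kN ks) mul1r mul0r addr0.
Qed.

(** A single block: the integrand samples [X1] and [X2] against the diffusion coefficients and tends
    to [X1 b1 + X2 b2 = 0] up to [tau]; after [tau] the cut coefficients vanish. *)
Lemma tangent_estimate a1 b1 X1 a2 b2 X2 : tame a1 b1 X1 -> tame a2 b2 X2 ->
  (forall s x, X1 s x * b1 s x + X2 s x * b2 s x = 0) ->
  forall eps eta : R, 0 < eps -> 0 < eta -> \forall n \near \oo, off_small P eta (fun x =>
    (\sum_(k < N n) (clipped_path X1 n k x * (noise_of a1 X1 (g n k.+1) x - noise_of a1 X1 (g n k) x)
      + clipped_path X2 n k x * (noise_of a2 X2 (g n k.+1) x - noise_of a2 X2 (g n k) x))) ^+ 2 <= eps).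
Proof.
move=> t1 t2 tan eps eta eps0 eta0.
have := @tame_estimate a1 b1 X1 a2 b2 X2 (clipped_path X1) (clipped_path X2) (fun _ _ _ => 0)
  (fun _ _ => 0%N) (fun=> 1%N) t1 t2 _ _ _ _ _ eps eta eps0 eta0.
move=> est; apply: filterS (est _ _ _ _ _) => //.
- move=> n; move/off_smallW; apply => // x; apply: le_trans.
  rewrite le_eqVlt; apply/predU1P; left; rewrite [RHS]big_ord1; congr (_ ^+ 2).
  by apply: eq_big => // k _; rewrite mul0r subr0.
- move=> n k kN; split; last by apply: meas_wrt_cst; exact: sF.
  + exact: clipped_path_meas t1 kN.
  + exact: clipped_path_meas t2 kN.
- by move=> n k x; rewrite normr0 ler0n; split => //; exact: clip_le.
- apply: filterS (aeI (tame_path_ae t1) (tame_path_ae t2)) => x [/tame_bound_t[M1 M10 h1] /tame_bound_t[M2 M20 h2]].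
  exists (Num.max M1 M2) => n k kN; rewrite normr0 !le_max M10; split => //; apply/orP.
  + left; apply: (le_trans (clip_le_norm _ (ler0n _ _))).
    by have [] := h1 _ (grid_bounds (gg n) (ltnW kN)).
  + right; apply: (le_trans (clip_le_norm _ (ler0n _ _))).
    by have [] := h2 _ (grid_bounds (gg n) (ltnW kN)).
- apply: filterS (aeI (tame_path_ae t1) (tame_path_ae t2)) => x [p1 p2] s st.
  have [M1 M10 h1] := tame_bound_t p1; have [M2 M20 h2] := tame_bound_t p2.
  have l1 := left_continuous_onW tT (within_continuous_left (tp_cont p1)).
  have l2 := left_continuous_onW tT (within_continuous_left (tp_cont p2)).
  have k1 := @cvg_stepf_clip _ M1 s l1 (fun s st => (h1 s st).1) st.
  have k2 := @cvg_stepf_clip _ M2 s l2 (fun s st => (h2 s st).1) st.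
  rewrite [X in _ --> X](_ : _ = stopped tau X1 s x * until tau b1 s x +
    stopped tau X2 s x * until tau b2 s x - 0); last first.
    rewrite subr0 /stopped /until; case: ifP => sx; last by rewrite !mulr0 addr0.
    by rewrite min_l// tan.
  apply: cvgB.
    by apply: cvgD; apply: cvgM => //; exact: cvg_cst.
  apply: cvg_near_cst; apply: nearW => n.
  by have [k kN ks] := grid_cell (gg n) st; rewrite !(stepfE _ (gg n) kN ks).
Qed.

Lemma noise_estimate a b X : tame a b X ->
  forall eps eta : R, 0 < eps -> 0 < eta -> \forall n \near \oo, off_small P eta (fun x =>
    `|\sum_(k < N n) clipped_coef b n k x ^+ 2 *
       ((w (g n k.+1) x - w (g n k) x) ^+ 2 - c * (g n k.+1 - g n k))| <= eps).
Proof.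
move=> tX eps eta eps0 eta0.
pose C := (96 + 2 * c ^+ 2) * (t - theta) ^+ 2 / eps ^+ 2.
have C0 : 0 < C.
  rewrite divr_gt0 ?exprn_gt0// mulr_gt0 ?exprn_gt0 ?subr_gt0//.
  by rewrite ltr_wpDr// mulr_ge0// sqr_ge0.
near=> n.
have := @quadratic_noise _ _ _ _ _ _ _ _ F_filtration w_wiener (N n) (g n) t
  (clipped_coef b n) (level n) ((t - theta) / (N n)%:R) eps (gg n) tT _ _ _ eps0.
move=> h; apply: off_smallW (h _ _ _) _ _ => //.
- by move=> k kN; exact: clipped_coef_meas tX kN.
- by move=> k x kN; exact: clip_le.
- by move=> k kN; rewrite ugridS.
- rewrite (_ : _ / eps ^+ 2 = C / level n); last first.
    rewrite /C /mesh_size natrX; field; rewrite ?natr1 ?nat1r pnatr_eq0/=.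
    by rewrite gt_eqF.
  rewrite ler_pdivrMr// -ler_pdivrMl// (@le_trans _ _ n%:R) ?ler_nat//.
  by near: n; exact: nbhs_infty_ger.
Unshelve. all: by end_near. Qed.

(** The five estimates, each allowed an exceptional event of measure [eta / 5], hold together at a
    common grid; [path_limit] then concludes on each path outside a null set, which may depend on
    [t]. *)
Lemma tangential_ito_at (a1 b1 X1 a2 b2 X2 : R -> Omega -> R) : tame a1 b1 X1 -> tame a2 b2 X2 ->
  (forall s x, X1 s x * b1 s x + X2 s x * b2 s x = 0) ->
  (forall s x, X1 s x * a1 s x + X2 s x * a2 s x = 0) ->
  {ae P, forall x, stopped tau X1 t x ^+ 2 + stopped tau X2 t x ^+ 2 =
    stopped tau X1 theta x ^+ 2 + stopped tau X2 theta x ^+ 2 +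
    c * (\int[mu]_(s in `[theta, t]) (until tau b1 s x ^+ 2) +
         \int[mu]_(s in `[theta, t]) (until tau b2 s x ^+ 2))}.
Proof.
move=> t1 t2 tanb tana.
pose Q e n x := [/\
  (\sum_(k < N n) (clipped_path X1 n k x * (noise_of a1 X1 (g n k.+1) x - noise_of a1 X1 (g n k) x)
      + clipped_path X2 n k x * (noise_of a2 X2 (g n k.+1) x - noise_of a2 X2 (g n k) x))) ^+ 2 <= e,
  \sum_(k < N n) ((noise_of a1 X1 (g n k.+1) x - noise_of a1 X1 (g n k) x)
     - clipped_coef b1 n k x * (w (g n k.+1) x - w (g n k) x)) ^+ 2 <= e,
  \sum_(k < N n) ((noise_of a2 X2 (g n k.+1) x - noise_of a2 X2 (g n k) x)
     - clipped_coef b2 n k x * (w (g n k.+1) x - w (g n k) x)) ^+ 2 <= e,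
  `|\sum_(k < N n) clipped_coef b1 n k x ^+ 2 *
       ((w (g n k.+1) x - w (g n k) x) ^+ 2 - c * (g n k.+1 - g n k))| <= e &
  `|\sum_(k < N n) clipped_coef b2 n k x ^+ 2 *
       ((w (g n k.+1) x - w (g n k) x) ^+ 2 - c * (g n k.+1 - g n k))| <= e].
(* Smallness for arbitrarily large [n] is enough and, unlike convergence along a
   subsequence, does not need the Borel-Cantelli lemma. *)
have freq : {ae P, forall x, forall j n0, exists2 n, (n0 <= n)%N & Q j.+1%:R^-1 n x}.
  apply: ae_foralln => j; apply: ae_foralln => n0; apply: ae_off_small => eta eta0.
  have j0 : 0 < j.+1%:R^-1 :> R by [].
  have eta5 : 0 < eta / 5 by rewrite divr_gt0.
  near \oo => n.
  have n0n : (n0 <= n)%N by near: n; exact: nbhs_infty_ge.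
  have e1 : off_small P (eta / 5) (fun x => (\sum_(k < N n) (clipped_path X1 n k x * (noise_of a1 X1 (g n k.+1) x - noise_of a1 X1 (g n k) x)
      + clipped_path X2 n k x * (noise_of a2 X2 (g n k.+1) x - noise_of a2 X2 (g n k) x))) ^+ 2 <= j.+1%:R^-1).
    by near: n; exact: (tangent_estimate t1 t2 tanb).
  have e2 : off_small P (eta / 5) (fun x => \sum_(k < N n) ((noise_of a1 X1 (g n k.+1) x - noise_of a1 X1 (g n k) x)
     - clipped_coef b1 n k x * (w (g n k.+1) x - w (g n k) x)) ^+ 2 <= j.+1%:R^-1).
    by near: n; exact: (riemann_estimate t1).
  have e3 : off_small P (eta / 5) (fun x => \sum_(k < N n) ((noise_of a2 X2 (g n k.+1) x - noise_of a2 X2 (g n k) x)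
     - clipped_coef b2 n k x * (w (g n k.+1) x - w (g n k) x)) ^+ 2 <= j.+1%:R^-1).
    by near: n; exact: (riemann_estimate t2).
  have e4 : off_small P (eta / 5) (fun x => `|\sum_(k < N n) clipped_coef b1 n k x ^+ 2 *
       ((w (g n k.+1) x - w (g n k) x) ^+ 2 - c * (g n k.+1 - g n k))| <= j.+1%:R^-1).
    by near: n; exact: (noise_estimate t1).
  have e5 : off_small P (eta / 5) (fun x => `|\sum_(k < N n) clipped_coef b2 n k x ^+ 2 *
       ((w (g n k.+1) x - w (g n k) x) ^+ 2 - c * (g n k.+1 - g n k))| <= j.+1%:R^-1).
    by near: n; exact: (noise_estimate t2).
  have := off_smallI e1 (off_smallI e2 (off_smallI e3 (off_smallI e4 e5))).
  move/off_smallW; apply; first by rewrite le_eqVlt; apply/predU1P; left; field.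
  by move=> x [q1 [q2 [q3 [q4 q5]]]]; exists n.
apply: filterS (aeI freq (aeI (tame_path_ae t1) (tame_path_ae t2))) => x [fr [p1 p2]].
have [M1 M10 h1] := tame_bound_t p1; have [M2 M20 h2] := tame_bound_t p2.
have it a b X : tame_path a b X x -> mu.-integrable `[theta, t] (EFin \o (until tau a ^~ x)).
  move=> p; apply: integrableS (tp_int p) => //.
  by apply: subset_itvl; rewrite bnd_simp.
have nE a b X n k : tame_path a b X x -> (k < N n)%N -> noise_of a X (g n k.+1) x - noise_of a X (g n k) x =
    noise_part theta t N (stopped tau X ^~ x) (until tau a ^~ x) n k.
  move=> p kN; rewrite (tp_noise p)//.
  - by have /andP[] := grid_bounds (gg n) (ltnW kN).
  - exact: (grid_le (gg n)).
  - by have /andP[_ /le_trans] := grid_bounds (gg n) kN; apply.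
apply: (@path_limit _ theta t c (Num.max M1 M2) N tht (ltW (normal_second_moment_gt0 R)) _ mesh_size_gt
  (fun n => level n) (stopped tau X1 ^~ x) (stopped tau X2 ^~ x) (until tau b1 ^~ x) (until tau b2 ^~ x)
  (until tau a1 ^~ x) (until tau a2 ^~ x) (w ^~ x)).
- by rewrite le_max M10.
- move=> K; near=> n; apply: (@le_trans _ _ n%:R); last by rewrite ler_nat.
  by near: n; exact: nbhs_infty_ger.
- exact: left_continuous_onW tT (within_continuous_left (tp_cont p1)).
- exact: left_continuous_onW tT (within_continuous_left (tp_cont p2)).
- exact: left_continuous_onW tT (tp_left p1).
- exact: left_continuous_onW tT (tp_left p2).
- move=> s st; have [k1 k2] := h1 s st; have [k3 k4] := h2 s st.
  by rewrite !le_max k1 k2 k3 k4 !orbT.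
- exact: it p1.
- exact: it p2.
- move=> s st; rewrite /stopped /until; case: ifP => sx; last by rewrite !mulr0 addr0.
  by rewrite min_l// tana.
move=> e e0 n0.
have [j je] : exists j, j.+1%:R^-1 < e by have [j] := ltr_add_invr e0; rewrite add0r; exists j.
have [n n0n [q1 q2 q3 q4 q5]] := fr j n0; exists n => //; split.
- apply: le_trans (ltW je); apply: le_trans q1; rewrite le_eqVlt; apply/predU1P; left.
  by congr (_ ^+ 2); apply: eq_bigr => k _; rewrite (nE _ _ _ _ _ p1)// (nE _ _ _ _ _ p2).
- apply: le_trans (ltW je); apply: le_trans q2; rewrite le_eqVlt; apply/predU1P; left.
  by apply: eq_bigr => k _; rewrite (nE _ _ _ _ _ p1).
- apply: le_trans (ltW je); apply: le_trans q3; rewrite le_eqVlt; apply/predU1P; left.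
  by apply: eq_bigr => k _; rewrite (nE _ _ _ _ _ p2).
- exact: le_trans q4 (ltW je).
- exact: le_trans q5 (ltW je).
Unshelve. all: by end_near. Qed.

End fixed_time.
End tame.

(** * The modulus of a complex exponential process *)

Section linear_equation.
Context (R : realType).
Local Notation mu := (@lebesgue_measure R).
Implicit Types (a b : R) (f : R -> R).

Lemma within_continuous_powR a b (p : R) f : {within `[a, b], continuous f} ->
  (forall s, a <= s <= b -> 0 < f s) -> {within `[a, b], continuous (fun s => f s `^ p)}.
Proof.
move=> /subspace_continuousP cf f0; apply/subspace_continuousP => s sab.
have sab' : a <= s <= b by move: sab; rewrite /= in_itv.
have E x : a <= x <= b -> f x `^ p = expR (p * ln (f x)).
  by move=> /f0 fx; rewrite /powR gt_eqF.
rewrite [X in _ --> X](E s sab').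
apply: (@cvg_trans _ (expR (p * ln (f x)) @[x --> within `[a, b]%classic (nbhs s)])).
  apply: near_eq_cvg; near=> x; apply/esym; apply: E.
  have : `[a, b]%classic x by near: x; exact: withinT.
  by rewrite /= in_itv.
apply: continuous_cvg; first exact: continuous_expR.
apply: cvgM; first exact: cvg_cst.
by apply: continuous_cvg; [apply: continuous_ln; exact: f0|exact: cf].
Unshelve. all: by end_near. Qed.

Lemma within_continuous_eq_rat a b f : a < b -> {within `[a, b], continuous f} ->
  (forall q : rat, a < ratr q < b -> f (ratr q) = 0) ->
  forall s, a <= s <= b -> f s = 0.
Proof.
move=> ab /subspace_continuousP cf fq s sab; apply/eqP/negPn/negP => fs0.
have e0 : 0 < `|f s| by rewrite normr_gt0.
have sin : `[a, b]%classic s by rewrite /= in_itv.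
have /cvgrPdist_lt/(_ _ e0) := cf s sin.
rewrite /prop_near1/within/= => -[dl /= dl0 hdl].
have /andP[as_ sb] := sab.
have lt : Num.max a (s - dl) < Num.min b (s + dl).
  by rewrite gt_max !lt_min ab/=; apply/and3P; split; lra.
have [q] := rat_in_itvoo lt.
rewrite in_itv/= gt_max lt_min => /andP[/andP[q1 q2] /andP[q3 q4]].
have hd : `|s - ratr q| < dl by rewrite ltr_distl; apply/andP; split; lra.
have hq : `[a, b]%classic (ratr q) by rewrite /= in_itv/= !ltW.
have fq0 : f (ratr q) = 0 by apply: fq; rewrite q1.
have h : `|f s - f (ratr q)| < `|f s| := hdl (ratr q) hd hq.
by move: h; rewrite fq0 subr0 ltxx.
Qed.

(** [Rf] is only continuous, but the right-hand side [Phi] of its equation is differentiable inside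
    the interval, and the two agree by density of the rationals. Nonnegativity of the integrand
    gives [Phi >= 1], so [ln \o Phi] can be differentiated; its derivative is [c * beta]. *)
Lemma log_linear_equation a b (c : R) (Rf beta : R -> R) : a < b -> 0 <= c ->
  {within `[a, b], continuous Rf} -> {within `[a, b], continuous beta} ->
  (forall s, a <= s <= b -> 0 <= Rf s /\ 0 <= beta s) ->
  (forall q : rat, a < ratr q < b ->
     Rf (ratr q) = 1 + c * \int[mu]_(s in `[a, ratr q]) (Rf s * beta s)) ->
  ln (Rf b) = c * \int[mu]_(s in `[a, b]) beta s.
Proof.
move=> ab c0 cR cb pos eqR.
pose k s := Rf s * beta s.
have ck : {within `[a, b], continuous k}.
  by move=> s; apply: continuousM; [exact: cR|exact: cb].
have cpt : compact `[a, b]%classic by exact: segment_compact.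
have ik : mu.-integrable `[a, b] (EFin \o k) by exact: continuous_compact_integrable.
have ib : mu.-integrable `[a, b] (EFin \o beta) by exact: continuous_compact_integrable.
pose I t := \int[mu]_(s in `[a, t]) k s.
pose Phi t := 1 + c * I t.
have cI : {within `[a, b], continuous I} by exact: parameterized_integral_continuous (ltW ab) ik.
have cPhi : {within `[a, b], continuous Phi}.
  apply/subspace_continuousP => s sab; apply: cvgD; first exact: cvg_cst.
  by apply: cvgM; [exact: cvg_cst|move/subspace_continuousP : cI; apply].
have RPhi s : a <= s <= b -> Rf s = Phi s.
  move=> sab; apply/eqP; rewrite -subr_eq0; apply/eqP; move: s sab.
  apply: (within_continuous_eq_rat ab).
    apply/subspace_continuousP => s sab; apply: cvgB.
      by move/subspace_continuousP : cR; apply.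
    by move/subspace_continuousP : cPhi; apply.
  by move=> q qab; rewrite eqR// subrr.
have Phi1 s : a <= s <= b -> 1 <= Phi s.
  move=> /andP[as_ sb]; rewrite lerDl mulr_ge0//; apply: Rintegral_ge0 => q /=.
  rewrite in_itv/= => /andP[aq qs]; have [] := pos q; first by rewrite aq (le_trans qs).
  by move=> *; rewrite mulr_ge0.
have Phi0 s : a <= s <= b -> 0 < Phi s by move=> /Phi1; exact: lt_le_trans.
have dF t : a < t < b -> is_derive t 1 (@ln R \o Phi : R -> R) (c * beta t).
  move=> /andP[at_ tb].
  have [+ _ _] := (continuous_within_itvP k ab).1 ck.
  move=> /(_ t); rewrite in_itv/= at_ tb => /(_ isT) ckt.
  have [dI dIE] := continuous_FTC1_closed tb ik at_ ckt.
  have isdI : is_derive t 1 (I : R -> R) (k t).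
    by rewrite derive1E in dIE; apply: DeriveDef.
  have tab : a <= t <= b by rewrite !ltW.
  have dPhi : is_derive t 1 (Phi : R -> R) (0 + c *: k t).
    exact: (is_deriveD (is_derive_cst (1 : R) t (1 : R)) (is_deriveZ c isdI)).
  have := is_derive1_comp (is_derive1_ln (Phi0 t tab)) dPhi.
  rewrite (_ : _ * _ = c * beta t)// add0r /GRing.scale/= /k (RPhi t tab).
  by field; rewrite gt_eqF// Phi0.
have cln : {within `[a, b], continuous (@ln R \o Phi)}.
  apply/subspace_continuousP => s sab; apply: continuous_cvg.
    by apply: continuous_ln; apply: Phi0; move: sab; rewrite /= in_itv.
  by move/subspace_continuousP : cPhi; apply.
have [_ cl cr] := (continuous_within_itvP (@ln R \o Phi : R -> R) ab).1 cln.
have := @continuous_FTC2 R (fun s => c * beta s) (@ln R \o Phi) a b ab _ _ _.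
rewrite /= (_ : Phi a = 1) ?ln1; last by rewrite /Phi /I set_itv1 Rintegral_set1 mulr0 addr0.
move=> ftc; rewrite (RPhi b) ?lexx ?ltW// -RintegralZl//.
rewrite /Rintegral ftc; last 3 first.
- apply/subspace_continuousP => s sab; apply: cvgM; first exact: cvg_cst.
  by move/subspace_continuousP : cb; apply.
- split; [|exact: cl|exact: cr].
  by move=> t; rewrite in_itv => /dF h; exact: ex_derive.
- by move=> t; rewrite in_itv => /dF h; rewrite derive1E derive_val.
by rewrite sube0.
Qed.

End linear_equation.

Section modulus.
Context (d : measure_display) (Omega : measurableType d) (R : realType).
Variables (P : probability Omega R) (theta T : R) (F : R -> set (set Omega)).
Variables (w : R -> Omega -> R) (tau : Omega -> R).
Hypotheses (theta_lt_T : theta < T).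
Hypotheses (F_filtration : is_filtration P theta T F) (w_wiener : is_wiener P theta T F w).
Hypotheses (tau_range : {ae P, forall x, theta < tau x <= T}).
Local Notation c := (normal_second_moment R).
Local Notation mu := (@lebesgue_measure R).

Lemma Re_i_mul_div (z : R[i]) (r : R) : complex.Re ('i%C * z / (r%:C)%C) = - complex.Im z / r.
Proof.
rewrite -fmorphV; case: z => u v /=; ring.
Qed.

Lemma Im_i_mul_div (z : R[i]) (r : R) : complex.Im ('i%C * z / (r%:C)%C) = complex.Re z / r.
Proof.
rewrite -fmorphV; case: z => u v /=; ring.
Qed.

Lemma adapted_continuous_path (X : R -> Omega -> R) x : theta < tau x <= T ->
  {within `[theta, T], continuous (stopped tau X ^~ x)} ->
  {within `[theta, tau x], continuous (X ^~ x)}.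
Proof.
move=> /andP[h1 h2] cX.
apply: (@subspace_eq_continuous _ _ _ (stopped tau X ^~ x)).
  by move=> s; rewrite inE/= in_itv/= => /andP[_ sx]; rewrite /stopped min_l.
by apply: continuous_subspaceW cX; apply: subset_itvl; rewrite bnd_simp.
Qed.

(** A null set common to all times is obtained for countably many of them only, hence the rationals,
    enumerated by [unpickle]. Before [tau], stopping the processes and cutting the integrands have
    no effect. *)
Lemma tangential_ito (a1 b1 X1 a2 b2 X2 : R -> Omega -> R) :
  tame P theta T F w tau a1 b1 X1 -> tame P theta T F w tau a2 b2 X2 ->
  (forall s x, X1 s x * b1 s x + X2 s x * b2 s x = 0) ->
  (forall s x, X1 s x * a1 s x + X2 s x * a2 s x = 0) ->
  {ae P, forall x, forall q : rat, theta < ratr q < tau x ->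
    X1 (ratr q) x ^+ 2 + X2 (ratr q) x ^+ 2 = X1 theta x ^+ 2 + X2 theta x ^+ 2 +
    c * \int[mu]_(s in `[theta, ratr q]) (b1 s x ^+ 2 + b2 s x ^+ 2)}.
Proof.
move=> t1 t2 tanb tana.
have h : {ae P, forall x, forall n (q : rat), unpickle n = Some q -> theta < ratr q <= T ->
    stopped tau X1 (ratr q) x ^+ 2 + stopped tau X2 (ratr q) x ^+ 2 =
    stopped tau X1 theta x ^+ 2 + stopped tau X2 theta x ^+ 2 +
    c * (\int[mu]_(s in `[theta, ratr q]) (until tau b1 s x ^+ 2) +
         \int[mu]_(s in `[theta, ratr q]) (until tau b2 s x ^+ 2))}.
  apply: ae_foralln => n; case E : (@unpickle rat n) => [q|]; last exact: aeW.
  have [/andP[q1 q2]|nq] := boolP (theta < ratr q <= T :> bool); last first.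
    by apply: aeW => x q' [<-]; rewrite (negbTE nq).
  have := tangential_ito_at theta_lt_T F_filtration w_wiener tau_range q1 q2 t1 t2 tanb tana.
  by apply: filterS => x hx q' [<-].
apply: filterS (aeI h (aeI (tame_path_ae theta_lt_T tau_range t1) (tame_path_ae theta_lt_T tau_range t2))).
move=> x [hx [p1 p2]] q /andP[q1 q2].
have /andP[x1 x2] := tp_tau p1.
have qT : theta < ratr q <= T by rewrite q1 (le_trans (ltW q2)).
have := hx _ q (pickleK q) qT.
rewrite /stopped !(min_l (ltW q2)) !(min_l (ltW x1)) => ->; congr (_ + c * _).
have e (b : R -> Omega -> R) : {in `[theta, ratr q]%classic,
    (fun s => until tau b s x ^+ 2) =1 (fun s => b s x ^+ 2)}.
  by move=> s; rewrite inE/= in_itv/= => /andP[_ sq]; rewrite /until (le_trans sq (ltW q2)).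
have i b a X : tame_path theta T tau a b X x ->
    mu.-integrable `[theta, ratr q] (EFin \o (fun s => b s x ^+ 2)).
  move=> p; apply: continuous_compact_integrable; first exact: segment_compact.
  have cb : {within `[theta, ratr q], continuous (b ^~ x)}.
    apply: continuous_subspaceW (tp_contb p).
    by apply: subset_itvl; rewrite bnd_simp ltW.
  by move=> s; apply: continuousM; exact: cb.
have E b : \int[mu]_(s in `[theta, ratr q]) (until tau b s x ^+ 2) =
    \int[mu]_(s in `[theta, ratr q]) (b s x ^+ 2) by apply: eq_Rintegral; exact: e.
by rewrite !E RintegralD//; [exact: i p1|exact: i p2].
Qed.

(** The drift [a] leaves no trace, since multiplication by [i Y] makes its contribution orthogonal
    to [Y]. The factor 1/2 comes from the square root in the modulus, and [sigma ^+ 2] from the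
    squared diffusion coefficient. *)
Lemma log_modulus (sigma gamma h : R) (a y : R -> Omega -> R) (Y : R -> Omega -> R[i]) :
  {ae P, forall x, {within `[theta, T], continuous (stopped tau y ^~ x)}} ->
  {ae P, forall x, 0 < inf [set y s x | s in `[theta, tau x]]} ->
  adapted_continuous P theta T F tau (fun s x => complex.Re (Y s x)) ->
  adapted_continuous P theta T F tau (fun s x => complex.Im (Y s x)) ->
  {ae P, forall x, Y theta x = 1} ->
  complex_ito_driven P theta T F w tau (fun s x => 'i%C * Y s x / (y s x `^ h)%:C%C)
    a (fun s x => sigma * y s x `^ gamma) y Y ->
  {ae P, forall x, ln (Normc.normc (Y (tau x) x)) =
    c * sigma ^+ 2 / 2 * \int[mu]_(s in `[theta, tau x]) y s x `^ (2 * (gamma - h))}.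
Proof.
move=> cy yinf aU aV Y1 [_ eU eV].
pose U s x := complex.Re (Y s x); pose V s x := complex.Im (Y s x).
pose beta s x := sigma * y s x `^ gamma / y s x `^ h.
have y_pos : {ae P, forall x, [/\ theta < tau x <= T,
    {within `[theta, tau x], continuous (y ^~ x)} & forall s, theta <= s <= tau x -> 0 < y s x]}.
  apply: filterS (aeI tau_range (aeI cy yinf)) => x [tx [cx ix]]; split => //.
    exact: adapted_continuous_path.
  move=> s sx; apply: (lt_le_trans ix); apply: ge_inf; last by exists s => //=; rewrite in_itv.
  (* [inf] takes the value 0 on a set without an infimum, so its positivity shows that the path is
     bounded below. *)
  by apply: contrapT => nlb; move: ix; rewrite inf_out ?ltxx// => -[].
have cbeta x : {within `[theta, tau x], continuous (y ^~ x)} ->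
    (forall s, theta <= s <= tau x -> 0 < y s x) -> {within `[theta, tau x], continuous (beta ^~ x)}.
  move=> cx px; apply/subspace_continuousP => s sx; apply: cvgM.
    apply: cvgM; first exact: cvg_cst.
    by have /subspace_continuousP := @within_continuous_powR R _ _ gamma _ cx px; apply.
  apply: cvgV.
    by rewrite gt_eqF// powR_gt0// px//; move: sx; rewrite /= in_itv.
  by have /subspace_continuousP := @within_continuous_powR R _ _ h _ cx px; apply.
pose bU s x := complex.Re ('i%C * Y s x / (y s x `^ h)%:C%C) * (sigma * y s x `^ gamma).
pose bV s x := complex.Im ('i%C * Y s x / (y s x `^ h)%:C%C) * (sigma * y s x `^ gamma).
have bUE s x : bU s x = - V s x * beta s x by rewrite /bU Re_i_mul_div /beta /V; ring.
have bVE s x : bV s x = U s x * beta s x by rewrite /bV Im_i_mul_div /beta /U; ring.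
have cUV x : theta < tau x <= T -> {within `[theta, T], continuous (stopped tau U ^~ x)} ->
    {within `[theta, T], continuous (stopped tau V ^~ x)} ->
    {within `[theta, tau x], continuous (U ^~ x)} /\ {within `[theta, tau x], continuous (V ^~ x)}.
  by move=> tx cU cV; split; exact: adapted_continuous_path.
pose dU s x := complex.Re ('i%C * Y s x / (y s x `^ h)%:C%C) * a s x.
pose dV s x := complex.Im ('i%C * Y s x / (y s x `^ h)%:C%C) * a s x.
have tU : tame P theta T F w tau dU bU U.
  split; [exact: aU|exact: eU|].
  apply: filterS (aeI y_pos (aeI aU.2 aV.2)) => x [[tx cx px] [cU cV]].
  have [cU' cV'] := cUV x tx cU cV; have cb := cbeta x cx px.
  rewrite (_ : bU ^~ x = fun s => - V s x * beta s x); last by apply/funext => s; rewrite bUE.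
  apply/subspace_continuousP => s sx; apply: cvgM.
    by apply: cvgN; move/subspace_continuousP : cV'; apply.
  by move/subspace_continuousP : cb; apply.
have tV : tame P theta T F w tau dV bV V.
  split; [exact: aV|exact: eV|].
  apply: filterS (aeI y_pos (aeI aU.2 aV.2)) => x [[tx cx px] [cU cV]].
  have [cU' cV'] := cUV x tx cU cV; have cb := cbeta x cx px.
  rewrite (_ : bV ^~ x = fun s => U s x * beta s x); last by apply/funext => s; rewrite bVE.
  apply/subspace_continuousP => s sx; apply: cvgM.
    by move/subspace_continuousP : cU'; apply.
  by move/subspace_continuousP : cb; apply.
(* Both orthogonality relations are algebraic and hold at every [s] and [x], even where the divisor
   is 0, since its inverse is then 0. *)
have tanb s x : U s x * bU s x + V s x * bV s x = 0 by rewrite bUE bVE; ring.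
have tana s x : U s x * dU s x + V s x * dV s x = 0.
  by rewrite /dU /dV Re_i_mul_div Im_i_mul_div /U /V; ring.
have ito := tangential_ito tU tV tanb tana.
apply: filterS (aeI y_pos (aeI Y1 (aeI ito (aeI aU.2 aV.2)))) => x [[tx cx px] [Yx [itox [cU cV]]]].
have [cU' cV'] := cUV x tx cU cV; have cb := cbeta x cx px.
have /andP[tx1 _] := tx.
pose Rf s := U s x ^+ 2 + V s x ^+ 2.
have cR : {within `[theta, tau x], continuous Rf}.
  apply/subspace_continuousP => s sx; apply: cvgD; apply: cvgM.
  - by move/subspace_continuousP : cU'; apply.
  - by move/subspace_continuousP : cU'; apply.
  - by move/subspace_continuousP : cV'; apply.
  - by move/subspace_continuousP : cV'; apply.
have cb2 : {within `[theta, tau x], continuous (fun s => beta s x ^+ 2)}.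
  apply/subspace_continuousP => s sx.
  by apply: cvgM; move/subspace_continuousP : cb; apply.
have logR : ln (Rf (tau x)) = c * \int[mu]_(s in `[theta, tau x]) (beta s x ^+ 2).
  apply: (log_linear_equation tx1 (ltW (normal_second_moment_gt0 R)) cR cb2).
    by move=> s _; rewrite addr_ge0 ?sqr_ge0.
  move=> q qx; rewrite /Rf (itox q qx) /U /V Yx/= expr1n expr0n/= addr0.
  congr (_ + c * _); apply: eq_Rintegral => s _; rewrite bUE bVE /U /V; ring.
have beta2 : {in `[theta, tau x]%classic, (fun s => beta s x ^+ 2) =1
    (fun s => sigma ^+ 2 * y s x `^ (2 * (gamma - h)))}.
  move=> s; rewrite inE/= in_itv/= => /px ys.
  rewrite /beta -mulrA -powRB; last by rewrite (gt_eqF ys) implybT.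
  rewrite exprMn; congr (_ * _).
  by rewrite -powR_mulrn ?powR_ge0// -powRrM mulrC.
have iy : mu.-integrable `[theta, tau x] (EFin \o (fun s => y s x `^ (2 * (gamma - h)))).
  apply: continuous_compact_integrable; first exact: segment_compact.
  exact: within_continuous_powR.
rewrite (eq_Rintegral mu beta2) RintegralZl// in logR.
have -> : Normc.normc (Y (tau x) x) = Num.sqrt (Rf (tau x)).
  by rewrite /Rf /U /V; case: (Y (tau x) x).
rewrite -powR12_sqrt; last by rewrite addr_ge0 ?sqr_ge0.
by rewrite ln_powR logR; ring.
Qed.

End modulus.

Unset Implicit Arguments.

Theorem proposition4p1
  (d : measure_display) (Omega : measurableType d) (R : realType)
  (P : probability Omega R) (P_complete : measure_is_complete P)
  (theta T : R) (theta_lt_T : theta < T)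
  (F : R -> set (set Omega)) (F_filtration : is_filtration P theta T F)
  (w : R -> Omega -> R) (w_wiener : is_wiener P theta T F w)
  (gamma sigma : R) (gamma01 : 0 <= gamma <= 1) (sigma_gt0 : 0 < sigma)
  (f : (R -> R) -> R -> Omega -> R) (f_drift : is_drift P theta T F f)
  (tau : Omega -> R) (tau_stopping : stopping_time theta T F tau)
  (tau_range : {ae P, forall x, theta < tau x <= T})
  (y : R -> Omega -> R)
  (y_start : {ae P, forall x, 0 < y theta x})
  (y_adapted_cont : adapted_continuous P theta T F tau y)
  (y_inf : {ae P, forall x, 0 < inf [set y s x | s in `[theta, tau x]]})
  (y_eq : ito_equation P theta T F w tau
     (fun s x => f (stopped tau y ^~ x) s x)
     (fun s x => sigma * y s x `^ gamma) y)
  (Y : R -> R -> Omega -> R[i])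
  (Y_adapted_cont : forall h : R, 0 <= h <= 1 ->
     adapted_continuous P theta T F tau (fun s x => complex.Re (Y h s x)) /\
     adapted_continuous P theta T F tau (fun s x => complex.Im (Y h s x)))
  (Y_start : forall h : R, 0 <= h <= 1 -> {ae P, forall x, Y h theta x = 1})
  (Y_eq : forall h : R, 0 <= h <= 1 ->
     complex_ito_driven P theta T F w tau
       (fun s x => 'i%C * Y h s x / (y s x `^ h)%:C%C)
       (fun s x => f (stopped tau y ^~ x) s x)
       (fun s x => sigma * y s x `^ gamma) y (Y h))
  (h1 h2 : R) (h1_01 : 0 <= h1 <= 1) (h2_01 : 0 <= h2 <= 1) :
  {ae P, forall x,
    (\int[lambda R]_(s in `[theta, tau x]) y s x `^ (2 * (gamma - h1))) /
    (\int[lambda R]_(s in `[theta, tau x]) y s x `^ (2 * (gamma - h2)))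
    = ln (Normc.normc (Y h1 (tau x) x)) / ln (Normc.normc (Y h2 (tau x) x))}.
Proof.
have log h : 0 <= h <= 1 -> _ := fun h01 =>
  log_modulus theta_lt_T F_filtration w_wiener tau_range y_adapted_cont.2 y_inf
    (Y_adapted_cont h h01).1 (Y_adapted_cont h h01).2 (Y_start h h01) (Y_eq h h01).
apply: filterS2 (log h1 h1_01) (log h2 h2_01) => x -> ->.
have k0 : normal_second_moment R * sigma ^+ 2 / 2 != 0.
  by rewrite gt_eqF// divr_gt0// mulr_gt0 ?normal_second_moment_gt0// exprn_gt0.
by rewrite -mulf_div divff// mul1r.
Qed.
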